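(* Let $F:\mathcal H\to\mathcal K$ be a frame operator and let $\{H_r\}_{r\in\mathbb R}$ be a path of self-adjoint operators, $H_r=H_0+V_r$, $V_r=F^*J_rF$, where each $J_r$ is a bounded self-adjoint operator on $\mathcal K$, $J_0=0$, and $r\mapsto J_r\in\mathcal B(\mathcal K)$ is continuous and piecewise real-analytic. Let $\lambda\in\Lambda(H_0;F)$. Then the scattering matrix $S(\lambda;H_r,H_0)$ is a meromorphic function of $r$ with values in $1+\mathcal L_1(\mathfrak h_\lambda(H_0))$, which admits analytic continuation to all resonance points of the path $\{H_r\}$ (i.e. its Laurent expansion, as a function of $r$, in a neighbourhood of any point of $R(\lambda;\{H_r\},F)$ has no negative powers).
   Context: Inner products are linear in the second variable; $R_z(H)=(H-z)^{-1}$; $\operatorname{Im}T=(T-T^* )/2i$; $\mathcal L_1$ denotes trace-class operators. $\mathcal H,\mathcal K$ are complex separable Hilbert spaces. Frame: $F=\sum_j\kappa_j\langle\varphi_j,\cdot\rangle\psi_j$, with $(\kappa_j)\in\ell_2$ a decreasing sequence of positive numbers, $(\varphi_j)$, $(\psi_j)$ orthonormal bases of $\mathcal H$, $\mathcal K$. $|F|=\sqrt{F^*F}$. For $\alpha=\pm1$, $\mathcal H_\alpha$ is the completion of $\operatorname{span}\{\varphi_j\}$ in the norm $\||F|^{-\alpha}f\|$; $\mathcal H_1\subset\mathcal H\subset\mathcal H_{-1}$, and $\langle\cdot,\cdot\rangle_{1,-1}$ is the pairing extending $\langle\cdot,\cdot\rangle$. Piecewise real-analytic: there is an increasing sequence $(r_j)$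 (finite or infinite) without finite accumulation points such that $J$ restricted to each $[r_{j-1},r_j]$ extends analytically in norm to a neighbourhood of it. $\Lambda(H;F)$ is the set of $\lambda\in\mathbb R$ such that, as $y\to0^+$, $FR_{\lambda+iy}(H)F^*$ converges in operator norm and $F\operatorname{Im}R_{\lambda+iy}(H)F^*$ converges in trace-class norm. Resonance set: for $\lambda\in\Lambda(H_0;F)$, $R(\lambda;\{H_r\},F)$ is the set of real $s$ such that $1+J_sT_{\lambda+i0}(H_0)$ is not invertible, where $T_{\lambda+i0}(H_0)=\lim_{y\to0^+}FR_{\lambda+iy}(H_0)F^*$; its elements are the resonance points of the path. For $s\notin R(\lambda;\{H_r\},F)$ one has $\lambda\in\Lambda(H_s;F)$. Evaluation operator: for $\lambda\in\Lambda(H;F)$ let $\phi(\lambda)=\frac1\pi\big(\kappa_i\kappa_j\langle\varphi_i,\operatorname{Im}R_{\lambda+i0}(H)\varphi_j\rangle\big)_{i,j}$ (entries being limits as $y\to0^+$), a non-negative trace-class operator on $\ell_2$, $\eta(\lambda)=\sqrt{\phi(\lambda)}$, and $\eta_j(\lambda)\in\ell_2$ the $j$-th column of $\eta(\lambda)$. Then $\mathcal E_\lambda(H):\mathcal H_1\to\ell_2$ is the Hilbert–Schmidt operator $\sum_j\beta_j\kappa_j\varphi_j\mapsto\sum_j\beta_j\eta_j(\lambda)$, $(\beta_j)\in\ell_2$, and $\mathfrak h_\lambda(H)\subset\ell_2$ is the closure of its range. Wave and scattering matrices: for $\lambda\in\Lambda(H_r;F)\cap\Lambda(H_0;F)$,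 $\mathfrak a_\pm(\lambda;H_r,H_0):\mathcal H_1\to\mathcal H_{-1}$ is the trace-class limit, as $y\to0^+$, of $\frac y\pi R_{\lambda\mp iy}(H_r)R_{\lambda\pm iy}(H_0)$; $w_\pm(\lambda;H_r,H_0):\mathfrak h_\lambda(H_0)\to\mathfrak h_\lambda(H_r)$ is the bounded operator with $\langle\mathcal E_\lambda(H_r)f,w_\pm\mathcal E_\lambda(H_0)g\rangle=\langle f,\mathfrak a_\pm(\lambda;H_r,H_0)g\rangle_{1,-1}$ for all $f,g\in\mathcal H_1$; and $S(\lambda;H_r,H_0)=w_+^*(\lambda;H_r,H_0)w_-(\lambda;H_r,H_0)$, defined for $r\notin R(\lambda;\{H_r\},F)$.
   Formalization: As J_r is only piecewise analytic, S is shown meromorphic on each closed interval of analyticity (one-sidedly at break points), not across them (false for J_r=|r|J), and resonance points are discrete there unless the whole interval is resonant, where S is undefined. *)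

(* Defs.v *)
From HB Require Import structures.
From mathcomp Require Import all_boot all_order all_algebra.
From mathcomp Require Import complex.
From mathcomp Require Import all_classical reals ereal topology normedtype.
From mathcomp Require Import sequences esum trigo.
From mathcomp Require Import ring lra.

Set Implicit Arguments.
Unset Strict Implicit.
Unset Printing Implicit Defensive.

Import Order.TTheory GRing.Theory Num.Theory.
Import numFieldNormedType.Exports.

Local Open Scope classical_set_scope.
Local Open Scope complex_scope.
Local Open Scope ring_scope.

HB.mixin Record CompleteNormedModule_isHilbert (R : realType) T
    & CompleteNormedModule R[i] T := {
  dot : T -> T -> R[i];
  dotC : forall x y, dot y x = (dot x y)^*%C;
  dotDr : forall x y z, dot x (y + z) = dot x y + dot x z;
  dotZr : forall a x y, dot x (a *: y) = a * dot x y;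
  dot_norm : forall x, dot x x = `|x| ^+ 2
}.

#[short(type="hilbertType")]
HB.structure Definition Hilbert (R : realType) :=
  {T of CompleteNormedModule R[i] T & CompleteNormedModule_isHilbert R T}.

HB.factory Record Lmodule_isHilbert (R : realType) T & GRing.Lmodule R[i] T := {
  dot : T -> T -> R[i];
  dotC : forall x y, dot y x = (dot x y)^*%C;
  dotDr : forall x y z, dot x (y + z) = dot x y + dot x z;
  dotZr : forall a x y, dot x (a *: y) = a * dot x y;
  dot_ge0 : forall x, 0 <= dot x x;
  dot_eq0 : forall x, dot x x = 0 -> x = 0;
  dot_complete : forall u : nat -> T,
    (forall e : R, 0 < e -> exists N, forall m n, (N <= m)%N -> (N <= n)%N ->
      complex.Re (dot (u m - u n) (u m - u n)) < e) ->
    exists l, forall e : R, 0 < e -> exists N, forall n, (N <= n)%N ->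
      complex.Re (dot (u n - l) (u n - l)) < e
}.

HB.builders Context R T & Lmodule_isHilbert R T.

Let q (x : T) : R := complex.Re (dot x x).

Let q_ge0 x : 0 <= q x.
Proof. by have := dot_ge0 x; rewrite lecE => /andP[]. Qed.

Let dotE x : dot x x = (q x)%:C.
Proof.
have := dot_ge0 x; rewrite lecE /q => /andP[/eqP].
by case: (dot x x) => a b /= ->.
Qed.

Let q0 x : q x = 0 -> x = 0.
Proof. by move=> qx; apply: dot_eq0; rewrite dotE qx. Qed.

Let dotDl x y z : dot (x + y) z = dot x z + dot y z.
Proof.
by rewrite [LHS]dotC dotDr [dot x z]dotC [dot y z]dotC rmorphD.
Qed.

Let dotZl a x y : dot (a *: x) y = a^*%C * dot x y.
Proof.
by rewrite [LHS]dotC dotZr [dot x y]dotC rmorphM.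
Qed.

Let qZ a x : q (a *: x) = (ComplexField.Normc.normc a) ^+ 2 * q x.
Proof.
rewrite {1}/q dotZl dotZr dotE; case: a => a b /=.
rewrite sqr_sqrtr ?addr_ge0 ?sqr_ge0//; simpc => /=.
by rewrite mulrDl !mulrA -!expr2.
Qed.

Let qD x y : q (x + y) = q x + q y + (complex.Re (dot x y)) *+ 2.
Proof.
rewrite /q dotDl !dotDr [dot y x]dotC.
case: (dot x x) => a b; case: (dot y y) => c d; case: (dot x y) => e f /=.
by rewrite mulr2n addrACA [RHS]addrACA [c + e]addrC.
Qed.

Let cauchy_schwarz x y : complex.Re (dot x y) ^+ 2 <= q x * q y.
Proof.
have [/eqP y0|qy0] := eqVneq (q y) 0.
  have -> : dot x y = 0.
    have -> : y = 0 *: y by rewrite scale0r; apply/q0/eqP.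
    by rewrite dotZr mul0r.
  by rewrite /= expr0n/= mulr_ge0 ?q_ge0.
have qyp : 0 < q y by rewrite lt_neqAle eq_sym qy0 q_ge0.
set r := complex.Re (dot x y).
have := q_ge0 (x + (- (r / q y))%:C *: y).
rewrite qD qZ dotZr/= expr0n/= addr0 sqr_sqrtr ?sqr_ge0//.
have -> : complex.Re ((- (r / q y))%:C * dot x y) = - (r ^+ 2 / q y).
  rewrite expr2 -mulrA [_ * (_ / _)]mulrC /r.
  by case: (dot x y) => a b /=; rewrite !mulNr !mul0r oppr0 !addr0 ?subr0.
have -> : (- (r / q y)) ^+ 2 * q y = r ^+ 2 / q y.
  by rewrite sqrrN expr2 -mulrA divfK// mulrAC -expr2.
rewrite mulr2n addrA addrK subr_ge0.
by rewrite ler_pdivrMr.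
Qed.

Let norm (x : T) : R[i] := (Num.sqrt (q x))%:C.

Let norm_triangle x y : norm (x + y) <= norm x + norm y.
Proof.
rewrite /norm -rmorphD lecR -[leRHS]ger0_norm ?addr_ge0 ?sqrtr_ge0//.
rewrite -sqrtr_sqr ler_sqrt ?sqr_ge0// sqrrD !sqr_sqrtr ?q_ge0// qD.
rewrite [leRHS]addrAC lerD2l lerMn2r/= -sqrtrM ?q_ge0//.
apply: le_trans (ler_norm _) _.
by rewrite -sqrtr_sqr ler_sqrt ?mulr_ge0 ?q_ge0// cauchy_schwarz.
Qed.

Let norm_scale (a : R[i]) x : norm (a *: x) = `|a| * norm x.
Proof.
rewrite /norm qZ sqrtrM ?sqr_ge0// sqrtr_sqr ger0_norm.
  by rewrite rmorphM; case: a.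
by case: a => a b /=; rewrite sqrtr_ge0.
Qed.

Let norm_eq0 x : norm x = 0 -> x = 0.
Proof.
move=> /complexI /eqP; rewrite sqrtr_eq0 => qx; apply/q0/eqP.
by rewrite eq_le qx q_ge0.
Qed.

HB.instance Definition _ :=
  Lmodule_isNormed.Build R[i] T norm_triangle norm_scale norm_eq0.

Let normE (x : T) : `|x| = (Num.sqrt (q x))%:C.
Proof. by []. Qed.

Let dot_norm (x : T) : dot x x = `|x| ^+ 2.
Proof. by rewrite normE dotE -rmorphXn/= sqr_sqrtr ?q_ge0. Qed.

Let qlt (x : T) (e : R) : 0 < e -> (q x < e ^+ 2) = (`|x| < e%:C).
Proof.
move=> e0; rewrite normE ltcR.
by rewrite -{2}(ger0_norm (ltW e0)) -sqrtr_sqr ltr_sqrt ?exprn_gt0.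
Qed.

Let posC (e : R[i]) : 0 < e -> e = (complex.Re e)%:C /\ 0 < complex.Re e.
Proof. by case: e => a b; rewrite ltcE /= => /andP[/eqP -> ->]. Qed.

Let complete (F : set_system T) : ProperFilter F -> cauchy F -> cvg F.
Proof.
move=> FF /cauchyP Fc.
have inv0 n : 0 < (n.+1%:R^-1 : R)%:C by rewrite ltcR invr_gt0.
have /choice[u Fu] : forall n, exists x, F (ball x (n.+1%:R^-1 : R)%:C).
  by move=> n; apply: Fc.
have uu m n : `|u m - u n| < (m.+1%:R^-1 + n.+1%:R^-1 : R)%:C.
  have [z [/= zm zn]] := filter_ex (filterI (Fu m) (Fu n)).
  apply: le_lt_trans (ler_distD z _ _) _.
  move: zm zn; rewrite -!ball_normE /= => zm zn.
  by rewrite rmorphD ltrD// distrC.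
have small (e : R) : 0 < e ->
    exists N, forall n, (N <= n)%N -> n.+1%:R^-1 < e.
  move=> e0; exists (Num.truncn e^-1) => n Nn.
  rewrite -[ltRHS]invrK ltf_pV2 ?posrE ?invr_gt0//.
  by rewrite (lt_le_trans (truncnS_gt _))// ler_nat.
have [l ul] : exists l, forall e : R, 0 < e -> exists N, forall n,
    (N <= n)%N -> q (u n - l) < e.
  apply: dot_complete => e e0.
  have se0 : 0 < Num.sqrt e / 2 by rewrite divr_gt0 ?sqrtr_gt0.
  have [N HN] := small _ se0.
  exists N => m n Nm Nn; rewrite -/(q _) -[e]sqr_sqrtr ?(ltW e0)//.
  rewrite qlt ?sqrtr_gt0// (lt_trans (uu m n))// ltcR.
  by rewrite [ltRHS]splitr ltrD// HN.
apply/cvg_ex; exists l; apply/cvgrPdist_lt => e /posC[-> e0].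
have e20 : 0 < complex.Re e / 2 by rewrite divr_gt0.
have e40 : 0 < (complex.Re e / 2) ^+ 2 by rewrite exprn_gt0.
have [N1 HN1] := ul _ e40; have [N2 HN2] := small _ e20.
set n := maxn N1 N2.
apply: filterS (Fu n) => z; rewrite -ball_normE /= => zn.
apply: le_lt_trans (ler_distD (u n) _ _) _.
rewrite [complex.Re e]splitr rmorphD ltrD//.
  by rewrite distrC -qlt// HN1// leq_maxl.
by apply: lt_trans zn _; rewrite ltcR HN2// leq_maxr.
Qed.

HB.instance Definition _ := Uniform_isComplete.Build T complete.
HB.instance Definition _ :=
  CompleteNormedModule_isHilbert.Build R T dotC dotDr dotZr dot_norm.

HB.end.

Section BoundedOperators.
Context {R : realType}.

Definition bounded_linear (U V : normedModType R[i]) : {pred U -> V} :=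
  [pred f : U -> V | `[< linear f /\ continuous f >]].

Record bop (U V : normedModType R[i]) := Bop {
  bop_fun :> U -> V;
  bop_axiom : bop_fun \in @bounded_linear U V
}.

End BoundedOperators.

HB.instance Definition _ (R : realType) (U V : normedModType R[i]) :=
  [isSub for @bop_fun R U V].
HB.instance Definition _ (R : realType) (U V : normedModType R[i]) :=
  [Choice of bop U V by <:].

Section BoundedOperatorsTheory.
Context {R : realType}.
Implicit Types U V W : normedModType R[i].

Lemma bop_linear U V (A : bop U V) : linear A.
Proof. by have := bop_axiom A; rewrite inE => -[]. Qed.

Lemma bop_continuous U V (A : bop U V) : continuous A.
Proof. by have := bop_axiom A; rewrite inE => -[]. Qed.

Lemma bounded_linear_submod_closed U V : submod_closed (@bounded_linear R U V).
Proof.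
split=> [|a f g]; rewrite !inE.
  split=> [c x y|]; first by rewrite /= scaler0 addr0.
  exact: cst_continuous.
move=> [lf cf] [lg cg]; split=> [c x y|x].
  rewrite /= !fctE lf lg !scalerDr addrACA; congr (_ + _ + (_ + _)).
  by rewrite !scalerA mulrC.
by apply: cvgD; [apply: cvgZr; exact: cf|exact: cg].
Qed.

HB.instance Definition _ U V :=
  GRing.isSubmodClosed.Build _ _ (@bounded_linear R U V)
    (bounded_linear_submod_closed U V).

HB.instance Definition _ U V :=
  [SubChoice_isSubLmodule of bop U V by <:].

Lemma id_bounded_linear U : (@id U) \in @bounded_linear R U U.
Proof. by rewrite inE; split=> // x; exact: cvg_id. Qed.

Definition bop_id U : bop U U := Bop (id_bounded_linear U).

Lemma comp_bounded_linear U V W (A : bop V W) (B : bop U V) :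
  A \o B \in @bounded_linear R U W.
Proof.
rewrite inE; split=> [a x y|x] /=; first by rewrite !bop_linear.
apply: continuous_comp; exact: bop_continuous.
Qed.

Definition bop_comp U V W (A : bop V W) (B : bop U V) : bop U W :=
  Bop (comp_bounded_linear A B).

End BoundedOperatorsTheory.

Section ClosedRange.
Context {R : realType} (U : normedModType R[i]) (L : hilbertType R).
Variable E : bop U L.

Definition closure_range : {pred L} := [pred x | x \in closure (range E)].

Record crange := CRange {
  crange_val : L;
  crange_axiom : crange_val \in closure_range
}.

HB.instance Definition _ := [isSub for crange_val].
HB.instance Definition _ := [Choice of crange by <:].

Let closure_normP (A : set L) x :
  closure A x <-> forall e : R[i], 0 < e -> exists2 y, A y & `|x - y| < e.
Proof.
split=> [cA e e0|H B /nbhs_ballP[e /= e0 eB]].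
  have [y [Ay]] := cA _ (nbhsx_ballx x e e0).
  by rewrite -ball_normE; exists y.
have [y Ay xy] := H _ e0; exists y; split=> //; apply: eB.
by rewrite -ball_normE.
Qed.

Lemma closure_range_submod_closed : submod_closed closure_range.
Proof.
have mem0 : closure (range E) 0.
  apply: subset_closure; exists 0 => //.
  by have := bop_linear E (-1) 0 0; rewrite scaler0 addr0 scaleN1r addNr.
split=> [|a x y]; rewrite !inE// => /closure_normP Hx /closure_normP Hy.
apply/closure_normP => e e0.
have e20 : 0 < e / 2 by rewrite divr_gt0.
have a0 : 0 < `|a| + 1 by rewrite ltr_wpDl.
have [_ [u _ <-] xu] := Hx _ (divr_gt0 e20 a0).
have [_ [v _ <-] yv] := Hy _ e20.
exists (E (a *: u + v)); first by exists (a *: u + v).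
rewrite bop_linear opprD addrACA -scalerBr.
apply: le_lt_trans (ler_normD _ _) _; rewrite [ltRHS]splitr ltrD// normrZ.
apply: le_lt_trans (_ : (`|a| + 1) * `|x - E u| < _).
  by rewrite ler_wpM2r// lerDl.
by rewrite mulrC -ltr_pdivlMr.
Qed.

HB.instance Definition _ :=
  GRing.isSubmodClosed.Build _ _ closure_range closure_range_submod_closed.
HB.instance Definition _ := [SubChoice_isSubLmodule of crange by <:].

Let cdot (x y : crange) : R[i] := dot (crange_val x) (crange_val y).

Let cdotC x y : cdot y x = (cdot x y)^*%C.
Proof. exact: dotC. Qed.

Let cdotDr x y z : cdot x (y + z) = cdot x y + cdot x z.
Proof. exact: dotDr. Qed.

Let cdotZr a x y : cdot x (a *: y) = a * cdot x y.
Proof. exact: dotZr. Qed.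

Let cdot_ge0 x : 0 <= cdot x x.
Proof. by rewrite /cdot dot_norm exprn_ge0. Qed.

Let cdot_eq0 x : cdot x x = 0 -> x = 0.
Proof.
move=> /eqP; rewrite /cdot dot_norm expf_eq0/= normr_eq0 => /eqP x0.
exact: val_inj.
Qed.

Let cdot_lt (x y : crange) (e : R) : 0 < e ->
  (complex.Re (cdot (x - y) (x - y)) < e ^+ 2) =
  (`|crange_val x - crange_val y| < e%:C).
Proof.
move=> e0; rewrite /cdot dot_norm.
have -> : crange_val (x - y) = crange_val x - crange_val y by [].
set z := crange_val x - crange_val y.
have := normr_ge0 z; case: `|z| => a b; rewrite lecE/= => /andP[/eqP -> a0].
rewrite expr2 /= mulr0 subr0 -expr2 ltr_pXn2r// ?nnegrE ?(ltW e0)//.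
by rewrite -[_ +i* 0]/(a%:C) ltcR.
Qed.

Let cdot_complete (u : nat -> crange) :
  (forall e : R, 0 < e -> exists N, forall m n, (N <= m)%N -> (N <= n)%N ->
      complex.Re (cdot (u m - u n) (u m - u n)) < e) ->
  exists l, forall e : R, 0 < e -> exists N, forall n, (N <= n)%N ->
      complex.Re (cdot (u n - l) (u n - l)) < e.
Proof.
move=> uc.
have : cvg ((crange_val \o u) @ \oo).
  apply: cauchy_cvg; apply/cauchyP => e e0.
  have eE : e = (complex.Re e)%:C.
    by move: e0; case: e => a b; rewrite ltcE/= => /andP[/eqP ->].
  have re0 : 0 < complex.Re e by rewrite -ltcR -eE.
  have re20 : 0 < complex.Re e ^+ 2 by rewrite exprn_gt0.
  have [N HN] := uc _ re20.
  exists (crange_val (u N)); exists N => // n /= Nn.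
  by rewrite -ball_normE /= eE -cdot_lt// HN.
move=> /cvg_ex[l ul].
have lE : l \in closure_range.
  rewrite inE; apply: (closed_cvg _ (@closed_closure _ (range E)) _ _ ul).
  by apply: nearW => n /=; have := crange_axiom (u n); rewrite inE.
exists (CRange lE) => e e0.
have se0 : 0 < (Num.sqrt e)%:C by rewrite ltcR sqrtr_gt0.
have /cvgrPdist_lt/(_ _ se0)[N _ HN] := ul.
exists N => n Nn; rewrite -(sqr_sqrtr (ltW e0)) cdot_lt ?sqrtr_gt0//=.
by rewrite distrC; exact: HN.
Qed.

HB.instance Definition _ := Lmodule_isHilbert.Build R crange
  cdotC cdotDr cdotZr cdot_ge0 cdot_eq0 cdot_complete.

Lemma crange_map_mem (f : U) : E f \in closure_range.
Proof. by rewrite inE; apply: subset_closure; exists f. Qed.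

Definition crange_map (f : U) : crange := CRange (crange_map_mem f).

End ClosedRange.

Section SquareSummable.
Context {R : realType}.

Definition sqmod (z : R[i]) : R := complex.Re z ^+ 2 + complex.Im z ^+ 2.

Definition square_summable : {pred nat -> R[i]} :=
  [pred x | `[< cvgn (series (fun i => sqmod (x i))) >]].

Record ell2 := Ell2 {
  ell2_val :> nat -> R[i];
  ell2_axiom : ell2_val \in square_summable
}.

HB.instance Definition _ := [isSub for ell2_val].
HB.instance Definition _ := [Choice of ell2 by <:].

Let sqmod_ge0 z : 0 <= sqmod z.
Proof. by rewrite addr_ge0 ?sqr_ge0. Qed.

Let sqmodD (z w : R[i]) : sqmod (z + w) <= 2 * (sqmod z + sqmod w).
Proof.
case: z => a b; case: w => c d; rewrite /sqmod /=.
have := sqr_ge0 (a - c); have := sqr_ge0 (b - d); nra.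
Qed.

Let sqmodZ (z w : R[i]) : sqmod (z * w) = sqmod z * sqmod w.
Proof. by case: z => a b; case: w => c d; rewrite /sqmod /=; ring. Qed.

Let sum_le_cvg (f : nat -> R) (M : R) : (forall i, 0 <= f i) ->
  (forall n, series f n <= M) -> cvgn (series f) /\ limn (series f) <= M.
Proof.
move=> f0 fM.
have cf : cvgn (series f).
  apply: nondecreasing_is_cvgn; first exact: nondecreasing_series.
  by exists M => _ [n _ <-].
by split=> //; apply: limr_le => //; exact: nearW.
Qed.

Let sum_ge (f : nat -> R) n : (forall i, 0 <= f i) -> cvgn (series f) ->
  series f n <= limn (series f).
Proof. by move=> f0 cf; apply: nondecreasing_cvgn_le => //; exact: nondecreasing_series. Qed.

Let term_le (f : nat -> R) n : (forall i, 0 <= f i) -> cvgn (series f) ->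
  f n <= limn (series f).
Proof.
move=> f0 cf; apply: le_trans (sum_ge n.+1 f0 cf).
by rewrite seriesSr lerDr sumr_ge0.
Qed.

Lemma square_summable_submod_closed : submod_closed square_summable.
Proof.
split=> [|a x y]; rewrite !inE.
  apply: (@sum_le_cvg _ 0 _ _).1 => [i|n]; first exact: sqmod_ge0.
  by rewrite /series/= big1// => i _; rewrite /sqmod/= expr0n/= addr0.
move=> cx cy; pose g := 2 *: ((sqmod a *: (fun i => sqmod (x i))) + (fun i => sqmod (y i))) : nat -> R.
apply: (@series_le_cvg _ _ g) => [i|i|i|].
- exact: sqmod_ge0.
- rewrite /g; apply: mulr_ge0 => //; apply: addr_ge0; last exact: sqmod_ge0.
  by apply: mulr_ge0; exact: sqmod_ge0.
- by apply: le_trans (sqmodD _ _) _; rewrite sqmodZ.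
- by apply: is_cvg_seriesZ; apply: is_cvg_seriesD => //; exact: is_cvg_seriesZ.
Qed.

HB.instance Definition _ := GRing.isSubmodClosed.Build _ _ square_summable
  square_summable_submod_closed.
HB.instance Definition _ := [SubChoice_isSubLmodule of ell2 by <:].

(* The sum of an absolutely convergent complex series, by real and imaginary  *)
(* parts.                                                                     *)
Definition csum (z : nat -> R[i]) : R[i] :=
  limn (series (fun i => complex.Re (z i))) +i*
  limn (series (fun i => complex.Im (z i))).

Definition ell2_dot (x y : ell2) : R[i] := csum (fun i => (x i)^*%C * y i).

Let cvg_sq (x : ell2) : cvgn (series (fun i => sqmod (x i))).
Proof. by have := ell2_axiom x; rewrite inE. Qed.

Let dom_cvg (f : nat -> R) (x y : ell2) :
  (forall i, `|f i| <= sqmod (x i) + sqmod (y i)) -> cvgn (series f).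
Proof.
move=> H; apply: normed_cvg.
apply: (@series_le_cvg _ _ ((fun i => sqmod (x i)) + (fun i => sqmod (y i)))).
- by move=> n; exact: normr_ge0.
- by move=> n; apply: addr_ge0; exact: sqmod_ge0.
- exact: H.
- by apply: is_cvg_seriesD; exact: cvg_sq.
Qed.

Let cvg_Re (x y : ell2) : cvgn (series (fun i => complex.Re ((x i)^*%C * y i))).
Proof.
apply: (@dom_cvg _ x y) => i.
case: (x i) => a b; case: (y i) => c d; rewrite /sqmod /= ler_norml.
have := sqr_ge0 (a - c); have := sqr_ge0 (b - d).
have := sqr_ge0 (a + c); have := sqr_ge0 (b + d).
by move=> *; apply/andP; split; nra.
Qed.

Let cvg_Im (x y : ell2) : cvgn (series (fun i => complex.Im ((x i)^*%C * y i))).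
Proof.
apply: (@dom_cvg _ x y) => i.
case: (x i) => a b; case: (y i) => c d; rewrite /sqmod /= ler_norml.
have := sqr_ge0 (a - d); have := sqr_ge0 (b - c).
have := sqr_ge0 (a + d); have := sqr_ge0 (b + c).
by move=> *; apply/andP; split; nra.
Qed.

Let eq_series (f g : nat -> R) : f =1 g -> limn (series f) = limn (series g).
Proof. by move=> /funext ->. Qed.

Let ell2_dotC x y : ell2_dot y x = (ell2_dot x y)^*%C.
Proof.
rewrite /ell2_dot /csum /=; congr (_ +i* _).
  by apply: eq_series => i; case: (x i) => a b; case: (y i) => c d /=; ring.
rewrite -[RHS]mulN1r -[RHS]lim_seriesZ; last exact: cvg_Im.
apply: eq_series => i; rewrite fctE.
by case: (x i) => a b; case: (y i) => c d; rewrite /GRing.scale /=; ring.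
Qed.

Let ell2_dotDr x y z : ell2_dot x (y + z) = ell2_dot x y + ell2_dot x z.
Proof.
rewrite /ell2_dot /csum; simpc; congr (_ +i* _).
  rewrite -lim_seriesD; [|exact: cvg_Re|exact: cvg_Re].
  by apply: eq_series => i; rewrite !fctE mulrDr; case: (_ * _); case: (_ * _).
rewrite -lim_seriesD; [|exact: cvg_Im|exact: cvg_Im].
by apply: eq_series => i; rewrite !fctE mulrDr; case: (_ * _); case: (_ * _).
Qed.

Let ell2_dotZr a x y : ell2_dot x (a *: y) = a * ell2_dot x y.
Proof.
have valZ i : (a *: y : ell2) i = a * y i by [].
case: a valZ => c d valZ; rewrite /ell2_dot /csum; simpc; congr (_ +i* _).
  have cR := @cvg_Re x y; have cI := @cvg_Im x y.
  rewrite -mulNr -[c * _]lim_seriesZ// -[(- d) * _]lim_seriesZ//.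
  rewrite -lim_seriesD; [|exact: is_cvg_seriesZ|exact: is_cvg_seriesZ].
  apply: eq_series => i; rewrite valZ !fctE /GRing.scale /=.
  by case: (x i) => a b; case: (y i) => e f; rewrite /=; ring.
have cR := @cvg_Re x y; have cI := @cvg_Im x y.
rewrite -[c * _]lim_seriesZ// -[d * _]lim_seriesZ//.
rewrite -lim_seriesD; [|exact: is_cvg_seriesZ|exact: is_cvg_seriesZ].
apply: eq_series => i; rewrite valZ !fctE /GRing.scale /=.
by case: (x i) => a b; case: (y i) => e f; rewrite /=; ring.
Qed.

Let q (x : ell2) : R := limn (series (fun i => sqmod (x i))).

Let ell2_dotE x : ell2_dot x x = (q x)%:C.
Proof.
rewrite /ell2_dot /csum; congr (_ +i* _).
  by apply: eq_series => i; case: (x i) => a b; rewrite /sqmod /=; ring.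
rewrite [X in series X](_ : _ = (fun=> 0)); last first.
  by apply/funext => i; case: (x i) => a b /=; ring.
apply: cvg_lim => //; rewrite [X in X @ _ --> _](_ : _ = (fun=> 0)).
  exact: cvg_cst.
by apply/funext => n; rewrite /series/= big1.
Qed.

Let q_ge0 x : 0 <= q x.
Proof. apply: le_trans (sqmod_ge0 (x 0%N)) _.
by apply: (@term_le (fun i => sqmod (x i))). Qed.

Let q_term (x : ell2) i : sqmod (x i) <= q x.
Proof. by apply: (@term_le (fun i => sqmod (x i))). Qed.

Let ell2_dot_ge0 x : 0 <= ell2_dot x x.
Proof. by rewrite ell2_dotE ler0c. Qed.

Let ell2_dot_eq0 x : ell2_dot x x = 0 -> x = 0.
Proof.
rewrite ell2_dotE => /complexI qx; apply/val_inj/funext => i /=.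
have : sqmod (x i) <= 0 by rewrite -qx q_term.
rewrite /sqmod; case: (x i) => a b /= H.
have /eqP : a ^+ 2 + b ^+ 2 = 0 by apply/eqP; rewrite eq_le H addr_ge0 ?sqr_ge0.
by rewrite paddr_eq0 ?sqr_ge0// !expf_eq0/= => /andP[/eqP -> /eqP ->].
Qed.

Let R_cauchy (f : nat -> R) :
  (forall e : R, 0 < e -> exists N, forall m n, (N <= m)%N -> (N <= n)%N ->
     (f m - f n) ^+ 2 < e) -> cvgn f.
Proof.
move=> H; apply: cauchy_cvg; apply/cauchyP => e e0.
have [N HN] := H (e ^+ 2) (exprn_gt0 _ e0).
exists (f N); exists N => // n /= Nn; rewrite -ball_normE /=.
by rewrite -(gtr0_norm e0) -ltr_sqr ?nnegrE// !real_normK ?num_real// HN.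
Qed.

Let ell2_complete (u : nat -> ell2) :
  (forall e : R, 0 < e -> exists N, forall m n, (N <= m)%N -> (N <= n)%N ->
      complex.Re (ell2_dot (u m - u n) (u m - u n)) < e) ->
  exists l, forall e : R, 0 < e -> exists N, forall n, (N <= n)%N ->
      complex.Re (ell2_dot (u n - l) (u n - l)) < e.
Proof.
move=> uc.
have uq (e : R) : 0 < e -> exists N, forall m n, (N <= m)%N -> (N <= n)%N ->
    q (u m - u n) < e.
  move=> /uc[N HN]; exists N => m n Nm Nn.
  by have := HN m n Nm Nn; rewrite ell2_dotE.
have valB x y i : (x - y : ell2) i = x i - y i by [].
have uRe i : cvgn (fun n => complex.Re (u n i)).
  apply: R_cauchy => e /uq[N HN]; exists N => m n Nm Nn.
  apply: le_lt_trans (HN m n Nm Nn).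
  apply: le_trans (q_term (u m - u n) i).
  rewrite valB /sqmod; case: (u m i) => a b; case: (u n i) => c d /=.
  by rewrite lerDl sqr_ge0.
have uIm i : cvgn (fun n => complex.Im (u n i)).
  apply: R_cauchy => e /uq[N HN]; exists N => m n Nm Nn.
  apply: le_lt_trans (HN m n Nm Nn).
  apply: le_trans (q_term (u m - u n) i).
  rewrite valB /sqmod; case: (u m i) => a b; case: (u n i) => c d /=.
  by rewrite lerDr sqr_ge0.
pose l i : R[i] := limn (fun n => complex.Re (u n i)) +i*
                   limn (fun n => complex.Im (u n i)).
have key (e : R) N n : (forall m n, (N <= m)%N -> (N <= n)%N ->
    q (u m - u n) < e) -> (N <= n)%N ->
    forall k, series (fun i => sqmod (u n i - l i)) k <= e.
  move=> HN Nn k.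
  have H : series (fun i => sqmod (u n i - u m i)) k @[m --> \oo] -->
      series (fun i => sqmod (u n i - l i)) k.
    rewrite /series/=; apply: cvg_big => [|i _]; first exact: add_continuous.
    have sE (v w : R[i]) : sqmod (v - w) =
        (complex.Re v - complex.Re w) * (complex.Re v - complex.Re w) +
        (complex.Im v - complex.Im w) * (complex.Im v - complex.Im w).
      by case: v => a b; case: w => c d.
    under eq_fun do rewrite sE; rewrite sE.
    have cR : complex.Re (u n i) - complex.Re (u m i) @[m --> \oo] -->
        complex.Re (u n i) - complex.Re (l i).
      by apply: cvgB; [exact: cvg_cst|exact: uRe].
    have cI : complex.Im (u n i) - complex.Im (u m i) @[m --> \oo] -->
        complex.Im (u n i) - complex.Im (l i).
      by apply: cvgB; [exact: cvg_cst|exact: uIm].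
    by apply: cvgD; apply: cvgM.
  rewrite -(cvg_lim _ H)//; apply: limr_le; first by apply/cvg_ex; eexists; exact: H.
  exists N => // m /= Nm; apply: le_trans (ltW (HN n m Nn Nm)).
  by apply: (@sum_ge (fun i => sqmod ((u n - u m) i))).
have [N0 HN0] := uq 1 ltr01.
have dl : (fun i => u N0 i - l i) \in square_summable.
  rewrite inE; apply: (@sum_le_cvg _ 1 _ _).1 => [i|k]; first exact: sqmod_ge0.
  exact: (key _ _ _ HN0).
pose L : ell2 := u N0 - Ell2 dl.
have LE i : L i = l i.
  by rewrite /L valB /= opprB addrC subrK.
exists L => e e0; have e20 : 0 < e / 2 by rewrite divr_gt0.
have [N HN] := uq _ e20; exists N => n Nn.
rewrite ell2_dotE /=; apply: (@le_lt_trans _ _ (e / 2)).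
  apply: (@sum_le_cvg _ (e / 2) _ _).2 => [i|k]; first exact: sqmod_ge0.
  have -> : (fun i => sqmod ((u n - L) i)) = (fun i => sqmod (u n i - l i)).
    by apply/funext => i; rewrite valB LE.
  exact: (key _ _ _ HN).
by rewrite ltr_pdivrMr// ltr_pMr// ltr1n.
Qed.

HB.instance Definition _ := Lmodule_isHilbert.Build R ell2
  ell2_dotC ell2_dotDr ell2_dotZr ell2_dot_ge0 ell2_dot_eq0 ell2_complete.

Lemma ell2_delta_subproof (j : nat) :
  (fun i => (i == j)%:R : R[i]) \in square_summable.
Proof.
rewrite inE; apply: (@sum_le_cvg _ 1 _ _).1 => [i|n]; first exact: sqmod_ge0.
rewrite /series/= (eq_bigr (fun i => if i == j then 1 else 0)) => [|i _]; last first.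
  by case: eqP => _; rewrite /sqmod /= expr0n ?expr1n/= ?addr0.
rewrite -big_mkcond/= big_mkord.
have [jn|nj] := ltnP j n.
  by rewrite (big_pred1 (Ordinal jn))// => i; rewrite -val_eqE.
by rewrite big_pred0// => i; apply/eqP => ij; have := ltn_ord i; rewrite ij ltnNge nj.
Qed.

Definition ell2_delta (j : nat) : ell2 := Ell2 (ell2_delta_subproof j).

End SquareSummable.
Arguments ell2 R : clear implicits.

Section HilbertSpaceOperators.
Context {R : realType}.
Implicit Types H K L : hilbertType R.

Definition linear_span H (B : set H) : set H :=
  [set x | exists n (a : 'I_n -> R[i]) (e : 'I_n -> H),
     (forall i, B (e i)) /\ x = \sum_i a i *: e i].

Definition orthonormal_basis H (B : set H) : Prop :=
  (forall x y, B x -> B y -> dot x y = (x == y)%:R) /\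
  closure (linear_span B) = setT.

Definition orthonormal_basis_seq H (e : nat -> H) : Prop :=
  (forall i j, dot (e i) (e j) = (i == j)%:R) /\
  closure (linear_span (range e)) = setT.

(* Adjoints, square roots, resolvents and limits below are selected by their  *)
(* defining property with [xget], the default 0 being used only if no bounded *)
(* operator has that property.                                                *)
Definition adjoint H K (A : bop H K) : bop K H :=
  xget 0 [set B : bop K H | forall x y, dot (B y) x = dot y (A x)].

Definition imag_part H (A : bop H H) : bop H H :=
  (2 * 'i%C)^-1 *: (A - adjoint A).

(* On a complex Hilbert space this already makes A self-adjoint.              *)
Definition nonneg_op H (A : bop H H) : Prop := forall x, 0 <= dot x (A x).

Definition sqrt_op H (A : bop H H) : bop H H :=
  xget 0 [set B : bop H H | nonneg_op B /\ bop_comp B B = A].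

Definition abs_op H K (A : bop H K) : bop H H :=
  sqrt_op (bop_comp (adjoint A) A).

Definition invertible_op H (A : bop H H) : Prop :=
  exists B : bop H H, bop_comp A B = bop_id H /\ bop_comp B A = bop_id H.

(* The norm of a normedModType over R[i] takes its values in R[i].            *)
Definition opnorm H K (A : bop H K) : \bar R :=
  ereal_sup [set (complex.Re `|A x|)%:E | x in [set x : H | `|x| <= 1]].

(* For A >= 0 the sum does not depend on the choice of the basis.             *)
Definition trace H (A : bop H H) : \bar R :=
  \esum_(e in xget set0 [set B : set H | orthonormal_basis B])
    (complex.Re (dot e (A e)))%:E.

(* A is trace class iff trace_norm A < +oo.                                   *)
Definition trace_norm H K (A : bop H K) : \bar R := trace (abs_op A).

(* Convergence as y -> 0+, in the space normed by nrm.                        *)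
Definition converges0 H K (nrm : bop H K -> \bar R) (T : R -> bop H K)
    (A : bop H K) : Prop :=
  (nrm A < +oo)%E /\ nrm (T y - A) @[y --> 0^'+] --> 0%E.

Definition limit0 H K (nrm : bop H K -> \bar R) (T : R -> bop H K) : bop H K :=
  xget 0 [set A : bop H K | converges0 nrm T A].

(* A possibly unbounded operator; opfun is meaningful on opdom only.          *)
Record unbounded_op H := UnboundedOp {
  opdom : set H;
  opfun : H -> H
}.

Definition self_adjoint H (A : unbounded_op H) : Prop :=
  [/\ opdom A 0,
      forall (a : R[i]) x y, opdom A x -> opdom A y ->
        opdom A (a *: x + y) /\
        opfun A (a *: x + y) = a *: opfun A x + opfun A y,
      closure (opdom A) = setT &
      forall x z, (forall y, opdom A y -> dot z y = dot x (opfun A y)) <->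
        (opdom A x /\ opfun A x = z)].

Definition perturb H (A : unbounded_op H) (V : bop H H) : unbounded_op H :=
  UnboundedOp (opdom A) (fun x => opfun A x + V x).

Definition resolvent H (A : unbounded_op H) (z : R[i]) : bop H H :=
  xget 0 [set B : bop H H |
    (forall f, opdom A (B f) /\ opfun A (B f) - z *: B f = f) /\
    (forall u, opdom A u -> B (opfun A u - z *: u) = u)].

End HilbertSpaceOperators.

Section Analyticity.
Context {R : realType} (V : lmodType R[i]) (nrm : V -> \bar R).

Definition analytic_at (f : R[i] -> V) (z0 : R[i]) : Prop :=
  exists (rho : R[i]) (a : nat -> V), [/\ 0 < rho,
    forall k, (nrm (a k) < +oo)%E &
    forall z, `|z - z0| < rho -> (nrm (f z) < +oo)%E /\
      nrm (f z - \sum_(0 <= k < n) (z - z0) ^+ k *: a k) @[n --> \oo] --> 0%E].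

(* f z = \sum_k (z - z0) ^ (k - m) *: a k in a punctured disc around z0.      *)
Definition laurent_expansion (f : R[i] -> V) (z0 : R[i]) (m : nat)
    (a : nat -> V) : Prop :=
  exists rho : R[i], [/\ 0 < rho,
    forall k, (nrm (a k) < +oo)%E &
    forall z, 0 < `|z - z0| < rho -> (nrm (f z) < +oo)%E /\
      nrm (f z - \sum_(0 <= k < n) (z - z0) ^ (k%:Z - m%:Z) *: a k)
        @[n --> \oo] --> 0%E].

Definition meromorphic_at (f : R[i] -> V) (z0 : R[i]) : Prop :=
  exists m a, laurent_expansion f z0 m a.

Definition no_negative_powers (f : R[i] -> V) (z0 : R[i]) : Prop :=
  forall m a, laurent_expansion f z0 m a -> forall k, (k < m)%N -> a k = 0.

(* The closed intervals between consecutive points of N, where -oo and +oo    *)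
(* count as points of N.                                                      *)
Definition piece (N : set R) (I : set R) : Prop :=
  exists a b : \bar R, [/\ (a < b)%E,
    a = -oo%E \/ (exists2 x, N x & a = x%:E),
    b = +oo%E \/ (exists2 x, N x & b = x%:E),
    forall x, N x -> ~ (a < x%:E < b)%E &
    I = [set x | (a <= x%:E <= b)%E]].

Definition complex_neighbourhood (I : set R) (U : set R[i]) : Prop :=
  open (U : set R[i]^o) /\ forall r, I r -> U r%:C.

(* N is the range of the increasing sequence of breakpoints.                  *)
Definition piecewise_real_analytic (N : set R) (f : R -> V) : Prop :=
  limit_point N = set0 /\
  forall I, piece N I -> exists (U : set R[i]) (g : R[i] -> V),
    [/\ complex_neighbourhood I U,
        forall z, U z -> analytic_at g z &
        forall r, I r -> f r = g r%:C].

End Analyticity.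

Section Scattering.
Context {R : realType}.

Record frame (H K : hilbertType R) := Frame {
  frame_op :> bop H K;
  kappa : nat -> R;
  phi : nat -> H;
  psi : nat -> K;
  kappa_gt0 : forall j, 0 < kappa j;
  kappa_decr : forall i j, (i <= j)%N -> kappa j <= kappa i;
  kappa_l2 : cvgn (series (fun j => kappa j ^+ 2));
  phi_basis : orthonormal_basis_seq phi;
  psi_basis : orthonormal_basis_seq psi;
  frame_opE : forall f, series (fun j => ((kappa j)%:C * dot (phi j) f) *: psi j)
    @ \oo --> frame_op f
}.

(* H_1 and H_{-1} as completions of the span of (phi_j) for the norms         *)
(* || |F|^{-1} f || and || |F| f ||, together with the inclusions             *)
(* H_1 -> H -> H_{-1}. Completions being unique up to isometry, results are   *)
(* to be stated for an arbitrary rigging.                                     *)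
Record rigging (H K : hilbertType R) (F : frame H K) := Rigging {
  Hplus : hilbertType R;
  Hminus : hilbertType R;
  plus_incl : bop Hplus H;
  minus_incl : bop H Hminus;
  plus_span : forall f, linear_span (range (phi F)) f ->
    exists u, plus_incl u = f;
  plus_norm : forall u g, linear_span (range (phi F)) (plus_incl u) ->
    abs_op F g = plus_incl u -> `|u| = `|g|;
  plus_dense :
    closure [set u | linear_span (range (phi F)) (plus_incl u)] = setT;
  minus_norm : forall f, linear_span (range (phi F)) f ->
    `|minus_incl f| = `|abs_op F f|;
  minus_dense :
    closure [set minus_incl f | f in linear_span (range (phi F))] = setT
}.

Variables (H K : hilbertType R) (F : frame H K) (G : rigging F).
Implicit Types (A : unbounded_op H) (lambda : R) (J : R -> bop K K).

(* <f, v>_{1,-1}: the continuous extension of v = g |-> <f, g> from H to      *)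
(* H_{-1}.                                                                    *)
Definition pairing (f : Hplus G) : bop (Hminus G) R[i]^o :=
  xget 0 [set p : bop (Hminus G) R[i]^o |
    forall g : H, p (minus_incl G g) = dot (plus_incl G f) g].

Definition sandwich (X : bop H H) : bop K K :=
  bop_comp F (bop_comp X (adjoint F)).

Definition Lambda A : set R := [set lambda |
  (exists T, converges0 (@opnorm R K K)
     (fun y => sandwich (resolvent A (lambda +i* y))) T) /\
  (exists T, converges0 (@trace_norm R K K)
     (fun y => sandwich (imag_part (resolvent A (lambda +i* y)))) T)].

Definition sandwich_limit A lambda : bop K K :=
  limit0 (@opnorm R K K) (fun y => sandwich (resolvent A (lambda +i* y))).

Definition perturbed_path A J (r : R) : unbounded_op H :=
  perturb A (bop_comp (adjoint F) (bop_comp (J r) F)).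

Definition resonance_set A J lambda : set R :=
  [set s | ~ invertible_op
     (bop_id K + bop_comp (J s) (sandwich_limit A lambda))].

Definition phi_matrix A lambda : bop (ell2 R) (ell2 R) :=
  xget 0 [set P : bop (ell2 R) (ell2 R) | forall i j,
    dot (ell2_delta i) (P (ell2_delta j)) =
    (pi^-1 * kappa F i * kappa F j)%:C *
      lim ((dot (phi F i) (imag_part (resolvent A (lambda +i* y)) (phi F j))
        : R[i]^o) @[y --> 0^'+])].

Definition eta_op A lambda : bop (ell2 R) (ell2 R) := sqrt_op (phi_matrix A lambda).

Definition evaluation A lambda : bop (Hplus G) (ell2 R) :=
  xget 0 [set E : bop (Hplus G) (ell2 R) |
    forall (beta : ell2 R) (f : Hplus G),
      series (fun j => (beta j * (kappa F j)%:C) *: phi F j) @ \oo -->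
        plus_incl G f ->
      series (fun j => beta j *: eta_op A lambda (ell2_delta j)) @ \oo --> E f].

Definition fiber A lambda : hilbertType R := crange (evaluation A lambda).

(* The sign is + for [true] and - for [false].                                *)
Definition signed (s : bool) (y : R) : R := if s then y else - y.

Definition amat (s : bool) A1 A0 lambda : bop (Hplus G) (Hminus G) :=
  limit0 (@trace_norm R (Hplus G) (Hminus G)) (fun y => (y / pi)%:C *:
    bop_comp (minus_incl G)
      (bop_comp (resolvent A1 (lambda +i* signed (~~ s) y))
        (bop_comp (resolvent A0 (lambda +i* signed s y)) (plus_incl G)))).

Definition wave_matrix (s : bool) A1 A0 lambda :
    bop (fiber A0 lambda) (fiber A1 lambda) :=
  xget 0 [set w : bop (fiber A0 lambda) (fiber A1 lambda) | forall f g,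
    dot (crange_map (evaluation A1 lambda) f : fiber A1 lambda)
        (w (crange_map (evaluation A0 lambda) g)) =
    pairing f (amat s A1 A0 lambda g)].

Definition scattering_matrix A1 A0 lambda :
    bop (fiber A0 lambda) (fiber A0 lambda) :=
  bop_comp (adjoint (wave_matrix true A1 A0 lambda))
    (wave_matrix false A1 A0 lambda).

End Scattering.

(* Main.v *)
Require Import Defs.
From HB Require Import structures.
From mathcomp Require Import all_boot all_order all_algebra.
From mathcomp Require Import complex finmap.
From mathcomp Require Import all_classical reals ereal topology normedtype.
From mathcomp Require Import sequences esum trigo.
From mathcomp Require Import ring lra.

(** Write T for the boundary value F R_{lambda+i0}(H_0) F^* and B for its
    imaginary part. Using unitaries that identify H_1 and H_{-1} with K, the
    evaluation operator becomes a map a0 from K onto a dense subspace of the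
    fiber with a0^* a0 = B / pi; it is Hilbert-Schmidt because B is trace class.
    The resolvent identity gives
      Im T(r) = Y^* B Y = Z^* B Z,  Y = (1 + J_r T)^-1,  Z = (1 + J_r T^* )^-1,
    where T(r) is the boundary value for H_r. Hence the adjoints of the wave
    matrices are the isometries a_r u |-> a0 Y u and a_r u |-> a0 Z u, and their
    product is the stationary formula
      S = 1 - 2 pi i a0 (1 + J_r T)^-1 J_r a0^*.
    T is compact, so the analytic Fredholm alternative makes the right-hand side
    meromorphic in r, in trace norm because a0 is Hilbert-Schmidt. For real
    non-resonant r the operator S is a contraction, so S is bounded near a
    resonance point and its Laurent expansion there has no negative powers. *)

Set Implicit Arguments.
Unset Strict Implicit.
Unset Printing Implicit Defensive.

Import Order.TTheory GRing.Theory Num.Theory.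
Import numFieldNormedType.Exports.

Local Open Scope classical_set_scope.
Local Open Scope complex_scope.
Local Open Scope ring_scope.

(** * Real-valued norms and inner products *)

(** Two obstacles shape the proof. Resolvents, square roots, the evaluation operator and the wave
    matrices are given only by defining properties, so each is pinned down, by completeness or by
    density of a range, before it is computed with. And trace-norm expansions have to come without
    contour integrals: analyticity is encoded by Taylor remainders with geometric bounds ([holo]),
    stable under products and inverses by plain algebra, and the trace norm enters only when an
    operator-norm expansion is placed between [a0] and its adjoint. Compactness of T means
    approximation by T Q_n, Q_n the projection on the first n vectors [psi]: at height y > 0 the
    sandwiched resolvent ends in F^*, and F^* (1 - Q_n) has norm at most kappa_n. The Fredholm
    alternative is local. Its bad branch, no invertibility near the point, is excluded along a piece
    by connectedness once the piece has one non-resonant point; a piece without such a point is a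
    separate case. S is known to be bounded at real points only, which is enough because the pole
    has finite order and every resonance in a piece is a limit of real regular points of that
    piece. *)

HB.instance Definition _ (R : realType) (U V : normedModType R[i])
  (A : bop U V) := @GRing.isLinear.Build R[i] U V _ (bop_fun A) (bop_linear A).

Section RealNorm.
Context {R : realType}.

(** Norms over [R[i]] are complex numbers; their real parts make ordered-field reasoning in [R]
    available. *)
Definition nm (V : normedZmodType R[i]) (x : V) : R := complex.Re `|x|.

Section Zmod.
Variable V : normedZmodType R[i].
Implicit Types x y : V.

Lemma nmE x : `|x| = (nm x)%:C.
Proof.
rewrite /nm; have := normr_ge0 x; rewrite lecE => /andP[/eqP].
by case: `|x| => a b /= ->.
Qed.

Lemma nm_ge0 x : 0 <= nm x.
Proof. by rewrite -lecR -nmE normr_ge0. Qed.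

Lemma nm0 : nm (0 : V) = 0.
Proof. by rewrite /nm normr0. Qed.

Lemma nm_eq0 x : nm x = 0 -> x = 0.
Proof. by move=> x0; apply/eqP; rewrite -normr_eq0 nmE x0. Qed.

Lemma nm_gt0 x : (0 < nm x) = (x != 0).
Proof. by rewrite -normr_gt0 nmE ltcR. Qed.

Lemma nmD x y : nm (x + y) <= nm x + nm y.
Proof. by rewrite -lecR rmorphD/= -!nmE ler_normD. Qed.

Lemma nmN x : nm (- x) = nm x.
Proof. by rewrite /nm normrN. Qed.

Lemma nmB x y : nm (x - y) <= nm x + nm y.
Proof. by rewrite -(nmN y) nmD. Qed.

Lemma nm_dist x y : nm (x - y) = nm (y - x).
Proof. by rewrite -nmN opprB. Qed.

End Zmod.

Lemma nmZ (V : normedModType R[i]) (a : R[i]) (x : V) :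
  nm (a *: x) = nm a * nm x.
Proof. by rewrite {1}/nm normrZ !nmE -rmorphM/=. Qed.

Lemma nmM (a b : R[i]) : nm (a * b) = nm a * nm b.
Proof. by rewrite {1}/nm normrM !nmE -rmorphM/=. Qed.

Lemma nm1 : nm (1 : R[i]) = 1.
Proof. by rewrite /nm normr1. Qed.

Lemma nmX (a : R[i]) n : nm (a ^+ n) = nm a ^+ n.
Proof. by elim: n => [|n IH]; rewrite ?expr0 ?nm1// !exprS nmM IH. Qed.

Lemma nm_real (a : R) : nm (a%:C) = `|a|.
Proof. by rewrite /nm normc_def/= expr0n addr0 sqrtr_sqr. Qed.

Lemma nmJ (a : R[i]) : nm (a^*%C) = nm a.
Proof. by rewrite /nm normcJ. Qed.

Lemma nmV (a : R[i]) : nm a^-1 = (nm a)^-1.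
Proof. by rewrite {1}/nm normfV nmE -(fmorphV (real_complex R)). Qed.

Lemma nm_i : nm ('i%C : R[i]) = 1.
Proof. by rewrite /nm normc_def/= expr0n add0r expr1n sqrtr1. Qed.

Lemma Re_le_nm (a : R[i]) : `|complex.Re a| <= nm a.
Proof. by rewrite -lecR -nmE normc_ge_Re. Qed.

Lemma Im_le_nm (a : R[i]) : `|complex.Im a| <= nm a.
Proof.
have := Re_le_nm (a * 'i%C); rewrite nmM nm_i mulr1 ReiNIm normrN //.
Qed.

Lemma gt0C (e : R[i]) : 0 < e -> e = (complex.Re e)%:C /\ 0 < complex.Re e.
Proof. by case: e => a b; rewrite ltcE /= => /andP[/eqP -> ->]. Qed.

Lemma ltnmE (V : normedZmodType R[i]) (x : V) (e : R) :
  (`|x| < e%:C) = (nm x < e).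
Proof. by rewrite nmE ltcR. Qed.

Lemma cvg_nmP (T : Type) (F : set_system T) (V : normedModType R[i])
    (f : T -> V) (l : V) : Filter F ->
  (f @ F --> l) <-> (nm (f x - l) @[x --> F] --> (0 : R)).
Proof.
move=> FF; split=> [/cvgrPdist_lt fl|/cvgrPdist_lt fl].
  apply/cvgrPdist_lt => e e0; have := fl e%:C; rewrite ltcR => /(_ e0).
  apply: filterS => x; rewrite ltnmE sub0r normrN ger0_norm ?nm_ge0//.
  by rewrite nm_dist.
apply/cvgrPdist_lt => e /gt0C[-> e0]; apply: filterS (fl _ e0) => x.
by rewrite ltnmE sub0r normrN ger0_norm ?nm_ge0// nm_dist.
Qed.

Lemma densityP (V : normedModType R[i]) (A : set V) :
  closure A = setT <->
  forall x (e : R), 0 < e -> exists2 y, A y & nm (x - y) < e.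
Proof.
split=> [cA x e e0|H].
  have : closure A x by rewrite cA.
  have ec : (0 : R[i]) < e%:C by rewrite ltcR.
  move=> /(_ _ (nbhsx_ballx x _ ec))[y [Ay]].
  by rewrite -ball_normE /= ltnmE; exists y.
apply/seteqP; split=> // x _ B /nbhs_ballP[e /= /gt0C[eE e0] eB].
have [y Ay xy] := H x _ e0; exists y; split=> //; apply: eB.
by rewrite -ball_normE /= eE ltnmE.
Qed.

Lemma limit_unique (V : normedZmodType R[i]) (x y : V) :
  (forall e : R, 0 < e -> nm (x - y) < e) -> x = y.
Proof.
move=> H; apply/eqP; rewrite -subr_eq0; apply: contraT => xy.
by have := H (nm (x - y)); rewrite nm_gt0 xy ltxx => /(_ isT).
Qed.

Lemma nm_complete (V : completeNormedModType R[i]) (u : nat -> V) :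
  (forall e : R, 0 < e -> exists N, forall n, (N <= n)%N -> nm (u n - u N) < e) ->
  cvgn u.
Proof.
move=> H; apply: cauchy_cvg; apply/cauchyP => e /gt0C[-> e0].
have [N HN] := H _ e0; exists (u N); exists N => // n /= Nn.
by rewrite -ball_normE /= ltnmE nm_dist HN.
Qed.

Lemma inv_lt (e : R) : 0 < e -> exists N, forall n, (N <= n)%N -> n.+1%:R^-1 < e.
Proof.
move=> e0; exists (Num.truncn e^-1) => n Nn.
rewrite -[ltRHS]invrK ltf_pV2 ?posrE ?invr_gt0//.
by rewrite (lt_le_trans (truncnS_gt _))// ler_nat.
Qed.

End RealNorm.

Section Dot.
Context {R : realType}.
Variable H : hilbertType R.
Implicit Types (x y z : H) (a : R[i]).

Lemma dotDl x y z : dot (x + y) z = dot x z + dot y z.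
Proof. by rewrite dotC dotDr rmorphD [dot x z]dotC [dot y z]dotC. Qed.

Lemma dotZl a x y : dot (a *: x) y = a^*%C * dot x y.
Proof. by rewrite dotC dotZr rmorphM [dot x y]dotC. Qed.

Lemma dot0r x : dot x 0 = 0.
Proof. by rewrite -(scale0r 0) dotZr mul0r. Qed.

Lemma dot0l x : dot 0 x = 0.
Proof. by rewrite dotC dot0r conjc0. Qed.

Lemma dotNr x y : dot x (- y) = - dot x y.
Proof. by rewrite -scaleN1r dotZr mulN1r. Qed.

Lemma dotNl x y : dot (- x) y = - dot x y.
Proof. by rewrite dotC dotNr rmorphN [dot x y]dotC. Qed.

Lemma dotBr x y z : dot x (y - z) = dot x y - dot x z.
Proof. by rewrite dotDr dotNr. Qed.

Lemma dotBl x y z : dot (x - y) z = dot x z - dot y z.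
Proof. by rewrite dotDl dotNl. Qed.

Lemma dot_sumr I (r : seq I) (P : pred I) x (F : I -> H) :
  dot x (\sum_(i <- r | P i) F i) = \sum_(i <- r | P i) dot x (F i).
Proof.
elim/big_rec2 : _ => [|i b a _ h]; first by rewrite dot0r.
by rewrite dotDr h.
Qed.

Lemma dot_suml I (r : seq I) (P : pred I) x (F : I -> H) :
  dot (\sum_(i <- r | P i) F i) x = \sum_(i <- r | P i) dot (F i) x.
Proof.
elim/big_rec2 : _ => [|i b a _ h]; first by rewrite dot0l.
by rewrite dotDl h.
Qed.

Lemma dotxx x : dot x x = (nm x ^+ 2)%:C.
Proof. by rewrite dot_norm nmE rmorphXn. Qed.

Lemma nm_sqrD x y :
  nm (x + y) ^+ 2 = nm x ^+ 2 + nm y ^+ 2 + complex.Re (dot x y) *+ 2.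
Proof.
have : complex.Re (dot (x + y) (x + y)) = complex.Re (nm (x + y) ^+ 2)%:C.
  by rewrite dotxx.
rewrite dotDl !dotDr !dotxx [dot y x]dotC /= => <-.
by case: (dot x y) => a b /=; ring.
Qed.

(** Cauchy-Schwarz. The real part is bounded by expanding the square of |v| u - |u| v; multiplying x
    by [dot x y] then rotates the inner product onto the positive axis. *)
Lemma nm_dot x y : nm (dot x y) <= nm x * nm y.
Proof.
have Re_le (u v : H) : complex.Re (dot u v) <= nm u * nm v.
  have [->|v0] := eqVneq v 0; first by rewrite dot0r nm0 mulr0.
  have vp : 0 < nm v by rewrite nm_gt0.
  have [->|u0] := eqVneq u 0; first by rewrite dot0l nm0 mul0r.
  have up : 0 < nm u by rewrite nm_gt0.
  have := sqr_ge0 (nm ((nm v)%:C *: u + (- (nm u))%:C *: v)).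
  rewrite nm_sqrD !nmZ !nm_real dotZl dotZr conjc_real mulrA -rmorphM.
  rewrite !exprMn normrN !ger0_norm ?nm_ge0//.
  have -> : complex.Re ((nm v * - nm u)%:C * dot u v) =
     (nm v * - nm u) * complex.Re (dot u v).
    by case: (dot u v) => a b /=; rewrite mul0r subr0.
  move: (complex.Re _) => c; rewrite mulr2n => h.
  have uv : 0 < nm u * nm v by rewrite mulr_gt0.
  nra.
have [->|d0] := eqVneq (dot x y) 0; first by rewrite nm0 mulr_ge0 ?nm_ge0.
have dp : 0 < nm (dot x y) by rewrite nm_gt0.
have := Re_le (dot x y *: x) y; rewrite dotZl nmZ.
have -> : (dot x y)^*%C * dot x y = (nm (dot x y) ^+ 2)%:C.
  by rewrite mulrC -sqr_normc nmE rmorphXn.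
by rewrite /= -mulrA expr2 ler_pM2l.
Qed.

Lemma parallelogram x y :
  nm (x + y) ^+ 2 + nm (x - y) ^+ 2 = (nm x ^+ 2 + nm y ^+ 2) *+ 2.
Proof. by rewrite !nm_sqrD nmN dotNr; case: (dot x y) => a b /=; ring. Qed.

Lemma dot_eq0P x : (forall y, dot y x = 0) -> x = 0.
Proof.
move=> /(_ x); rewrite dotxx => /complexI /eqP.
by rewrite expf_eq0 => /andP[_ /eqP /nm_eq0].
Qed.

Lemma dot_extr x y : (forall z, dot z x = dot z y) -> x = y.
Proof.
move=> h; apply/eqP; rewrite -subr_eq0; apply/eqP/dot_eq0P => z.
by rewrite dotBr h subrr.
Qed.

Lemma cvg_dot (T : Type) (F : set_system T) (f : T -> H) l x : Filter F ->
  f @ F --> l -> nm (dot x (f t) - dot x l) @[t --> F] --> (0 : R).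
Proof.
move=> FF /cvg_nmP fl.
apply: (@squeeze_cvgr _ _ _ _ (cst 0) (fun t => nm x * nm (f t - l))).
- by apply: nearW => t; rewrite nm_ge0 -dotBr nm_dot.
- exact: cvg_cst.
- by rewrite -(mulr0 (nm x)); apply: cvgM => //; exact: cvg_cst.
Qed.

End Dot.

(** * Bounded operators *)

Local Notation "A \c B" := (bop_comp A B) (at level 40, left associativity).

Section Sequences.
Context {R : realType}.

Lemma cvgn_nmP (V : normedModType R[i]) (u : nat -> V) (l : V) :
  (u @ \oo --> l) <->
  (forall e : R, 0 < e -> exists N, forall n, (N <= n)%N -> nm (u n - l) < e).
Proof.
split=> [/cvgrPdist_lt ul e e0|h].
  have [|N _ HN] := ul e%:C; first by rewrite ltcR.
  by exists N => n Nn; rewrite nm_dist -ltnmE; exact: HN.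
apply/cvgrPdist_lt => e /gt0C[-> e0]; have [N HN] := h _ e0.
by exists N => // n /= Nn; rewrite ltnmE nm_dist HN.
Qed.

Lemma cauchy_limit (V : completeNormedModType R[i]) (u : nat -> V) :
  (forall e : R, 0 < e -> exists N, forall n, (N <= n)%N -> nm (u n - u N) < e) ->
  exists l, forall e : R, 0 < e ->
    exists N, forall n, (N <= n)%N -> nm (u n - l) < e.
Proof. by move=> /nm_complete /cvg_ex[l /cvgn_nmP ul]; exists l. Qed.

Lemma le_eps (a b : R) : (forall e, 0 < e -> a <= b + e) -> a <= b.
Proof. by move=> h; apply/ler_addgt0Pr => e /h. Qed.

Lemma limit_uniq (V : normedModType R[i]) (u : nat -> V) (l l' : V) :
  u @ \oo --> l -> u @ \oo --> l' -> l = l'.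
Proof.
move=> /cvgn_nmP h /cvgn_nmP h'; apply: limit_unique => e e0.
have e2 : 0 < e / 2 by rewrite divr_gt0.
have [N HN] := h _ e2; have [N' HN'] := h' _ e2; set n := maxn N N'.
have := HN n (leq_maxl _ _); have := HN' n (leq_maxr _ _).
rewrite [nm (u n - l)]nm_dist => p q.
rewrite (_ : l - l' = (l - u n) + (u n - l')); last by rewrite addrA subrK.
by rewrite (le_lt_trans (nmD _ _))// [ltRHS]splitr ltrD.
Qed.

End Sequences.

Section BopBasics.
Context {R : realType}.
Implicit Types U V W : normedModType R[i].

Lemma bopP U V (A B : bop U V) : (forall x, A x = B x) -> A = B.
Proof. by move=> h; apply/val_inj/funext. Qed.

Lemma bopDE U V (A B : bop U V) x : (A + B) x = A x + B x.
Proof. by []. Qed.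

Lemma bopNE U V (A : bop U V) x : (- A) x = - A x.
Proof. by []. Qed.

Lemma bopZE U V a (A : bop U V) x : (a *: A) x = a *: A x.
Proof. by []. Qed.

Lemma bop0E U V x : (0 : bop U V) x = 0.
Proof. by []. Qed.

Lemma bop_compE U V W (A : bop V W) (B : bop U V) x : (A \c B) x = A (B x).
Proof. by []. Qed.

Lemma bop_idE U (x : U) : bop_id U x = x.
Proof. by []. Qed.

Lemma bop0 U V (A : bop U V) : A 0 = 0.
Proof. by have := bop_linear A (-1) 0 0; rewrite scaler0 addr0 scaleN1r addNr. Qed.

Lemma bopD U V (A : bop U V) x y : A (x + y) = A x + A y.
Proof. by rewrite -(scale1r x) bop_linear !scale1r. Qed.

Lemma bopZ U V (A : bop U V) a x : A (a *: x) = a *: A x.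
Proof. by rewrite -[a *: x]addr0 bop_linear bop0 addr0. Qed.

Lemma bopN U V (A : bop U V) x : A (- x) = - A x.
Proof. by rewrite -scaleN1r bopZ scaleN1r. Qed.

Lemma bopB U V (A : bop U V) x y : A (x - y) = A x - A y.
Proof. by rewrite bopD bopN. Qed.

Lemma bop_sum U V (A : bop U V) I (r : seq I) (P : pred I) (F : I -> U) :
  A (\sum_(i <- r | P i) F i) = \sum_(i <- r | P i) A (F i).
Proof. by elim/big_rec2 : _ => [|i b a _ <-]; rewrite ?bop0 ?bopD. Qed.

Definition bopE := (@bopDE, @bopNE, @bopZE, @bop0E, @bop_compE, @bop_idE).

Lemma bop_sumE U V I (r : seq I) (P : pred I) (F : I -> bop U V) x :
  (\sum_(i <- r | P i) F i) x = \sum_(i <- r | P i) F i x.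
Proof. by elim/big_rec2 : _ => [|i b a _ <-]. Qed.

Lemma bop_bounded U V (A : bop U V) :
  exists2 c : R, 0 <= c & forall x, nm (A x) <= c * nm x.
Proof.
have /linear_boundedP/pinfty_ex_gt0[M /gt0C[ME M0] h] :
    bounded_near (bop_fun A) (nbhs (0 : U)).
  by apply: continuous_linear_bounded => //; exact: bop_continuous.
exists (complex.Re M); first exact: ltW.
by move=> x; have := h x; rewrite ME !nmE -rmorphM lecR.
Qed.

Lemma bop_make U V (f : U -> V) (c : R) : linear f ->
  (forall x, nm (f x) <= c * nm x) -> exists A : bop U V, forall x, A x = f x.
Proof.
move=> lf fc; pose c' := Num.max c 1.
have cc' : 0 < c' by rewrite lt_max ltr01 orbT.
have fc' x : nm (f x) <= c' * nm x.
  by rewrite (le_trans (fc x))// ler_wpM2r ?nm_ge0// le_max lexx.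
have fB x y : f (x - y) = f x - f y.
  by rewrite addrC -scaleN1r lf scaleN1r addrC.
suff ax : f \in @bounded_linear R U V by exists (Bop ax).
rewrite inE; split=> // x; apply/cvgrPdist_lt => e /gt0C[-> e0].
have dp : (0 : R[i]) < (complex.Re e / c')%:C by rewrite ltcR divr_gt0.
apply/nbhs_ballP; exists (complex.Re e / c')%:C => //= y.
rewrite -ball_normE /= !ltnmE => xy.
rewrite -fB (le_lt_trans (fc' _))// mulrC -ltr_pdivlMr//.
Qed.

End BopBasics.

Section Norm.
Context {R : realType}.
Implicit Types H K L : hilbertType R.

(** [fine] loses nothing: [opnormE] shows that a bounded operator has a finite extended-real
    norm. *)
Definition bn H K (A : bop H K) : R := fine (opnorm A).

Lemma unit_ball H (x : H) : (`|x| <= 1) = (nm x <= 1).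
Proof. by rewrite nmE (_ : 1 = 1%:C)// lecR. Qed.

Lemma opnormE H K (A : bop H K) : opnorm A = (bn A)%:E.
Proof.
rewrite /bn fineK//; have [c c0 hc] := bop_bounded A.
rewrite ge0_fin_numE; last first.
  by apply: ereal_sup_ubound; exists 0; rewrite /= ?unit_ball -/(nm _) ?bop0 nm0.
apply: le_lt_trans (ltry c); apply: ge_ereal_sup => _ [x /= x1 <-].
move: x1; rewrite lee_fin -/(nm _) unit_ball => x1.
by rewrite (le_trans (hc x))// ler_piMr.
Qed.

Lemma bn_ge0 H K (A : bop H K) : 0 <= bn A.
Proof.
rewrite -lee_fin -opnormE; apply: ereal_sup_ubound.
by exists 0; rewrite /= ?unit_ball -/(nm _) ?bop0 nm0.
Qed.

Lemma bn_le H K (A : bop H K) x : nm (A x) <= bn A * nm x.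
Proof.
have [->|x0] := eqVneq x 0; first by rewrite bop0 !nm0 mulr0.
have xp : 0 < nm x by rewrite nm_gt0.
rewrite -ler_pdivrMr// -lee_fin -opnormE; apply: ereal_sup_ubound => /=.
exists ((nm x)^-1%:C *: x).
  by rewrite unit_ball nmZ nm_real ger0_norm ?invr_ge0 ?nm_ge0// mulVf// gt_eqF.
rewrite -/(nm _) bopZ nmZ nm_real ger0_norm ?invr_ge0 ?nm_ge0//.
by rewrite mulrC.
Qed.

Lemma bn_lub H K (A : bop H K) c : 0 <= c ->
  (forall x, nm (A x) <= c * nm x) -> bn A <= c.
Proof.
move=> c0 h; rewrite -lee_fin -opnormE; apply: ge_ereal_sup => _ [x /= x1 <-].
move: x1; rewrite lee_fin -/(nm _) unit_ball => x1.
by rewrite (le_trans (h x))// ler_piMr.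
Qed.

Lemma bn_ub H K (A : bop H K) c x : bn A <= c -> nm (A x) <= c * nm x.
Proof. by move=> Ac; rewrite (le_trans (bn_le A x))// ler_wpM2r ?nm_ge0. Qed.

Lemma bn0 H K : bn (0 : bop H K) = 0.
Proof.
apply: le_anti; rewrite bn_ge0 andbT; apply: bn_lub => // x.
by rewrite bopE nm0 mul0r.
Qed.

Lemma bn_eq0 H K (A : bop H K) : bn A = 0 -> A = 0.
Proof.
move=> A0; apply: bopP => x; apply: nm_eq0; apply: le_anti.
by rewrite nm_ge0 (le_trans (bn_le A x))// A0 mul0r.
Qed.

Lemma bn_id H : bn (bop_id H) <= 1.
Proof. by apply: bn_lub => // x; rewrite mul1r. Qed.

Lemma bnD H K (A B : bop H K) : bn (A + B) <= bn A + bn B.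
Proof.
apply: bn_lub => [|x]; first by rewrite addr_ge0 ?bn_ge0.
by rewrite (le_trans (nmD _ _))// mulrDl lerD ?bn_le.
Qed.

Lemma bnZ H K a (A : bop H K) : bn (a *: A) = nm a * bn A.
Proof.
have le b (B : bop H K) : bn (b *: B) <= nm b * bn B.
  apply: bn_lub => [|x]; first by rewrite mulr_ge0 ?bn_ge0 ?nm_ge0.
  by rewrite bopE nmZ -mulrA ler_wpM2l ?nm_ge0 ?bn_le.
have [->|a0] := eqVneq a 0; first by rewrite scale0r bn0 nm0 mul0r.
apply: le_anti; rewrite le/=.
have := le a^-1 (a *: A); rewrite scalerA mulVf// scale1r nmV.
by rewrite -ler_pdivlMl ?invrK ?invr_gt0 ?nm_gt0.
Qed.

Lemma bnN H K (A : bop H K) : bn (- A) = bn A.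
Proof. by rewrite -scaleN1r bnZ nmN nm1 mul1r. Qed.

Lemma bnB H K (A B : bop H K) : bn (A - B) <= bn A + bn B.
Proof. by rewrite -(bnN B) bnD. Qed.

Lemma bn_dist H K (A B : bop H K) : bn (A - B) = bn (B - A).
Proof. by rewrite -bnN opprB. Qed.

Lemma bn_comp H K L (A : bop K L) (B : bop H K) : bn (A \c B) <= bn A * bn B.
Proof.
apply: bn_lub => [|x]; first by rewrite mulr_ge0 ?bn_ge0.
by rewrite bopE (le_trans (bn_le _ _))// -mulrA ler_wpM2l ?bn_ge0 ?bn_le.
Qed.

Lemma bn_sum H K I (r : seq I) (P : pred I) (F : I -> bop H K) :
  bn (\sum_(i <- r | P i) F i) <= \sum_(i <- r | P i) bn (F i).
Proof.
elim/big_rec2 : _ => [|i b a _ h]; first by rewrite bn0.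
by rewrite (le_trans (bnD _ _))// lerD2l.
Qed.

End Norm.

(** * Extension by continuity and completeness in operator norm *)

Section Extension.
Context {R : realType}.

(* Extension by continuity, for a map given by its graph [S]. *)
Lemma bop_extend (L1 L2 : hilbertType R) (S : L1 -> L2 -> Prop) (c : R) :
  0 <= c ->
  (forall a x y x' y', S x y -> S x' y' -> S (a *: x + x') (a *: y + y')) ->
  (forall x y, S x y -> nm y <= c * nm x) ->
  closure [set x | exists y, S x y] = setT ->
  exists V : bop L1 L2, bn V <= c /\ forall x y, S x y -> V x = y.
Proof.
move=> c0 Sl Sb /densityP Sd.
(* [T] is the closure of the graph: single-valued by the bound, total by density and
   completeness. *)
pose T x y := forall e : R, 0 < e ->
  exists u v, [/\ S u v, nm (x - u) < e & nm (y - v) < e].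
have Tb x y : T x y -> nm y <= c * nm x.
  move=> Txy; apply: le_eps => e e0.
  have e'0 : 0 < e / (c + 1) by rewrite divr_gt0// ltr_wpDl.
  have [u [v [Suv xu yv]]] := Txy _ e'0.
  rewrite -(subrK v y) (le_trans (nmD _ _))//.
  rewrite (le_trans (lerD (ltW yv) (Sb _ _ Suv)))//.
  have ux : nm u <= nm x + e / (c + 1).
    rewrite -(subrK x u) (le_trans (nmD _ _))// addrC lerD2l ltW//.
    by rewrite nm_dist.
  rewrite (le_trans (lerD (lexx _) (ler_wpM2l c0 ux)))// mulrDr addrCA lerD2l.
  by rewrite -[X in X + _]mul1r -mulrDl addrC mulrC divfK// gt_eqF// ltr_wpDl.
have Tl a x y x' y' : T x y -> T x' y' -> T (a *: x + x') (a *: y + y').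
  move=> Txy Txy' e e0.
  have a0 : 0 < nm a + 1 by rewrite ltr_wpDl ?nm_ge0.
  have e2 : 0 < e / 2 by rewrite divr_gt0.
  have [u [v [Suv xu yv]]] := Txy _ (divr_gt0 e2 a0).
  have [u' [v' [Suv' xu' yv']]] := Txy' _ e2.
  have key (W : hilbertType R) (p q p' q' : W) : nm (p - q) < e / 2 / (nm a + 1) ->
      nm (p' - q') < e / 2 -> nm (a *: p + p' - (a *: q + q')) < e.
    move=> pq pq'; rewrite opprD addrACA -scalerBr (le_lt_trans (nmD _ _))//.
    rewrite [ltRHS]splitr ler_ltD// nmZ.
    have := ltW pq; rewrite ler_pdivlMr// => h; apply: le_trans h.
    by rewrite mulrC ler_wpM2l ?nm_ge0// lerDl.
  exists (a *: u + u'), (a *: v + v'); split; [exact: Sl|exact: key|exact: key].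
have ST x y : S x y -> T x y.
  by move=> Sxy e e0; exists x, y; rewrite !subrr !nm0.
have S00 : T 0 0.
  move=> e e0; have [u [v Suv] _] := Sd 0 _ ltr01.
  have := Sl (-1) _ _ _ _ Suv Suv; rewrite !scaleN1r !addNr => S0.
  by exists 0, 0; rewrite !subrr !nm0.
have Tu x y y' : T x y -> T x y' -> y = y'.
  move=> h h'; have := Tl (-1) _ _ _ _ h h'; rewrite !scaleN1r addNr => /Tb.
  rewrite nm0 mulr0 => h0; apply/esym/eqP; rewrite -subr_eq0 addrC; apply/eqP.
  by apply: nm_eq0; apply: le_anti; rewrite h0 nm_ge0.
have Te x : exists y, T x y.
  have ex n : exists uv, S uv.1 uv.2 /\ nm (x - uv.1) < n.+1%:R^-1.
    have n0 : (0 : R) < n.+1%:R^-1 by rewrite invr_gt0.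
    by have [u [v Suv] xu] := Sd x _ n0; exists (u, v).
  have [w Hw] := choice ex.
  have wb m n : nm ((w m).2 - (w n).2) <= c * (m.+1%:R^-1 + n.+1%:R^-1).
    have [[Sm xm] [Sn xn]] := (Hw m, Hw n).
    have := Sb _ _ (Sl (-1) _ _ _ _ Sn Sm); rewrite !scaleN1r ![- _ + _]addrC.
    move=> /le_trans; apply; rewrite ler_wpM2l// -(subrKA x).
    by rewrite (le_trans (nmD _ _))// lerD// ?ltW// nm_dist.
  have c1 : 0 < c + 1 by rewrite ltr_wpDl.
  have [y Hy] : exists l, forall e : R, 0 < e ->
      exists N, forall n, (N <= n)%N -> nm ((w n).2 - l) < e.
    apply: cauchy_limit => e e0.
    have e2 : 0 < e / 2 / (c + 1) by rewrite !divr_gt0.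
    have [N HN] := inv_lt e2; exists N => n Nn.
    rewrite (le_lt_trans (wb _ _))//.
    have h := ltrD (HN n Nn) (HN N (leqnn _)).
    have s0 : (0 : R) < n.+1%:R^-1 + N.+1%:R^-1 by rewrite addr_gt0 ?invr_gt0.
    apply: le_lt_trans (_ : (c + 1) * (n.+1%:R^-1 + N.+1%:R^-1) < _).
      by rewrite ler_pM2r// lerDl.
    by rewrite -ltr_pdivlMl// mulrC [X in X * _]splitr mulrDl.
  exists y => e e0; have [N HN] := Hy _ e0; have [N' HN'] := inv_lt e0.
  have [Sn xn] := Hw (maxn N N').
  exists (w (maxn N N')).1, (w (maxn N N')).2; split=> //.
    by rewrite (lt_trans xn)// HN'// leq_maxr.
  by rewrite nm_dist HN// leq_maxl.
have [f Hf] := choice Te.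
have fl : linear f by move=> a x y; apply: (Tu _ _ _ (Hf _)); apply: Tl.
have [V HV] := bop_make fl (fun x => Tb _ _ (Hf x)).
exists V; split; first by apply: bn_lub => // x; rewrite HV Tb.
by move=> x y Sxy; rewrite HV; apply: Tu (Hf x) _; exact: ST.
Qed.

(** Completeness in operator norm: the pointwise limits form a linear map, and the Cauchy estimate
    survives the limit at each vector with its constant, hence also in norm. *)
Lemma bop_limit (L1 L2 : hilbertType R) (A : nat -> bop L1 L2) :
  (forall e : R, 0 < e ->
    exists N, forall n, (N <= n)%N -> bn (A n - A N) <= e) ->
  exists B : bop L1 L2, forall e : R, 0 < e ->
    exists N, forall n, (N <= n)%N -> bn (A n - B) <= e.
Proof.
move=> Ac.
have lim x : exists l, forall e : R, 0 < e ->
    exists N, forall n, (N <= n)%N -> nm (A n x - l) < e.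
  apply: cauchy_limit => e e0.
  have x1 : 0 < nm x + 1 by rewrite ltr_wpDl ?nm_ge0.
  have [N HN] := Ac _ (divr_gt0 e0 x1); exists N => n Nn.
  have := bn_ub x (HN n Nn); rewrite !bopE => /le_lt_trans; apply.
  by rewrite mulrAC ltr_pdivrMr// ltr_pM2l// ltrDl.
have [f Hf] := choice lim.
have key (e : R) N : (forall n, (N <= n)%N -> bn (A n - A N) <= e) ->
    forall x, nm (A N x - f x) <= e * nm x.
  move=> HN x; apply: le_eps => d d0; have [M HM] := Hf x _ d0.
  set n := maxn N M; rewrite -(subrKA (A n x)) (le_trans (nmD _ _))// lerD//.
    rewrite nm_dist; have := bn_ub x (HN n (leq_maxl _ _)).
    by rewrite !bopE.
  by rewrite ltW// HM// leq_maxr.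
have fl : linear f.
  move=> a x y; apply: limit_unique => e e0.
  have a0 : 0 < nm a + 1 by rewrite ltr_wpDl ?nm_ge0.
  have e3 : 0 < e / 3 by rewrite divr_gt0.
  have [N1 H1] := Hf (a *: x + y) _ e3; have [N2 H2] := Hf x _ (divr_gt0 e3 a0).
  have [N3 H3] := Hf y _ e3; set n := maxn N1 (maxn N2 N3).
  have {H1} := H1 n (leq_maxl _ _).
  have {H2} := H2 n (leq_trans (leq_maxl _ _) (leq_maxr _ _)).
  have {H3} := H3 n (leq_trans (leq_maxr _ _) (leq_maxr _ _)).
  rewrite bop_linear => h3 h2 h1.
  rewrite (_ : _ - _ = - (a *: A n x + A n y - f (a *: x + y)) +
    (a *: (A n x - f x) + (A n y - f y))); last first.
    by rewrite opprB scalerBr [a *: A n x - _ + _]addrACA -opprD subrKA.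
  rewrite (le_lt_trans (nmD _ _))// nmN.
  rewrite (le_lt_trans (lerD (lexx _) (nmD _ _)))// nmZ.
  have h2' : nm a * nm (A n x - f x) <= e / 3.
    move: (ltW h2); rewrite ler_pdivlMr// => h; apply: le_trans h.
    by rewrite mulrC ler_wpM2l ?nm_ge0// lerDl.
  lra.
have [N1 H1] := Ac _ ltr01.
have [B HB] : exists B : bop L1 L2, forall x, B x = f x.
  apply: (@bop_make _ _ _ _ (bn (A N1) + 1)) => // x.
  have := key _ _ H1 x => h; rewrite -[f x](subrK (A N1 x)).
  rewrite (le_trans (nmD _ _))// addrC mulrDl lerD ?bn_le// nm_dist//.
exists B => e e0; have e2 : 0 < e / 2 by rewrite divr_gt0.
have [N HN] := Ac _ e2; exists N => n Nn.
rewrite -(subrKA (A N)) (le_trans (bnD _ _))// [leRHS]splitr lerD ?HN//.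
by apply: bn_lub => [|x]; rewrite ?(ltW e2)// !bopE HB key.
Qed.

End Extension.

(** * Projections, the Riesz theorem and adjoints *)

Section Projection.
Context {R : realType}.
Implicit Types H K L : hilbertType R.

Definition is_subspace H (M : set H) : Prop :=
  M 0 /\ forall a x y, M x -> M y -> M (a *: x + y).

(** [M] is not assumed closed, so [p] is only a limit of points of [M]. A minimising sequence is
    Cauchy by the parallelogram law, and minimality gives orthogonality. *)
Lemma projection H (M : set H) (x : H) : is_subspace M ->
  exists p, (forall e : R, 0 < e -> exists2 m, M m & nm (p - m) < e) /\
    forall m, M m -> dot m (x - p) = 0.
Proof.
move=> [M0 Ml]; pose D := [set nm (x - m) | m in M].
have Dlb : has_lbound D by exists 0 => _ [m _ <-]; exact: nm_ge0.
have Dinf : has_inf D by split=> //; exists (nm (x - 0)), 0.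
pose d := inf D.
have d0 : 0 <= d by apply: lb_le_inf => [|_ [m _ <-]]; [exact: Dinf.1|exact: nm_ge0].
have dle m : M m -> d <= nm (x - m) by move=> Mm; apply: ge_inf => //; exists m.
have ex n : exists m, M m /\ nm (x - m) < d + n.+1%:R^-1.
  have n0 : (0 : R) < n.+1%:R^-1 by rewrite invr_gt0.
  by have [_ [m Mm <-] h] := inf_adherent n0 Dinf; exists m.
have [u Hu] := choice ex.
(* The midpoint of [u i] and [u j] is at distance at least [d]; the constant bounds 4 (d + e)^2 - 4
   d^2 for e at most 1. *)
have close (e : R) i j : 0 < e -> e <= 1 -> i.+1%:R^-1 < e -> j.+1%:R^-1 < e ->
    nm (u i - u j) ^+ 2 <= 4 * (2 * d + 1) * e.
  move=> e0 e1 ie je; have [[Mi hi] [Mj hj]] := (Hu i, Hu j).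
  have := parallelogram (x - u i) (x - u j).
  have -> : x - u i - (x - u j) = - (u i - u j).
    by rewrite opprB addrC opprB subrKA.
  have -> : x - u i + (x - u j) = 2 *: (x - 2^-1 *: (1 *: u i + u j)).
    rewrite scale1r scalerBr scalerA divff// scale1r.
    by rewrite scaler_nat mulr2n addrACA -opprD.
  have Mm : M (2^-1 *: (1 *: u i + u j)).
    by rewrite -[_ *: _]addr0; apply: (Ml) => //; apply: (Ml).
  have := dle _ Mm; rewrite nmZ nmN (_ : nm 2 = 2); last first.
    by rewrite (_ : 2 = (2 : R)%:C) ?nm_real ?ger0_norm// rmorph_nat.
  have := lt_trans hi (_ : _ < d + e); rewrite ltrD2l => /(_ ie).
  have := lt_trans hj (_ : _ < d + e); rewrite ltrD2l => /(_ je).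
  have := nm_ge0 (x - u i); have := nm_ge0 (x - u j).
  move: (nm (x - u i)) (nm (x - u j)) (nm (x - _ *: _)) (nm (u i - u j)) => a b c f.
  move=> a0 b0 ae be cd E.
  have a2 : a ^+ 2 <= (d + e) ^+ 2 by rewrite lerXn2r// ?nnegrE; lra.
  have b2 : b ^+ 2 <= (d + e) ^+ 2 by rewrite lerXn2r// ?nnegrE; lra.
  have c2 : d ^+ 2 <= c ^+ 2 by rewrite lerXn2r// ?nnegrE; lra.
  nra.
have [p Hp] : exists l, forall e : R, 0 < e ->
    exists N, forall n, (N <= n)%N -> nm (u n - l) < e.
  apply: cauchy_limit => e e0; pose C := 4 * (2 * d + 1).
  have C0 : 0 < C by rewrite /C; lra.
  pose e' := Num.min 1 (e ^+ 2 / 2 / C).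
  have e'0 : 0 < e' by rewrite lt_min ltr01 !divr_gt0// exprn_gt0.
  have [N HN] := inv_lt e'0; exists N => n Nn.
  rewrite -ltr_sqr ?nnegrE ?nm_ge0 ?(ltW e0)//.
  apply: le_lt_trans (close e' _ _ e'0 _ (HN _ Nn) (HN _ (leqnn _))) _.
    by rewrite ge_min lexx.
  apply: le_lt_trans (_ : C * (e ^+ 2 / 2 / C) < _).
    by rewrite ler_wpM2l ?(ltW C0)// ge_min lexx orbT.
  rewrite mulrC divfK ?gt_eqF//; have := exprn_gt0 2 e0; lra.
exists p; split=> [e e0|m Mm].
  by have [N HN] := Hp _ e0; exists (u N); [exact: (Hu N).1|rewrite nm_dist HN].
have nxp : nm (x - p) <= d.
  apply: le_eps => e e0; have e2 : 0 < e / 2 by rewrite divr_gt0.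
  have [N HN] := Hp _ e2; have [N' HN'] := inv_lt e2.
  set n := maxn N N'; rewrite -(subrKA (u n)) (le_trans (nmD _ _))//.
  rewrite (splitr e) addrA lerD//; last by rewrite ltW// HN// leq_maxl.
  by rewrite (le_trans (ltW (Hu n).2))// lerD2l ltW// HN'// leq_maxr.
have dxp w : M w -> d <= nm (x - p - w).
  move=> Mw; apply: le_eps => e e0; have [N HN] := Hp _ e0.
  have := dle _ (Ml 1 _ _ (Hu N).1 Mw); rewrite scale1r => /le_trans; apply.
  have -> : x - (u N + w) = (x - p - w) - (u N - p).
    by rewrite [- (u N - p)]opprB [x - p - w]addrAC subrKA opprD addrA addrAC.
  by rewrite (le_trans (nmB _ _))// lerD2l ltW// HN.
set z := x - p in nxp dxp *.
have [//|q0] := eqVneq (dot m z) 0.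
have key (t : R[i]) : 0 <= nm (t *: m) ^+ 2 - complex.Re (dot z (t *: m)) *+ 2.
  have h : nm z ^+ 2 <= nm (z - t *: m) ^+ 2.
    rewrite lerXn2r ?nnegrE ?nm_ge0// (le_trans nxp)// dxp//.
    by rewrite -[_ *: _]addr0; apply: Ml.
  move: h; rewrite nm_sqrD nmN dotNr.
  by case: (dot z _) => a b /=; rewrite mulNrn; lra.
have q1 : 0 < nm (dot m z) ^+ 2 by rewrite exprn_gt0// nm_gt0.
have s0 : 0 < nm m ^+ 2 + 1 by rewrite ltr_wpDl ?sqr_ge0.
(* The best step along [m] has denominator [nm m ^+ 2]; the added 1 covers m = 0 and still shortens
   the distance. *)
have := key ((nm m ^+ 2 + 1)^-1%:C * dot m z).
have sv : 0 <= (nm m ^+ 2 + 1)^-1 by rewrite invr_ge0 ltW.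
rewrite dotZr nmZ nmM nm_real (ger0_norm sv).
rewrite [dot z m]dotC -[_ * dot m z * _]mulrA -sqr_normc nmE -rmorphXn -rmorphM /=.
set s := _ ^-1; set q := nm (dot m z) in q1 *; rewrite !exprMn.
have sE : s * (nm m ^+ 2 + 1) = 1 by rewrite mulVf// gt_eqF.
have s1 : 0 < s by rewrite invr_gt0.
have -> : s ^+ 2 * q ^+ 2 * nm m ^+ 2 - (s * q ^+ 2) *+ 2 =
  s * q ^+ 2 * (s * (nm m ^+ 2 + 1) - s - 2) by ring.
rewrite sE pmulr_rge0; last exact: mulr_gt0.
by move=> h; exfalso; lra.
Qed.

(** x minus its projection is orthogonal to [M], hence zero, so x is a limit of points of [M]. This
    is the density test for most graphs fed to [bop_extend]. *)
Lemma dense_of_orth H (M : set H) : is_subspace M ->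
  (forall v, (forall m, M m -> dot m v = 0) -> v = 0) -> closure M = setT.
Proof.
move=> sM h; apply/densityP => x e e0; have [p [Mp xp]] := projection x sM.
have /eqP := h _ xp; rewrite subr_eq0 => /eqP ->; exact: Mp.
Qed.

Lemma bop_dense_eq (U V : normedModType R[i]) (A B : bop U V) (M : set U) :
  closure M = setT -> (forall x, M x -> A x = B x) -> A = B.
Proof.
move=> /densityP Md h; apply: bopP => x; apply: limit_unique => e e0.
have [c c0 hc] := bop_bounded (A - B).
have [y My xy] := Md x _ (divr_gt0 e0 (ltr_wpDl c0 (@ltr01 R))).
have E : A x - B x = (A - B) (x - y).
  by rewrite !bopE !bopB (h y My) opprB subrKA.
rewrite E (le_lt_trans (hc _))//.
apply: le_lt_trans (_ : (c + 1) * nm (x - y) < _).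
  by rewrite ler_wpM2r ?nm_ge0// lerDl.
by rewrite mulrC -ltr_pdivlMr// ltr_wpDl.
Qed.

(** The bound on [f] puts the projection [p] into the kernel. Then z = x0 - p is orthogonal to the
    kernel, which contains f(z) x - f(x) z for every x. *)
Lemma riesz H (f : H -> R[i]) c : 0 <= c ->
  (forall a x y, f (a *: x + y) = a * f x + f y) ->
  (forall x, nm (f x) <= c * nm x) -> exists v, forall x, f x = dot v x.
Proof.
move=> c0 fl fb.
have f0 : f 0 = 0.
  by have := fl (-1) 0 0; rewrite scaler0 addr0 mulN1r addNr.
have [h|] := pselect (forall x, f x = 0); first by exists 0 => x; rewrite dot0l h.
move=> /existsNP[x0 /eqP fx0].
have sM : is_subspace [set x | f x = 0].
  by split=> // a x y /= fx fy; rewrite fl fx fy mulr0 addr0.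
have [p [Mp xp]] := projection x0 sM.
have fB x y : f (x - y) = f x - f y.
  by rewrite addrC -scaleN1r fl mulN1r addrC.
have fp : f p = 0.
  apply: limit_unique => e e0.
  have [m fm pm] := Mp _ (divr_gt0 e0 (ltr_wpDl c0 (@ltr01 R))).
  rewrite -fm -fB (le_lt_trans (fb _))//.
  apply: le_lt_trans (_ : (c + 1) * nm (p - m) < _).
    by rewrite ler_wpM2r ?nm_ge0// lerDl.
  by rewrite mulrC -ltr_pdivlMr// ltr_wpDl.
set z := x0 - p in xp.
have fz : f z != 0 by rewrite fB fp subr0.
have z0 : dot z z != 0.
  apply: contra fz => /eqP; rewrite dotxx => /complexI /eqP.
  by rewrite expf_eq0 => /andP[_ /eqP /nm_eq0 ->]; rewrite f0.
exists ((f z / dot z z)^*%C *: z) => x; rewrite dotZl conjcK.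
have /xp : f (f z *: x - f x *: z) = 0.
  by rewrite addrC -scaleNr fl -[f z *: x]addr0 fl f0 addr0 mulrC mulrN addNr.
rewrite dotC dotBr !dotZr rmorphB => /eqP; rewrite -rmorphB fmorph_eq0 subr_eq0.
by move=> /eqP h; rewrite mulrAC h mulfK.
Qed.

(** Makes [adjoint] a true adjoint rather than the default of [xget]. Boundedness comes from |B y|^2
    = <y, A B y>. *)
Lemma adjoint_exists H K (A : bop H K) :
  exists B : bop K H, forall x y, dot (B y) x = dot y (A x).
Proof.
have ex y : exists v, forall x, dot y (A x) = dot v x.
  apply: (@riesz _ _ (nm y * bn A)).
  - by rewrite mulr_ge0 ?nm_ge0 ?bn_ge0.
  - by move=> a u v; rewrite bop_linear dotDr dotZr.
  - by move=> x; rewrite (le_trans (nm_dot _ _))// -mulrA ler_wpM2l ?nm_ge0 ?bn_le.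
have [f Hf] := choice ex.
have fl : linear f.
  move=> a u v; apply: dot_extr => z; rewrite dotC -Hf.
  by rewrite dotDl dotZl !Hf -dotZl -dotDl -dotC.
have [B HB] : exists B : bop K H, forall x, B x = f x.
  apply: (@bop_make _ _ _ _ (bn A)) => // y.
  have [->|y0] := eqVneq (nm (f y)) 0; first by rewrite mulr_ge0 ?nm_ge0 ?bn_ge0.
  have yp : 0 < nm (f y) by rewrite lt_neqAle eq_sym y0 nm_ge0.
  rewrite -(ler_pM2l yp) -expr2.
  have -> : nm (f y) ^+ 2 = nm (dot (f y) (f y)).
    by rewrite dotxx nm_real ger0_norm ?sqr_ge0.
  rewrite -Hf (le_trans (nm_dot _ _))//.
  rewrite [leRHS](_ : _ = nm y * (bn A * nm (f y))); last by ring.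
  by rewrite ler_wpM2l ?nm_ge0 ?bn_le.
by exists B => x y; rewrite HB -Hf.
Qed.

Lemma adjP H K (A : bop H K) x y : dot (adjoint A y) x = dot y (A x).
Proof. exact: (xgetPex _ (adjoint_exists A)). Qed.

Lemma adjPr H K (A : bop H K) x y : dot x (adjoint A y) = dot (A x) y.
Proof. by rewrite dotC adjP -dotC. Qed.

Lemma adj_unique H K (A : bop H K) (B : bop K H) :
  (forall x y, dot (B y) x = dot y (A x)) -> adjoint A = B.
Proof.
move=> h; apply: bopP => y; apply: dot_extr => x.
by rewrite dotC adjP -h -dotC.
Qed.

Lemma adjK H K (A : bop H K) : adjoint (adjoint A) = A.
Proof. by apply: adj_unique => x y; rewrite adjPr. Qed.

Lemma adj_comp H K L (A : bop K L) (B : bop H K) :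
  adjoint (A \c B) = adjoint B \c adjoint A.
Proof. by apply: adj_unique => x y; rewrite !bopE !adjP. Qed.

Lemma adjD H K (A B : bop H K) : adjoint (A + B) = adjoint A + adjoint B.
Proof. by apply: adj_unique => x y; rewrite !bopE dotDl dotDr !adjP. Qed.

Lemma adj_scale H K a (A : bop H K) : adjoint (a *: A) = a^*%C *: adjoint A.
Proof. by apply: adj_unique => x y; rewrite !bopE dotZl dotZr !adjP conjcK. Qed.

Lemma adjN H K (A : bop H K) : adjoint (- A) = - adjoint A.
Proof. by apply: adj_unique => x y; rewrite !bopE dotNl dotNr !adjP. Qed.

Lemma adj_id H : adjoint (bop_id H) = bop_id H.
Proof. by apply: adj_unique. Qed.

Lemma bn_adj H K (A : bop H K) : bn (adjoint A) = bn A.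
Proof.
have le H' K' (B : bop H' K') : bn (adjoint B) <= bn B.
  apply: bn_lub => [|y]; first exact: bn_ge0.
  have [->|y0] := eqVneq (nm (adjoint B y)) 0; first by rewrite mulr_ge0 ?nm_ge0 ?bn_ge0.
  have yp : 0 < nm (adjoint B y) by rewrite lt_neqAle eq_sym y0 nm_ge0.
  rewrite -(ler_pM2l yp) -expr2.
  have -> : nm (adjoint B y) ^+ 2 = nm (dot (adjoint B y) (adjoint B y)).
    by rewrite dotxx nm_real ger0_norm ?sqr_ge0.
  rewrite adjP (le_trans (nm_dot _ _))//.
  rewrite [leRHS](_ : _ = nm y * (bn B * nm (adjoint B y))); last by ring.
  by rewrite ler_wpM2l ?nm_ge0 ?bn_le.
by apply: le_anti; rewrite le -{1}(adjK A) le.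
Qed.

End Projection.

Section CompAlgebra.
Context {R : realType}.
Implicit Types U V W X : normedModType R[i].

Lemma compA U V W X (A : bop W X) (B : bop V W) (C : bop U V) :
  A \c (B \c C) = A \c B \c C.
Proof. exact: bopP. Qed.

Lemma comp1l U V (A : bop U V) : bop_id V \c A = A.
Proof. exact: bopP. Qed.

Lemma comp1r U V (A : bop U V) : A \c bop_id U = A.
Proof. exact: bopP. Qed.

Lemma compDl U V W (A B : bop V W) (C : bop U V) :
  (A + B) \c C = A \c C + B \c C.
Proof. exact: bopP. Qed.

Lemma compDr U V W (A : bop V W) (B C : bop U V) :
  A \c (B + C) = A \c B + A \c C.
Proof. by apply: bopP => x; rewrite !bopE bopD. Qed.

Lemma compNl U V W (A : bop V W) (C : bop U V) : (- A) \c C = - (A \c C).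
Proof. exact: bopP. Qed.

Lemma compNr U V W (A : bop V W) (B : bop U V) : A \c (- B) = - (A \c B).
Proof. by apply: bopP => x; rewrite !bopE bopN. Qed.

Lemma compBl U V W (A B : bop V W) (C : bop U V) :
  (A - B) \c C = A \c C - B \c C.
Proof. by rewrite compDl compNl. Qed.

Lemma compBr U V W (A : bop V W) (B C : bop U V) :
  A \c (B - C) = A \c B - A \c C.
Proof. by rewrite compDr compNr. Qed.

Lemma compZl U V W a (A : bop V W) (C : bop U V) : (a *: A) \c C = a *: (A \c C).
Proof. exact: bopP. Qed.

Lemma compZr U V W a (A : bop V W) (B : bop U V) : A \c (a *: B) = a *: (A \c B).
Proof. by apply: bopP => x; rewrite !bopE bopZ. Qed.

Lemma comp0l U V W (C : bop U V) : (0 : bop V W) \c C = 0.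
Proof. exact: bopP. Qed.

Lemma comp0r U V W (C : bop V W) : C \c (0 : bop U V) = 0.
Proof. by apply: bopP => x; rewrite !bopE bop0. Qed.

End CompAlgebra.

(** * Nonnegative operators, square roots and polar decomposition *)

Section Nonneg.
Context {R : realType}.
Implicit Types H K L : hilbertType R.

Lemma half_real : nm (2^-1 : R[i]) = 2^-1.
Proof. by rewrite nmV (_ : 2 = (2 : R)%:C) ?nm_real ?ger0_norm// rmorph_nat. Qed.

Lemma nonneg_real H (A : bop H H) x : nonneg_op A ->
  dot x (A x) = (complex.Re (dot x (A x)))%:C /\ 0 <= complex.Re (dot x (A x)).
Proof.
move=> /(_ x); rewrite lecE /= => /andP[/eqP h ->]; split=> //.
by move: h; case: (dot x _) => a b /= ->.
Qed.

(** Polarisation: the form is real at x, y, x + y and x + i y. *)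
Lemma nonneg_sym H (A : bop H H) : nonneg_op A -> adjoint A = A.
Proof.
move=> A0; apply: adj_unique => x y; rewrite dotC.
have im z : complex.Im (dot z (A z)) = 0 by rewrite (nonneg_real z A0).1.
have := im (x + y); rewrite bopD dotDl !dotDr.
have := im (x + 'i%C *: y); rewrite bopD bopZ dotDl !dotDr !dotZl !dotZr.
have := im x; have := im y.
case: (dot x (A x)) => a a'; case: (dot y (A y)) => b b'.
case: (dot x (A y)) => c c'; case: (dot y (A x)) => d d' /= -> ->.
by move=> h1 h2; congr (_ +i* _); lra.
Qed.

(** Positivity of the form at x - c^-1 A x, its last term being estimated by the norm of [A]. *)
Lemma nonneg_bound H (A : bop H H) c x : nonneg_op A -> 0 < c -> bn A <= c ->
  nm (A x) ^+ 2 <= c * complex.Re (dot x (A x)).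
Proof.
move=> A0 c0 Ac; have sA := nonneg_sym A0.
have := (nonneg_real (x + (- c^-1)%:C *: A x) A0).2.
rewrite bopD bopZ dotDl !dotDr !dotZl !dotZr conjc_real.
have -> : dot x (A (A x)) = (nm (A x) ^+ 2)%:C by rewrite -adjP sA dotxx.
rewrite dotxx.
have h : complex.Re (dot (A x) (A (A x))) <= c * nm (A x) ^+ 2.
  rewrite (le_trans (ler_norm _))// (le_trans (Re_le_nm _))//.
  rewrite (le_trans (nm_dot _ _))// expr2 mulrCA ler_wpM2l ?nm_ge0//.
  exact: bn_ub.
rewrite (nonneg_real x A0).1 (nonneg_real (A x) A0).1 /=.
move: h; set s := complex.Re _; set t := complex.Re _; set q := nm _ ^+ 2.
rewrite ?mul0r ?mulr0 ?subr0 => sq h.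
have : 0 <= c * (t + - c^-1 * q + (- c^-1 * q + - c^-1 * (- c^-1 * s))).
  by rewrite mulr_ge0// ltW.
have -> : c * (t + - c^-1 * q + (- c^-1 * q + - c^-1 * (- c^-1 * s))) =
  c * t - (c * c^-1) * (q *+ 2) + (c * c^-1) * (c^-1 * s) by ring.
rewrite divff ?gt_eqF// !mul1r => h2.
have : c^-1 * s <= q by rewrite mulrC ler_pdivrMr// mulrC.
lra.
Qed.

Lemma nonneg_ker H (A : bop H H) x : nonneg_op A ->
  complex.Re (dot x (A x)) = 0 -> A x = 0.
Proof.
move=> A0 h; have c0 : 0 < bn A + 1 by rewrite ltr_wpDl ?bn_ge0.
have := nonneg_bound x A0 c0; rewrite h mulr0 lerDl ler01 => /(_ isT) h0.
apply: nm_eq0; apply/eqP; rewrite -sqrf_eq0; apply/eqP/le_anti.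
by rewrite h0 sqr_ge0.
Qed.

(* A fixed point of Y |-> (X + Y^2) / 2 is 1 - sqrt (1 - X); the iterates are  *)
(* dominated by those of t |-> (1 + t^2) / 2, which increase to 1.             *)
Lemma sqrt_fixpoint H (X : bop H H) : bn X <= 1 -> adjoint X = X ->
  exists Y : bop H H, [/\ bn Y <= 1, adjoint Y = Y & Y = 2^-1 *: (X + Y \c Y)].
Proof.
move=> X1 sX.
pose t n : R := iter n (fun t => 2^-1 * (1 + t ^+ 2)) 0.
pose Y n : bop H H := iter n (fun Y => 2^-1 *: (X + Y \c Y)) 0.
have tS n : t n.+1 = 2^-1 * (1 + t n ^+ 2) by [].
have YS n : Y n.+1 = 2^-1 *: (X + Y n \c Y n) by [].
have t01 n : 0 <= t n <= 1.
  elim: n => [|n /andP[t0 t1]]; first by rewrite /t/= lexx ler01.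
  rewrite tS; apply/andP; split; first by rewrite mulr_ge0// addr_ge0// sqr_ge0.
  have : t n ^+ 2 <= 1 by rewrite exprn_ile1.
  lra.
have Yt n : bn (Y n) <= t n.
  elim: n => [|n IH]; first by rewrite /Y /t/= bn0.
  rewrite tS YS bnZ half_real ler_wpM2l// (le_trans (bnD _ _))// lerD//.
  by rewrite (le_trans (bn_comp _ _))// expr2 ler_pM ?bn_ge0.
(* Increments of [Y] are dominated by those of [t], since Y'^2 - Y^2 = Y' (Y' - Y) + (Y' - Y) Y
   holds without commutation. *)
have Yd n : bn (Y n.+1 - Y n) <= t n.+1 - t n.
  elim: n => [|n IH].
    rewrite tS YS /Y /t /= comp0l addr0 subr0 bnZ half_real expr0n/=.
    by rewrite addr0 subr0 ler_wpM2l.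
  rewrite [X in bn (_ - X)]YS [X in bn (X - _)]YS -scalerBr bnZ half_real.
  rewrite opprD addrACA subrr add0r.
  have -> : Y n.+1 \c Y n.+1 - Y n \c Y n =
    Y n.+1 \c (Y n.+1 - Y n) + (Y n.+1 - Y n) \c Y n.
    by rewrite compBr compBl addrA subrK.
  rewrite [X in _ <= _ - X]tS [X in _ <= X - _]tS -mulrBr ler_wpM2l// (le_trans (bnD _ _))//.
  have -> : 1 + t n.+1 ^+ 2 - (1 + t n ^+ 2) =
    t n.+1 * (t n.+1 - t n) + (t n.+1 - t n) * t n by ring.
  by rewrite lerD// (le_trans (bn_comp _ _))// ler_pM ?bn_ge0.
have td m n : (m <= n)%N -> bn (Y n - Y m) <= t n - t m.
  elim: n => [|n IH]; first by rewrite leqn0 => /eqP ->; rewrite !subrr bn0.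
  rewrite leq_eqVlt => /predU1P[->|]; first by rewrite !subrr bn0.
  rewrite ltnS => /IH h; rewrite -(subrKA (Y n)) -[leRHS](subrKA (t n)).
  by rewrite (le_trans (bnD _ _))// lerD.
have tmono : nondecreasing_seq t.
  by apply/nondecreasing_seqP => n; rewrite -subr_ge0 (le_trans _ (Yd n))// bn_ge0.
have tc : cvgn t.
  apply: nondecreasing_is_cvgn => //; exists 1 => _ [n _ <-].
  by have /andP[] := t01 n.
have [Z HZ] : exists B : bop H H, forall e : R, 0 < e ->
    exists N, forall n, (N <= n)%N -> bn (Y n - B) <= e.
  apply: bop_limit => e e0.
  have /cvgrPdist_lt/(_ _ e0)[N _ HN] := tc; exists N => n Nn.
  rewrite (le_trans (td _ _ Nn))//.
  have := HN N (leqnn N); rewrite /= ltr_norml => /andP[_ h].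
  have := nondecreasing_cvgn_le tmono tc n; lra.
have sY n : adjoint (Y n) = Y n.
  elim: n => [|n IH].
    by apply: adj_unique => x y; rewrite !bopE dot0l dot0r.
  by rewrite YS adj_scale adjD adj_comp IH sX fmorphV rmorph_nat.
have eq0 (A : bop H H) : (forall e, 0 < e -> bn A <= e) -> A = 0.
  move=> h; apply: bn_eq0; apply: le_anti; rewrite bn_ge0 andbT.
  by apply: le_eps => e; rewrite add0r; exact: h.
have Z1 : bn Z <= 1.
  apply: le_eps => e e0; have [N HN] := HZ _ e0.
  rewrite -(subrK (Y N) Z) addrC (le_trans (bnD _ _))// lerD//.
    by rewrite (le_trans (Yt N))//; have /andP[] := t01 N.
  by rewrite bn_dist HN.
exists Z; split=> //.
  apply/eqP; rewrite -subr_eq0; apply/eqP/eq0 => e e0.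
  have e2 : 0 < e / 2 by rewrite divr_gt0.
  have [N HN] := HZ _ e2; rewrite -(subrKA (Y N)) (le_trans (bnD _ _))//.
  rewrite [leRHS]splitr lerD ?HN// -{1}(sY N) -adjN -adjD bn_adj bn_dist.
  exact: HN.
apply/eqP; rewrite -subr_eq0; apply/eqP/eq0 => e e0.
have e2 : 0 < e / 2 by rewrite divr_gt0.
have [N HN] := HZ _ e2; rewrite -(subrKA (Y N.+1)) (le_trans (bnD _ _))//.
rewrite [leRHS]splitr lerD//; first by rewrite bn_dist HN.
rewrite YS -scalerBr bnZ half_real opprD addrACA subrr add0r.
have -> : Y N \c Y N - Z \c Z = Y N \c (Y N - Z) + (Y N - Z) \c Z.
  by rewrite compBr compBl addrA subrK.
have h1 : bn (Y N \c (Y N - Z)) <= 1 * (e / 2).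
  rewrite (le_trans (bn_comp _ _))// ler_pM ?bn_ge0// ?HN//.
  by rewrite (le_trans (Yt N))//; have /andP[] := t01 N.
have h2 : bn ((Y N - Z) \c Z) <= (e / 2) * 1.
  by rewrite (le_trans (bn_comp _ _))// ler_pM ?bn_ge0// ?HN.
have := bnD (Y N \c (Y N - Z)) ((Y N - Z) \c Z); lra.
Qed.

(** For c above the norm of [A], X = 1 - A / c is a symmetric contraction by [nonneg_bound]; its
    fixed point Y satisfies (1 - Y)^2 = 1 - X = A / c. *)
Lemma sqrt_exists H (A : bop H H) : nonneg_op A ->
  exists B : bop H H, nonneg_op B /\ B \c B = A.
Proof.
move=> A0; pose c := bn A + 1; have c0 : 0 < c by rewrite ltr_wpDl ?bn_ge0.
have ci : 0 <= c^-1 by rewrite invr_ge0 ltW.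
have Ac : bn A <= c by rewrite lerDl.
pose X := bop_id H - c^-1%:C *: A.
have sX : adjoint X = X.
  by rewrite adjD adjN adj_scale adj_id conjc_real nonneg_sym.
have X1 : bn X <= 1.
  apply: bn_lub => // x; rewrite mul1r.
  rewrite -(@ler_pXn2r _ 2) ?nnegrE ?nm_ge0//.
  rewrite /X !bopE nm_sqrD nmN dotNr nmZ nm_real (ger0_norm ci) dotZr exprMn.
  have := nonneg_bound x A0 c0 Ac.
  rewrite (nonneg_real x A0).1 /= mul0r subr0 => h.
  have /(ler_wpM2l ci) : nm (A x) ^+ 2 <= c * complex.Re (dot x (A x)) := h.
  move=> /(ler_wpM2l ci); rewrite (mulrA _ c) mulVf ?gt_eqF// mul1r.
  have := mulr_ge0 ci (nonneg_real x A0).2; rewrite mulrA -expr2; lra.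
have [Y [Y1 sY YE]] := sqrt_fixpoint X1 sX.
have BB : (bop_id H - Y) \c (bop_id H - Y) = c^-1%:C *: A.
  have Y2 : Y + Y = X + Y \c Y.
    rewrite -[Y in LHS]scale1r -scalerDl -[1 + 1]/(2 : R[i]) YE scalerA.
    by rewrite divff// scale1r -YE.
  rewrite compBl !compBr !comp1l comp1r opprB addrACA -opprD.
  have -> : Y \c Y = Y + Y - X by rewrite Y2 addrAC subrr add0r.
  by rewrite [Y + Y - X]addrC addrA addrK /X opprB addrC subrK.
exists ((Num.sqrt c)%:C *: (bop_id H - Y)); split.
  move=> x; rewrite bopE dotZr mulr_ge0// ?ler0c ?sqrtr_ge0// !bopE dotBr dotxx.
  have im : complex.Im (dot x (Y x)) = 0.
    have : dot x (Y x) = (dot x (Y x))^*%C by rewrite -dotC -{2}sY adjP.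
    by case: (dot x _) => a b /= [] /eqP; rewrite -addr_eq0 -mulr2n mulrn_eq0 => /eqP.
  have : complex.Re (dot x (Y x)) <= nm x ^+ 2.
    rewrite (le_trans (ler_norm _))// (le_trans (Re_le_nm _))//.
    rewrite (le_trans (nm_dot _ _))// expr2 ler_wpM2l ?nm_ge0//.
    by have := bn_ub x Y1; rewrite mul1r.
  move: im; case: (dot x _) => a b /= -> h.
  by rewrite lecE /= subrr eqxx subr_ge0.
rewrite compZl compZr scalerA BB scalerA -!rmorphM/= -expr2 sqr_sqrtr ?(ltW c0)//.
by rewrite divff ?gt_eqF// scale1r.
Qed.

Lemma sqrt_opP H (A : bop H H) : nonneg_op A ->
  nonneg_op (sqrt_op A) /\ sqrt_op A \c sqrt_op A = A.
Proof. by move=> /sqrt_exists h; exact: (xgetPex _ h). Qed.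

Lemma adj_nonneg H K (A : bop H K) : nonneg_op (adjoint A \c A).
Proof. by move=> x; rewrite bopE adjPr dotxx ler0c sqr_ge0. Qed.

Lemma abs_opP H K (A : bop H K) :
  nonneg_op (abs_op A) /\ abs_op A \c abs_op A = adjoint A \c A.
Proof. exact/sqrt_opP/adj_nonneg. Qed.

Lemma nm_abs H K (A : bop H K) x : nm (abs_op A x) = nm (A x).
Proof.
have [P0 PP] := abs_opP A.
have : (nm (abs_op A x) ^+ 2)%:C = (nm (A x) ^+ 2)%:C.
  rewrite -!dotxx -adjP (nonneg_sym P0).
  by rewrite -(bop_compE (abs_op A)) PP bopE adjP.
by move=> /complexI /eqP; rewrite eqrXn2 ?nm_ge0// => /eqP.
Qed.

(** On P u + v with P v = 0 the map is A u; it contracts because P u and v are orthogonal, and sums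
    of this kind are dense. For the last equality, the nonnegative operator 1 - V^* V has vanishing
    form at P x, so it kills P x. *)
Lemma polar H K (A : bop H K) : exists V : bop H K,
  [/\ bn V <= 1, V \c abs_op A = A & adjoint V \c A = abs_op A].
Proof.
have [P0 PP] := abs_opP A; set P := abs_op A in P0 PP *.
have sP := nonneg_sym P0.
pose S x y := exists u v, [/\ x = P u + v, y = A u & P v = 0].
have [V [V1 VS]] : exists V : bop H K, bn V <= 1 /\ forall x y, S x y -> V x = y.
  apply: bop_extend => //.
  - move=> a x y x' y' [u [v [-> -> Pv]]] [u' [v' [-> -> Pv']]].
    exists (a *: u + u'), (a *: v + v'); split.
    + by rewrite bop_linear scalerDr addrACA.
    + by rewrite bop_linear.
    + by rewrite bop_linear Pv Pv' scaler0 addr0.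
  - move=> x y [u [v [-> -> Pv]]]; rewrite mul1r.
    rewrite -(@ler_pXn2r _ 2) ?nnegrE ?nm_ge0// nm_sqrD -(nm_abs A).
    by rewrite -adjPr sP Pv dot0r /= mul0rn addr0 lerDl sqr_ge0.
  - apply: dense_of_orth.
      split=> [|a x y [x' [u [v [-> _ Pv]]]] [y' [u' [v' [-> _ Pv']]]]].
        by exists 0, 0, 0; rewrite !bop0 addr0.
      exists (A (a *: u + u')), (a *: u + u'), (a *: v + v'); split=> //.
        by rewrite bop_linear scalerDr addrACA.
      by rewrite bop_linear Pv Pv' scaler0 addr0.
    move=> v hv; have Pv : P v = 0.
      apply: dot_eq0P => u; rewrite -adjP sP; apply: hv.
      by exists (A u), u, 0; rewrite addr0 bop0.
    have /eqP : dot v v = 0 by apply: hv; exists 0, 0, v; rewrite !bop0 add0r.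
    by rewrite dotxx => /eqP/complexI/eqP; rewrite expf_eq0 => /andP[_ /eqP/nm_eq0].
have VP : V \c P = A by apply: bopP => x; apply: VS; exists x, 0; rewrite addr0 bop0.
exists V; split=> //.
pose D := bop_id H - adjoint V \c V.
have D0 : nonneg_op D.
  move=> x; rewrite /D !bopE dotBr adjPr !dotxx -rmorphB ler0c subr_ge0.
  by rewrite lerXn2r ?nnegrE ?nm_ge0//; have := bn_ub x V1; rewrite mul1r.
apply: bopP => x; have : D (P x) = 0.
  apply: nonneg_ker => //; rewrite /D !bopE dotBr adjPr !dotxx.
  by rewrite -(bop_compE V) VP nm_abs /= subrr.
by rewrite /D !bopE -(bop_compE V) VP => /eqP; rewrite subr_eq0 => /eqP.
Qed.

End Nonneg.

(** * Orthonormal bases *)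

Section Bases.
Context {R : realType}.
Implicit Types H K L : hilbertType R.

Definition orthonormal H (B : set H) : Prop :=
  forall x y, B x -> B y -> dot x y = (x == y)%:R.

Lemma linear_span_is_subspace H (B : set H) : is_subspace (linear_span B).
Proof.
split.
  by exists 0%N, (fun=> 0), (fun=> 0); split; [case|rewrite big_ord0].
move=> a _ _ [m [c [e [Be ->]]]] [n [d [f [Bf ->]]]].
exists (m + n)%N, (fun i : 'I_(m + n) => match fintype.split i with inl j => a * c j | inr k => d k end),
  (fun i : 'I_(m + n) => match fintype.split i with inl j => e j | inr k => f k end); split.
  by move=> i; case: (fintype.split i).
rewrite big_split_ord /= scaler_sumr; congr (_ + _); apply: eq_bigr => i _.
  by rewrite (unsplitK (inl i)) scalerA.
by rewrite (unsplitK (inr i)).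
Qed.

Lemma linear_span_mem H (B : set H) x : B x -> linear_span B x.
Proof.
by move=> Bx; exists 1%N, (fun=> 1), (fun=> x); split=> //; rewrite big_ord1 scale1r.
Qed.

(** Zorn: a vector orthogonal to a maximal orthonormal set could be normalised and added. The basis
    selected in [trace] is therefore a genuine one. *)
Lemma onb_exists H : exists B : set H, orthonormal_basis B.
Proof.
have [A [oA maxA]] : exists A : set H, orthonormal A /\
    forall B, A `<` B -> ~ orthonormal B.
  apply: Zorn_bigcup => F FP Ft x y [X FX Xx] [Y FY Yy].
  have [XY|YX] := Ft _ _ FX FY; first by apply: (FP _ FY) => //; exact: XY.
  by apply: (FP _ FX) => //; exact: YX.
exists A; split=> //; apply: dense_of_orth; first exact: linear_span_is_subspace.
move=> v hv; apply/eqP; apply: contraT => v0.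
have vp : 0 < nm v by rewrite nm_gt0.
pose e := (nm v)^-1%:C *: v.
have eA y : A y -> dot y e = 0 by move=> /linear_span_mem/hv h; rewrite dotZr h mulr0.
have ee : dot e e = 1.
  by rewrite dotxx nmZ nm_real ger0_norm ?invr_ge0 ?nm_ge0// mulVf ?gt_eqF// expr1n.
have nAe : ~ A e by move=> /eA; rewrite ee => /eqP; rewrite oner_eq0.
exfalso; apply: (maxA (A `|` [set e])).
  by split=> [y Ay|h]; [left|apply: nAe; apply: h; right].
move=> x y [Ax|->] [Ay|->]; first exact: oA.
- by rewrite eA//; case: eqP => // xe; rewrite xe in Ax.
- by rewrite dotC eA// conjc0; case: eqP => // ey; rewrite -ey in Ay.
- by rewrite ee eqxx.
Qed.

(** Literally the basis selected by [trace], so that traces unfold to sums over [onb]. *)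
Definition onb H : set H := xget set0 [set B : set H | orthonormal_basis B].

Arguments onb : clear implicits.

Lemma onbP H : orthonormal_basis (onb H).
Proof. exact: (xgetPex _ (onb_exists H)). Qed.

Section Bessel.
Variables (H : hilbertType R) (B : set H).
Hypothesis oB : orthonormal B.

Definition proj_seq (s : seq H) (x : H) : H := \sum_(e <- s) dot e x *: e.

Lemma dot_proj_seq s x y : uniq s -> (forall e, e \in s -> B e) -> y \in s ->
  dot y (proj_seq s x) = dot y x.
Proof.
move=> us sB ys; rewrite /proj_seq dot_sumr (bigD1_seq y)//= dotZr.
rewrite (oB (sB _ ys) (sB _ ys)) eqxx mulr1.
rewrite big1_seq ?addr0// => e /andP[ey es].
by rewrite dotZr (oB (sB _ ys) (sB _ es)) eq_sym (negPf ey) mulr0.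
Qed.

Lemma bessel_eq s x : uniq s -> (forall e, e \in s -> B e) ->
  \sum_(e <- s) nm (dot e x) ^+ 2 = nm x ^+ 2 - nm (x - proj_seq s x) ^+ 2.
Proof.
move=> us sB; have E : dot (proj_seq s x) (proj_seq s x) =
    (\sum_(e <- s) nm (dot e x) ^+ 2)%:C.
  rewrite {1}/proj_seq dot_suml rmorph_sum /=.
  rewrite big_seq [RHS]big_seq; apply: eq_bigr => e es.
  by rewrite dotZl dot_proj_seq// mulrC -sqr_normc nmE -rmorphXn.
have E2 : dot (proj_seq s x) x = (\sum_(e <- s) nm (dot e x) ^+ 2)%:C.
  rewrite /proj_seq dot_suml rmorph_sum /=; apply: eq_bigr => e _.
  by rewrite dotZl mulrC -sqr_normc nmE -rmorphXn.
have := nm_sqrD x (- proj_seq s x); rewrite nmN dotNr [dot x _]dotC E2 => ->.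
by have := E; rewrite dotxx => /complexI ->; rewrite conjc_real /=; lra.
Qed.

Lemma proj_seq_span s (y : H) n (a : 'I_n -> R[i]) (e : 'I_n -> H) :
  uniq s -> (forall e, e \in s -> B e) -> (forall i, e i \in s) ->
  y = \sum_i a i *: e i -> proj_seq s y = y.
Proof.
move=> us sB es ->; rewrite /proj_seq.
under eq_bigr do rewrite dot_sumr scaler_suml.
rewrite exchange_big; apply: eq_bigr => i _.
rewrite (bigD1_seq (e i))//= dotZr oB ?eqxx ?mulr1; [|exact: sB|exact: sB].
rewrite big1_seq ?addr0// => f /andP[fe fs].
by rewrite dotZr oB ?(negPf fe) ?mulr0 ?scale0r//; apply: sB.
Qed.

Lemma proj_seqB s x y : proj_seq s (x - y) = proj_seq s x - proj_seq s y.
Proof.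
rewrite /proj_seq -sumrB; apply: eq_bigr => e _.
by rewrite dotBr scalerBl.
Qed.

End Bessel.

(** Bessel gives one inequality. For the other, a finite combination of basis vectors is close to x,
    and the projection on the vectors it uses is at least as close. *)
Lemma parseval H (B : set H) x : orthonormal_basis B ->
  \esum_(e in B) (nm (dot e x) ^+ 2)%:E = (nm x ^+ 2)%:E.
Proof.
move=> [oB dB]; apply/eqP; rewrite eq_le; apply/andP; split.
  apply: ge_ereal_sup => _ [X [fX XB] <-].
  have sB (e : H) : e \in fset_set X -> B e by rewrite in_fset_set// inE => /XB.
  rewrite fsbig_finite//= sumEFin lee_fin (bessel_eq oB x (fset_uniq _) sB).
  by rewrite gerBl sqr_ge0.
apply/lee_addgt0Pr => e e0.
(* Chosen so that d^2 is at most e. *)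
pose d := Num.min 1 e.
have d0 : 0 < d by rewrite lt_min ltr01.
have [y [n [a [f [Bf yE]]]] xy] := (densityP _).1 dB x _ d0.
pose s := undup (codom f).
have us : uniq s by exact: undup_uniq.
have sB z : z \in s -> B z by rewrite mem_undup => /codomP[i ->].
have fs i : f i \in s by rewrite mem_undup codom_f.
have py := proj_seq_span oB us sB fs yE.
have h : nm (x - proj_seq s x) <= nm (x - y).
  have := bessel_eq oB (x - y) us sB; rewrite proj_seqB py.
  rewrite opprB addrA subrK => E.
  have : 0 <= \sum_(e <- s) nm (dot e (x - y)) ^+ 2.
    by apply: sumr_ge0 => z _; exact: sqr_ge0.
  by rewrite E subr_ge0 ler_pXn2r ?nnegrE ?nm_ge0.
have le1 : ((nm x ^+ 2)%:E <= (\sum_(e <- s) nm (dot e x) ^+ 2)%:E + e%:E)%E.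
  rewrite -EFinD lee_fin (bessel_eq oB)//.
  have h2 : nm (x - proj_seq s x) ^+ 2 <= d ^+ 2.
    by rewrite lerXn2r ?nnegrE ?nm_ge0 ?(ltW d0)// (le_trans h)// ltW.
  have h3 : d ^+ 2 <= e.
    rewrite expr2 -[e]mul1r ler_pM ?(ltW d0)// ge_min lexx// orbT//.
  lra.
apply: le_trans le1 _; rewrite leeD2r//; apply: esum_ge; exists [set` s].
  by split=> //; exact: finite_seq.
by rewrite -fsbig_seq// sumEFin.
Qed.

Lemma esum_swap (T1 T2 : choiceType) (I : set T1) (J : set T2)
    (a : T1 -> T2 -> \bar R) : (forall i j, (0 <= a i j)%E) ->
  \esum_(i in I) \esum_(j in J) a i j = \esum_(j in J) \esum_(i in I) a i j.
Proof.
move=> a0; rewrite (esum_esum (J := fun=> J))// (esum_esum (J := fun=> I))//.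
rewrite (reindex_esum (J `*`` fun=> I) _ (fun x => (x.2, x.1)))//; split=> //=.
- by move=> [i j] [/=].
- by move=> [i1 i2] [j1 j2] /= _ _ [] -> ->.
- by move=> [i1 i2] [Pi1 Qi2] /=; exists (i2, i1).
Qed.

Lemma esumZ_le (T : choiceType) (I : set T) (a : T -> \bar R) (c : R) :
  0 <= c -> (forall i, (0 <= a i)%E) ->
  (\esum_(i in I) (c%:E * a i) <= c%:E * \esum_(i in I) a i)%E.
Proof.
move=> c0 a0; apply: ge_ereal_sup => _ [X [fX XI] <-].
rewrite fsbig_finite//= -ge0_sume_distrr//.
rewrite -fsbig_finite// lee_wpmul2l ?lee_fin//.
by apply: ereal_sup_ubound; exists X.
Qed.

End Bases.
Arguments onb {R} H.

(** * Hilbert-Schmidt and trace norms *)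

Section TraceNorm.
Context {R : realType}.
Implicit Types H K L : hilbertType R.
Local Open Scope ereal_scope.

(** The square of the Hilbert-Schmidt norm, extended-real, so that being Hilbert-Schmidt reads
    [hsn A <= a%:E]. *)
Definition hs H K (B : set H) (A : bop H K) : \bar R :=
  \esum_(e in B) ((nm (A e) ^+ 2)%R)%:E.

Definition hsn H K (A : bop H K) : \bar R := hs (onb H) A.

Let sq_ge0 (a : R) : 0 <= ((a ^+ 2)%R)%:E.
Proof. by rewrite lee_fin sqr_ge0. Qed.

(** Parseval for each A e, then exchange of the two sums. As the two bases are unrelated,
    independence of the basis follows. *)
Lemma hs_adj H K (B1 : set H) (B2 : set K) (A : bop H K) :
  orthonormal_basis B1 -> orthonormal_basis B2 -> hs B1 A = hs B2 (adjoint A).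
Proof.
move=> h1 h2; rewrite /hs.
under eq_esum => e _ do rewrite -(parseval (A e) h2).
rewrite esum_swap//; apply: eq_esum => f _; rewrite -(parseval _ h1).
by apply: eq_esum => e _; rewrite adjPr dotC nmJ.
Qed.

Lemma hs_basis H K (B : set H) (A : bop H K) :
  orthonormal_basis B -> hs B A = hsn A.
Proof.
by move=> hB; rewrite /hsn (hs_adj A hB (onbP K)) -(hs_adj A (onbP H) (onbP K)).
Qed.

Lemma hsn_adj H K (A : bop H K) : hsn (adjoint A) = hsn A.
Proof. by rewrite /hsn -(hs_adj A (onbP H) (onbP K)). Qed.

Lemma hsn_compl H K L (X : bop K L) (A : bop H K) (x a : R) :
  (bn X <= x)%R -> hsn A <= a%:E -> hsn (X \c A) <= (x ^+ 2 * a)%:E.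
Proof.
move=> Xx Aa; have x0 : (0 <= x)%R by rewrite (le_trans (bn_ge0 X)).
apply: (@le_trans _ _ ((x ^+ 2)%:E * hsn A)).
  rewrite /hsn /hs (le_trans _ (esumZ_le _ _ _)) ?sqr_ge0//.
  apply: le_esum => e _; rewrite -EFinM lee_fin -exprMn.
  by rewrite lerXn2r ?nnegrE ?nm_ge0 ?mulr_ge0 ?nm_ge0// bopE; exact: bn_ub.
by rewrite [leRHS]EFinM lee_wpmul2l ?lee_fin ?sqr_ge0.
Qed.

Lemma hsn_compr H K L (A : bop K L) (X : bop H K) (x a : R) :
  (bn X <= x)%R -> hsn A <= a%:E -> hsn (A \c X) <= (x ^+ 2 * a)%:E.
Proof.
move=> Xx Aa; rewrite -hsn_adj adj_comp; apply: hsn_compl; rewrite ?hsn_adj//.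
by rewrite bn_adj.
Qed.

Lemma hsn_bn H K (A : bop H K) (a : R) : hsn A <= a%:E -> (bn A ^+ 2 <= a)%R.
Proof.
move=> Aa; have a0 : (0 <= a)%R.
  by rewrite -lee_fin (le_trans _ Aa)//; apply: esum_ge0 => e _.
rewrite -(sqr_sqrtr a0) ler_pXn2r ?nnegrE ?bn_ge0 ?sqrtr_ge0//.
apply: bn_lub => [|x]; first exact: sqrtr_ge0.
rewrite -(@ler_pXn2r _ 2) ?nnegrE ?mulr_ge0 ?sqrtr_ge0 ?nm_ge0// exprMn.
rewrite sqr_sqrtr// -lee_fin -(parseval _ (onbP K)).
apply: (@le_trans _ _ ((nm x ^+ 2)%:E * hsn (adjoint A))).
  rewrite /hsn /hs (le_trans _ (esumZ_le _ _ _)) ?sqr_ge0//.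
  apply: le_esum => e _; rewrite -EFinM lee_fin -exprMn.
  rewrite lerXn2r ?nnegrE ?nm_ge0 ?mulr_ge0 ?nm_ge0// -adjP mulrC.
  exact: nm_dot.
by rewrite hsn_adj mulrC [leRHS]EFinM lee_wpmul2l ?lee_fin ?sqr_ge0.
Qed.

(** Cauchy-Schwarz for sums in the form 2 a b <= s a^2 + b^2 / s; each use picks the weight [s] that
    balances the two terms. *)
Lemma esum_dot_le H K (B : set H) (P Q : bop H K) (p q s : R) :
  orthonormal_basis B -> (0 < s)%R -> hsn P <= p%:E -> hsn Q <= q%:E ->
  \esum_(e in B) (nm (dot (P e) (Q e)))%:E <= ((s * p + s^-1 * q) / 2)%:E.
Proof.
move=> hB s0; rewrite -(hs_basis P hB) -(hs_basis Q hB) => Pp Qq.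
have si : (0 < s^-1)%R by rewrite invr_gt0.
apply: (@le_trans _ _ ((s / 2)%:E * hs B P + (s^-1 / 2)%:E * hs B Q)); last first.
  rewrite mulrDl EFinD leeD//.
    by rewrite [in leRHS]mulrAC [leRHS]EFinM lee_wpmul2l// lee_fin divr_ge0// ltW.
  by rewrite [in leRHS]mulrAC [leRHS]EFinM lee_wpmul2l// lee_fin divr_ge0// ltW.
apply: (@le_trans _ _ (\esum_(e in B) ((s / 2)%:E * (nm (P e) ^+ 2)%:E) +
    \esum_(e in B) ((s^-1 / 2)%:E * (nm (Q e) ^+ 2)%:E))); last first.
  by rewrite leeD// esumZ_le// divr_ge0// ltW.
rewrite -esumD; last 2 first.
- by move=> e _; rewrite -EFinM lee_fin mulr_ge0 ?sqr_ge0// divr_ge0// ltW.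
- by move=> e _; rewrite -EFinM lee_fin mulr_ge0 ?sqr_ge0// divr_ge0// ltW.
apply: le_esum => e _; rewrite -!EFinM -EFinD lee_fin.
rewrite (le_trans (nm_dot _ _))//.
have := sqr_ge0 (s * nm (P e) - nm (Q e)).
move: (nm (P e)) (nm (Q e)) => a b h.
have : (0 <= s^-1 * (s * a - b) ^+ 2)%R by rewrite mulr_ge0// ltW.
have -> : (s^-1 * (s * a - b) ^+ 2 =
  (s^-1 * s) * s * a ^+ 2 - (s^-1 * s) * (a * b) *+ 2 + s^-1 * b ^+ 2)%R by ring.
rewrite mulVf ?gt_eqF//; lra.
Qed.

(** |T|^(1/2): its squared Hilbert-Schmidt norm is the trace norm of T, which turns trace-class
    estimates into Hilbert-Schmidt ones. *)
Definition sqrt_abs H K (T : bop H K) : bop H H := sqrt_op (abs_op T).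

Lemma sqrt_absP H K (T : bop H K) :
  adjoint (sqrt_abs T) = sqrt_abs T /\ sqrt_abs T \c sqrt_abs T = abs_op T.
Proof. by have [/nonneg_sym] := sqrt_opP (abs_opP T).1. Qed.

Lemma trace_normE H K (T : bop H K) : trace_norm T = hsn (sqrt_abs T).
Proof.
have [sQ QQ] := sqrt_absP T; rewrite /trace_norm /trace /hsn /hs.
apply: eq_esum => e _; rewrite -QQ bopE.
by rewrite -{1}sQ adjPr dotxx.
Qed.

(** |T| = V^* T, so its diagonal entries <V e, T e> are nonnegative. For fixed V the sum bounds
    expressions linear in T, which gives the triangle and ideal inequalities. *)
Lemma trace_norm_polar H K (T : bop H K) : exists2 V : bop H K, (bn V <= 1)%R &
  trace_norm T = \esum_(e in onb H) (nm (dot (V e) (T e)))%:E.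
Proof.
have [V [V1 _ VT]] := polar T; exists V => //; apply: eq_esum => e _.
congr (_%:E); rewrite -adjPr -(bop_compE (adjoint V)) VT.
have [-> h] := nonneg_real e (abs_opP T).1.
by rewrite nm_real ger0_norm.
Qed.

Lemma trace_norm_ge0 H K (T : bop H K) : 0 <= trace_norm T.
Proof. by rewrite trace_normE; apply: esum_ge0 => e _. Qed.

(** With T = U Q Q and Q = |T|^(1/2), the term <V e, X T Y e> equals <Q W e, Q Y e> for W = U^* X^*
    V. *)
Lemma trace_norm_dot H' H K K' (B : set H') (V : bop H' K') (X : bop K K')
    (T : bop H K) (Y : bop H' H) (x y t : R) : orthonormal_basis B ->
  (bn V <= 1)%R -> (0 < x)%R -> (0 < y)%R -> (bn X <= x)%R -> (bn Y <= y)%R ->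
  trace_norm T <= t%:E ->
  \esum_(e in B) (nm (dot (V e) (X (T (Y e)))))%:E <= (x * y * t)%:E.
Proof.
move=> hB V1 x0 y0 Xx Yy; rewrite trace_normE => Tt.
have [U [U1 UT _]] := polar T; have [sQ QQ] := sqrt_absP T.
set Q := sqrt_abs T in Tt sQ QQ.
pose W := adjoint U \c (adjoint X \c V).
have Wx : (bn W <= x)%R.
  rewrite (le_trans (bn_comp _ _))// bn_adj -[leRHS]mul1r ler_pM ?bn_ge0//.
  by rewrite (le_trans (bn_comp _ _))// bn_adj -[leRHS]mulr1 ler_pM ?bn_ge0.
have h1 : hsn (Q \c W) <= (x ^+ 2 * t)%:E by exact: hsn_compr.
have h2 : hsn (Q \c Y) <= (y ^+ 2 * t)%:E by exact: hsn_compr.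
(* This weight turns the bounds x^2 t and y^2 t into x y t. *)
have s0 : (0 < y / x)%R by rewrite divr_gt0.
have := esum_dot_le hB s0 h1 h2.
have -> : ((y / x * (x ^+ 2 * t) + (y / x)^-1 * (y ^+ 2 * t)) / 2 = x * y * t)%R.
  by rewrite invf_div; field; rewrite !gt_eqF.
apply: le_trans; apply: le_esum => e _; rewrite lee_fin.
by rewrite !bopE -{1}sQ adjP -(bop_compE Q) QQ adjP adjP -(bop_compE U) UT.
Qed.

Lemma trace_norm_fin H K (T : bop H K) : trace_norm T < +oo ->
  exists t : R, [/\ trace_norm T = t%:E & (0 <= t)%R].
Proof.
move=> h; have T0 := trace_norm_ge0 T.
have /fineK E : trace_norm T \is a fin_num by rewrite ge0_fin_numE.
by exists (fine (trace_norm T)); rewrite E fine_ge0.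
Qed.

(** The contraction V belonging to S + T is kept for each summand, where it can only give a smaller
    sum than the trace norm. *)
Lemma trace_normD H K (S T : bop H K) :
  trace_norm (S + T)%R <= trace_norm S + trace_norm T.
Proof.
have [/trace_norm_fin[s [Es s0]]|] := ltP (trace_norm S) +oo; last first.
  by rewrite leye_eq => /eqP ->; rewrite addye ?leey// gt_eqF// (lt_le_trans _ (trace_norm_ge0 _)).
have [/trace_norm_fin[t [Et t0]]|] := ltP (trace_norm T) +oo; last first.
  by rewrite leye_eq => /eqP ->; rewrite addey ?leey// Es.
have [V V1 ->] := trace_norm_polar (S + T)%R.
have key (A : bop H K) (a : R) : trace_norm A = a%:E ->
    \esum_(e in onb H) (nm (dot (V e) (A e)))%:E <= a%:E.
  move=> Ea; have : trace_norm A <= a%:E by rewrite Ea.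
  move=> /(trace_norm_dot (onbP H) V1 ltr01 ltr01 (bn_id K) (bn_id H)).
  by rewrite !mul1r.
rewrite Es Et (le_trans _ (leeD (key _ _ Es) (key _ _ Et)))//.
rewrite -esumD; [|by move=> *; rewrite lee_fin nm_ge0..].
by apply: le_esum => e _; rewrite lee_fin bopE dotDr nmD.
Qed.

Lemma trace_norm_comp H' H K K' (X : bop K K') (T : bop H K) (Y : bop H' H)
    (x y t : R) : (0 < x)%R -> (0 < y)%R -> (bn X <= x)%R -> (bn Y <= y)%R ->
  trace_norm T <= t%:E -> trace_norm (X \c T \c Y) <= (x * y * t)%:E.
Proof.
move=> x0 y0 Xx Yy Tt; have [V V1 ->] := trace_norm_polar (X \c T \c Y).
exact: (trace_norm_dot (onbP _) V1 x0 y0 Xx Yy Tt).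
Qed.

Lemma bn_trace_norm H K (T : bop H K) (t : R) :
  trace_norm T <= t%:E -> (bn T <= t)%R.
Proof.
rewrite trace_normE => /hsn_bn h; have [U [U1 UT _]] := polar T.
rewrite -UT -(sqrt_absP T).2 (le_trans (bn_comp _ _))//.
rewrite (le_trans _ h)// -[leRHS]mul1r ler_pM ?bn_ge0//.
by rewrite expr2 bn_comp.
Qed.

(** <V e, A X A^* e> = <A^* V e, X A^* e> pairs two Hilbert-Schmidt operators. It lifts
    operator-norm estimates of X to trace-norm estimates. *)
Lemma trace_norm_sandwich H K (A : bop H K) (X : bop H H) (x a : R) :
  (0 < x)%R -> (bn X <= x)%R -> hsn A <= a%:E ->
  trace_norm (A \c X \c adjoint A) <= (x * a)%:E.
Proof.
move=> x0 Xx Aa; have [V V1 ->] := trace_norm_polar (A \c X \c adjoint A).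
have h1 : hsn (adjoint A \c V) <= (1 ^+ 2 * a)%:E.
  by apply: hsn_compr => //; rewrite hsn_adj.
have h2 : hsn (X \c adjoint A) <= (x ^+ 2 * a)%:E.
  by apply: hsn_compl => //; rewrite hsn_adj.
have := esum_dot_le (onbP K) x0 h1 h2.
have -> : ((x * (1 ^+ 2 * a) + x^-1 * (x ^+ 2 * a)) / 2 = x * a)%R.
  by field; rewrite gt_eqF.
apply: le_trans; apply: le_esum => e _; rewrite lee_fin.
by rewrite !bopE adjP.
Qed.

(** The identity serves as the contraction in [trace_norm_dot]. *)
Lemma nonneg_trace H (A : bop H H) : nonneg_op A -> trace A <= trace_norm A.
Proof.
move=> A0; have [/trace_norm_fin[t [Et t0]]|] := ltP (trace_norm A) +oo; last first.
  by rewrite leye_eq => /eqP ->; rewrite leey.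
have : trace_norm A <= t%:E by rewrite Et.
move=> /(trace_norm_dot (onbP H) (bn_id H) ltr01 ltr01 (bn_id H) (bn_id H)).
rewrite !mul1r Et; apply: le_trans; apply: le_esum => e _.
by rewrite lee_fin !bopE (le_trans (ler_norm _))// Re_le_nm.
Qed.

End TraceNorm.

(** * Analytic functions *)

Section Ecvg.
Context {R : realType}.

Lemma ecvg0P (T : Type) (F : set_system T) (u : T -> \bar R) : Filter F ->
  (forall x, (0 <= u x)%E) ->
  (u x @[x --> F] --> 0%E) <->
  (forall e : R, 0 < e -> \forall x \near F, (u x <= e%:E)%E).
Proof.
move=> FF u0; split=> [/fine_cvgP[uf ul] e e0|h].
  have /cvgrPdist_lt/(_ _ e0) ul' := ul.
  apply: filterS2 uf ul' => x xf; rewrite sub0r normrN /= => xe.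
  by rewrite -(fineK xf) lee_fin ltW// (le_lt_trans (ler_norm _)).
apply/fine_cvgP; split.
  apply: filterS (h _ ltr01) => x x1; rewrite ge0_fin_numE//.
  by rewrite (le_lt_trans x1)// ltry.
apply/cvgrPdist_lt => e e0; have e2 : 0 < e / 2 by rewrite divr_gt0.
apply: filterS (h _ e2) => x xe; rewrite sub0r normrN /=.
have xf : u x \is a fin_num by rewrite ge0_fin_numE// (le_lt_trans xe)// ltry.
rewrite ger0_norm ?fine_ge0//.
move: xe; rewrite -(fineK xf) lee_fin => /le_lt_trans; apply => /=.
by rewrite ltr_pdivrMr// ltr_pMr// ltr1n.
Qed.

Lemma opnorm_ge0 (H K : hilbertType R) (A : bop H K) : (0 <= opnorm A)%E.
Proof. by rewrite opnormE lee_fin bn_ge0. Qed.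

End Ecvg.

Section Analytic.
Context {R : realType}.

Definition is_seminorm (V : lmodType R[i]) (nr : V -> R) : Prop :=
  [/\ forall x, 0 <= nr x, forall x y, nr (x + y) <= nr x + nr y &
      forall a x, nr (a *: x) = nm a * nr x].

Lemma bn_seminorm (H K : hilbertType R) : is_seminorm (@bn R H K).
Proof. by split=> *; rewrite ?bn_ge0 ?bnD ?bnZ. Qed.

Lemma nm_seminorm : is_seminorm (V := R[i]^o) (@nm R R[i]).
Proof. by split=> *; [exact: nm_ge0|exact: nmD|exact: nmM]. Qed.

(* [fs n] is the n-th Taylor remainder divided by (z - z0) ^ n; the bounds    *)
(* make the Taylor series converge for |z - z0| < 1 / M.                      *)
Definition expansion (V : lmodType R[i]) (nr : V -> R) (f : R[i] -> V) z0
    (a : nat -> V) (fs : nat -> R[i] -> V) (rho C M : R) : Prop :=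
  [/\ 0 < rho, 0 <= C, 1 <= M & forall z, nm (z - z0) < rho -> f z = fs 0%N z /\
    forall n, fs n z = a n + (z - z0) *: fs n.+1 z /\ nr (fs n z) <= C * M ^+ n].

(** Remainders, unlike limits of series, satisfy exact algebraic recursions, so sums, products and
    inverses need only geometric bounds. *)
Definition holo (V : lmodType R[i]) (nr : V -> R) (f : R[i] -> V) z0 : Prop :=
  exists a fs rho C M, expansion nr f z0 a fs rho C M.

Lemma expansion_weaken V nr f z0 a fs rho C M rho' C' M' :
  @expansion V nr f z0 a fs rho C M -> 0 < rho' -> rho' <= rho -> C <= C' ->
  M <= M' -> expansion nr f z0 a fs rho' C' M'.
Proof.
move=> [r0 C0 M1 h] r'0 rr CC MM; split=> //.
- exact: le_trans CC.
- exact: le_trans MM.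
move=> z /lt_le_trans/(_ rr)/h[-> hz]; split=> // n; have [-> hn] := hz n.
split=> //; rewrite -(hz n).1 (le_trans (hz n).2)//.
have M0 : 0 <= M by rewrite (le_trans ler01).
by rewrite ler_pM ?exprn_ge0// lerXn2r ?nnegrE// (le_trans M0).
Qed.

Lemma expansion_coef V nr f z0 a fs rho C M : @expansion V nr f z0 a fs rho C M ->
  (forall n, a n = fs n z0 /\ nr (a n) <= C * M ^+ n) /\ f z0 = a 0%N.
Proof.
move=> [r0 _ _ h]; have zz : nm (z0 - z0) < rho by rewrite subrr nm0.
have [f0 hz] := h _ zz.
have E n : a n = fs n z0 by rewrite (hz n).1 subrr scale0r addr0.
by split=> [n|]; [split; rewrite E// (hz n).2|rewrite f0 E].
Qed.

Section Basic.
Variables (V : lmodType R[i]) (nr : V -> R).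
Hypothesis nrP : is_seminorm nr.

Lemma seminorm0 : nr 0 = 0.
Proof. by have [_ _ h] := nrP; rewrite -(scale0r 0) h nm0 mul0r. Qed.

Lemma seminormN x : nr (- x) = nr x.
Proof. by have [_ _ h] := nrP; rewrite -scaleN1r h nmN nm1 mul1r. Qed.

Lemma seminormB x y : nr (x - y) <= nr x + nr y.
Proof. by have [_ h _] := nrP; rewrite -(seminormN y) h. Qed.

Lemma seminorm_sum I (r : seq I) (P : pred I) (F : I -> V) :
  nr (\sum_(i <- r | P i) F i) <= \sum_(i <- r | P i) nr (F i).
Proof.
have [_ hD _] := nrP.
elim/big_rec2 : _ => [|i b a _ h]; first by rewrite seminorm0.
by rewrite (le_trans (hD _ _))// lerD2l.
Qed.

Lemma holo_cst v z0 : holo nr (fun=> v) z0.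
Proof.
exists (fun n => if n is 0%N then v else 0), (fun n z => if n is 0%N then v else 0).
exists 1, (nr v), 1; have [h0 _ _] := nrP; split=> // z _; split=> // -[|n].
  by rewrite scaler0 addr0 expr0 mulr1.
by rewrite scaler0 addr0 seminorm0 expr1n mulr1.
Qed.

Lemma holoD f g z0 : holo nr f z0 -> holo nr g z0 -> holo nr (fun z => f z + g z) z0.
Proof.
move=> [a [fs [r [C [M hf]]]]] [b [gs [r' [C' [M' hg]]]]].
have [r0 C0 M1 _] := hf; have [r'0 C'0 M'1 _] := hg; have [_ hD _] := nrP.
have m0 : 0 < Num.min r r' by rewrite lt_min r0.
have {hf}[_ _ _ hf] := @expansion_weaken _ _ _ _ _ _ _ _ _ (Num.min r r') C (Num.max M M')
  hf m0 ltac:(by rewrite ge_min lexx) ltac:(by []) ltac:(by rewrite le_max lexx).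
have {hg}[_ _ _ hg] := @expansion_weaken _ _ _ _ _ _ _ _ _ (Num.min r r') C' (Num.max M M')
  hg m0 ltac:(by rewrite ge_min lexx orbT) ltac:(by []) ltac:(by rewrite le_max lexx orbT).
exists (fun n => a n + b n), (fun n z => fs n z + gs n z).
exists (Num.min r r'), (C + C'), (Num.max M M'); split=> //.
- by rewrite addr_ge0.
- by rewrite le_max M1.
move=> z zr; have [-> hf'] := hf z zr; have [-> hg'] := hg z zr.
split=> // n; have [-> fn] := hf' n; have [-> gn] := hg' n; split.
  by rewrite scalerDr addrACA.
by rewrite -(hf' n).1 -(hg' n).1 (le_trans (hD _ _))// mulrDl lerD// ?(hf' n).2 ?(hg' n).2.
Qed.

Lemma holo_sum I (r : seq I) (P : pred I) (f : I -> R[i] -> V) z0 :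
  (forall i, holo nr (f i) z0) -> holo nr (fun z => \sum_(i <- r | P i) f i z) z0.
Proof.
move=> h; elim: r => [|i r IH].
  have -> : (fun z => \sum_(i <- [::] | P i) f i z) = (fun=> 0).
    by apply/funext => z; rewrite big_nil.
  exact: holo_cst.
have -> : (fun z => \sum_(j <- i :: r | P j) f j z) =
    (fun z => (if P i then f i z else 0) + \sum_(j <- r | P j) f j z).
  by apply/funext => z; rewrite big_cons; case: ifP; rewrite ?add0r.
by apply: holoD => //; case: (P i) => //; exact: holo_cst.
Qed.

End Basic.

Lemma holo_lin (U V : lmodType R[i]) (nu : U -> R) (nv : V -> R) (l : U -> V) c f z0 :
  linear l -> 0 <= c -> (forall x, nv (l x) <= c * nu x) ->
  holo nu f z0 -> holo nv (fun z => l (f z)) z0.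
Proof.
move=> ll c0 lc [a [fs [r [C [M [r0 C0 M1 h]]]]]].
exists (fun n => l (a n)), (fun n z => l (fs n z)), r, (c * C), M; split=> //.
  exact: mulr_ge0.
move=> z /h[-> hz]; split=> // n; split.
  by rewrite (hz n).1 addrC ll addrC.
by rewrite (le_trans (lc _))// -mulrA ler_wpM2l// (hz n).2.
Qed.

Section Product.
Variables (U V W : lmodType R[i]) (nu : U -> R) (nv : V -> R) (nw : W -> R).
Hypothesis nuP : is_seminorm nu.
Hypothesis nvP : is_seminorm nv.
Hypothesis nwP : is_seminorm nw.
Variable mul : U -> V -> W.
Hypothesis mulDl : forall x y v, mul (x + y) v = mul x v + mul y v.
Hypothesis mulDr : forall u x y, mul u (x + y) = mul u x + mul u y.
Hypothesis mulZl : forall a x v, mul (a *: x) v = a *: mul x v.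
Hypothesis mulZr : forall a u y, mul u (a *: y) = a *: mul u y.
Hypothesis mul_le : forall x y, nw (mul x y) <= nu x * nv y.

(** The coefficients are the Cauchy product. The remainder is f_n g plus the sum over k < n of a_k
    g_(n-k), f_n and g_n denoting the remainders of f and g. *)
Lemma holo_mul f g z0 : holo nu f z0 -> holo nv g z0 ->
  holo nw (fun z => mul (f z) (g z)) z0.
Proof.
move=> [a [fs [r [C [M hf]]]]] [b [gs [r' [C' [M' hg]]]]].
have [nu0 _ _] := nuP; have [nv0 _ _] := nvP; have [nw0 nwD _] := nwP.
have [r0 C0 M1 _] := hf; have [r'0 C'0 M'1 _] := hg.
pose rr := Num.min r r'; pose MM := Num.max M M'.
have m0 : 0 < rr by rewrite lt_min r0.
have {}hf : expansion nu f z0 a fs rr C MM.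
  by apply: expansion_weaken hf _ _ _ _; rewrite ?ge_min ?le_max ?lexx.
have {}hg : expansion nv g z0 b gs rr C' MM.
  by apply: expansion_weaken hg _ _ _ _; rewrite ?ge_min ?le_max ?lexx ?orbT.
have [ha _] := expansion_coef hf; have [hb _] := expansion_coef hg.
have [_ _ MM1 {}hf] := hf; have [_ _ _ {}hg] := hg.
have MM0 : 0 <= MM by rewrite (le_trans ler01).
exists (fun n => mul (a n) (b 0%N) + \sum_(k < n) mul (a k) (b (n - k)%N)).
exists (fun n z => mul (fs n z) (g z) + \sum_(k < n) mul (a k) (gs (n - k)%N z)).
exists rr, (C * C'), (2 * MM); split=> //.
- exact: mulr_ge0.
- by rewrite -[1]mulr1 ler_pM//; lra.
move=> z zr; have [fz hfz] := hf z zr; have [gz hgz] := hg z zr.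
split=> [|n]; first by rewrite big_ord0 addr0 fz.
have mulBl x y v : mul (x - y) v = mul x v - mul y v.
  by rewrite -scaleN1r mulDl mulZl scaleN1r.
have mulBr u x y : mul u (x - y) = mul u x - mul u y.
  by rewrite -scaleN1r mulDr mulZr scaleN1r.
have wf k : (z - z0) *: fs k.+1 z = fs k z - a k by rewrite (hfz k).1 addrAC subrr add0r.
have wg k : (z - z0) *: gs k.+1 z = gs k z - b k by rewrite (hgz k).1 addrAC subrr add0r.
split.
  rewrite scalerDr -mulZl wf mulBl scaler_sumr.
  have -> : \sum_(k < n.+1) (z - z0) *: mul (a k) (gs (n.+1 - k)%N z) =
      \sum_(k < n.+1) (mul (a k) (gs (n - k)%N z) - mul (a k) (b (n - k)%N)).
    apply: eq_bigr => k _; rewrite -mulZr subSn ?wg ?mulBr//.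
    by rewrite -ltnS.
  rewrite sumrB !big_ord_recr /= subnn -gz.
  set S := \sum_(i < n) _; set T := \sum_(i < n) _.
  rewrite [S + _]addrC -[_ + S - _]addrA subrKA [mul _ _ + (S - _)]addrA.
  by rewrite [T + _]addrC [RHS]addrC subrK.
(* There are n + 1 terms, and n + 1 <= 2^n is absorbed by the rate 2 [MM]. *)
apply: le_trans (nwD _ _) _; apply: (@le_trans _ _ (n.+1%:R * (C * C' * MM ^+ n))).
  rewrite -natr1 mulrDl mul1r addrC lerD//.
    rewrite (le_trans (seminorm_sum nwP _ _ _))//.
    apply: le_trans (_ : \sum_(k < n) (C * C' * MM ^+ n) <= _); last first.
      by rewrite sumr_const card_ord mulr_natl.
    apply: ler_sum => k _; rewrite (le_trans (mul_le _ _))//.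
    have -> : MM ^+ n = MM ^+ k * MM ^+ (n - k) by rewrite -exprD subnKC// ltnW.
    by rewrite mulrACA ler_pM ?(ha k).2 ?(hgz _).2.
  rewrite (le_trans (mul_le _ _))// mulrAC ler_pM ?(hfz _).2//.
  by have := (hgz 0%N).2; rewrite -gz expr0 mulr1.
rewrite exprMn [leRHS]mulrCA ler_wpM2r ?mulr_ge0 ?exprn_ge0//.
by rewrite -natrX ler_nat ltn_expl.
Qed.

End Product.

End Analytic.

(** * Inverses and their stability *)

Section Invertible.
Context {R : realType}.
Implicit Types H K : hilbertType R.

Definition inv_op H (A : bop H H) : bop H H :=
  xget 0 [set B | A \c B = bop_id H /\ B \c A = bop_id H].

Lemma inv_opP H (A : bop H H) : invertible_op A ->
  A \c inv_op A = bop_id H /\ inv_op A \c A = bop_id H.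
Proof. by move=> h; exact: (xgetPex _ h). Qed.

Lemma inv_op_eq H (A B : bop H H) : A \c B = bop_id H -> B \c A = bop_id H ->
  inv_op A = B.
Proof.
move=> AB BA; have [h _] : A \c inv_op A = bop_id H /\ inv_op A \c A = bop_id H.
  by apply: inv_opP; exists B.
by rewrite -[inv_op A]comp1l -BA -compA h comp1r.
Qed.

(** The bound for the adjoint makes the range dense; the bound for [A] lets the inverse on the range
    extend by continuity. *)
Lemma bounded_below_invertible H (A : bop H H) (c : R) : 0 < c ->
  (forall u, c * nm u <= nm (A u)) -> (forall u, c * nm u <= nm (adjoint A u)) ->
  invertible_op A.
Proof.
move=> c0 Ac Ac'.
have rd : closure [set x | exists y, A y = x] = setT.
  apply: dense_of_orth.
    split; first by exists 0; rewrite bop0.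
    by move=> a _ _ [x <-] [y <-]; exists (a *: x + y); rewrite bop_linear.
  move=> v hv; apply: nm_eq0; apply: le_anti; rewrite nm_ge0 andbT.
  rewrite -(ler_pM2l c0) mulr0 (le_trans (Ac' v))//.
  rewrite (_ : adjoint A v = 0) ?nm0//; apply: dot_eq0P => y.
  by rewrite adjPr hv//; exists y.
have [B [_ HB]] : exists B : bop H H, bn B <= c^-1 /\ forall x y, A y = x -> B x = y.
  apply: bop_extend rd; first by rewrite invr_ge0 ltW.
    by move=> a x y x' y' <- <-; rewrite bop_linear.
  by move=> x y <-; rewrite mulrC ler_pdivlMr// mulrC.
have BA : B \c A = bop_id H by apply: bopP => x; exact: HB.
exists B; split=> //; apply: (bop_dense_eq rd) => _ [y <-].
by rewrite bopE -(bop_compE B) BA.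
Qed.

(** Used in place of a Neumann series: |u| <= b |A u| <= b |(A + E) u| + |u| / 2, and likewise for
    the adjoints, so [A + E] is bounded below with constant 1 / (2 b). *)
Lemma invertible_perturb H (A E : bop H H) (b : R) : invertible_op A ->
  0 < b -> bn (inv_op A) <= b -> bn E * b <= 2^-1 ->
  invertible_op (A + E) /\ bn (inv_op (A + E)) <= 2 * b.
Proof.
move=> iA b0 Ab Eb; have [AB BA] := inv_opP iA.
have key (A' B' E' : bop H H) : B' \c A' = bop_id H -> bn B' <= b -> bn E' = bn E ->
    forall u, nm u <= 2 * b * nm ((A' + E') u).
  move=> BA' B'b EE' u.
  have h1 : nm u <= b * nm (A' u).
    by rewrite -{1}[u]bop_idE -BA' bopE; exact: bn_ub.
  have h2 : nm (A' u) <= nm ((A' + E') u) + nm (E' u).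
    by rewrite -{1}(addrK (E' u) (A' u)) nmB.
  have h3 : nm (E' u) <= bn E * nm u by rewrite -EE' bn_le.
  have h4 : b * nm (A' u) <= b * nm ((A' + E') u) + b * (bn E * nm u).
    by rewrite -mulrDr ler_pM2l// (le_trans h2)// lerD2l.
  have h5 : b * (bn E * nm u) <= 2^-1 * nm u.
    by rewrite mulrA ler_wpM2r ?nm_ge0// mulrC.
  lra.
have k1 := key A (inv_op A) E BA Ab erefl.
have iAE : invertible_op (A + E).
  apply: (@bounded_below_invertible _ _ (2 * b)^-1) => [|u|u].
  - by rewrite invr_gt0 mulr_gt0.
  - by rewrite mulrC ler_pdivrMr ?mulr_gt0// mulrC k1.
  - rewrite mulrC ler_pdivrMr ?mulr_gt0// mulrC adjD.
    apply: (key _ (adjoint (inv_op A))); rewrite ?bn_adj//.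
    by rewrite -adj_comp AB adj_id.
split=> //; apply: bn_lub => [|x]; first by rewrite mulr_ge0// ltW.
by rewrite (le_trans (k1 _))// -(bop_compE (A + E)) (inv_opP iAE).1.
Qed.

End Invertible.

(** * Holomorphy of products and inverses *)

Section HoloInverse.
Context {R : realType}.

(** Course-of-values recursion, for the coefficients of an inverse, each determined by all earlier
    ones. [G n] tabulates the first n values. *)
Lemma strong_rec (T : Type) (x0 : T) (F : nat -> (nat -> T) -> T) :
  (forall n g h, (forall k, (k < n)%N -> g k = h k) -> F n g = F n h) ->
  exists c, forall n, c n = F n c.
Proof.
move=> Fext; pose G := fix G n := if n is m.+1 then
  (fun k => if k == m then F m (G m) else G m k) else fun=> x0.
have GS n k : (k < n)%N -> G n k = G k.+1 k.
  elim: n => // n IH; rewrite ltnS leq_eqVlt => /predU1P[->//|kn] /=.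
  by rewrite ltn_eqF// IH//= eqxx.
exists (fun n => G n.+1 n) => n; rewrite [LHS]/= eqxx; apply: Fext => k kn.
by rewrite GS.
Qed.

(** With s = C c the left side is M^n ((1 + s)^n - 1). The rate M (1 + s) is thus large enough to
    reproduce itself in the recursion for an inverse. *)
Lemma geometric_conv (C M c : R) n : 0 <= C -> 0 <= M -> 0 <= c ->
  C * c * (\sum_(k < n) (M * (1 + C * c)) ^+ k * M ^+ (n - k)) <=
  (M * (1 + C * c)) ^+ n.
Proof.
move=> C0 M0 c0; have s0 : 0 <= C * c by rewrite mulr_ge0.
set s := C * c in s0 *.
elim: n => [|n IH]; first by rewrite big_ord0 mulr0 expr0 ler01.
rewrite big_ord_recr /= subSnn expr1.
have -> : \sum_(k < n) (M * (1 + s)) ^+ k * M ^+ (n.+1 - k) =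
   M * \sum_(k < n) (M * (1 + s)) ^+ k * M ^+ (n - k).
  rewrite mulr_sumr; apply: eq_bigr => k _; rewrite subSn; last exact: ltnW.
  by rewrite exprS mulrCA.
rewrite exprSr; move: IH; set S := \sum_(k < n) _; set P := _ ^+ n => IH.
have := ler_wpM2l M0 IH; nra.
Qed.

Variable (H : hilbertType R).

Lemma holo_comp (f g : R[i] -> bop H H) z0 :
  holo (@bn R H H) f z0 -> holo (@bn R H H) g z0 ->
  holo (@bn R H H) (fun z => f z \c g z) z0.
Proof.
apply: (@holo_mul _ _ _ _ _ _ _ (bn_seminorm _ _) (bn_seminorm _ _)
  (bn_seminorm _ _) (fun A B : bop H H => A \c B)).
- by move=> *; rewrite compDl.
- by move=> *; rewrite compDr.
- by move=> *; rewrite compZl.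
- by move=> *; rewrite compZr.
- by move=> *; exact: bn_comp.
Qed.

Lemma holo_scale (f : R[i] -> R[i]^o) (g : R[i] -> bop H H) z0 :
  holo (@nm R R[i]) f z0 -> holo (@bn R H H) g z0 ->
  holo (@bn R H H) (fun z => (f z : R[i]) *: g z) z0.
Proof.
apply: (@holo_mul _ _ _ _ _ _ _ nm_seminorm (bn_seminorm _ _) (bn_seminorm _ _)
  (fun (a : R[i]^o) (B : bop H H) => (a : R[i]) *: B)).
- by move=> *; rewrite scalerDl.
- by move=> *; rewrite scalerDr.
- by move=> *; rewrite -scalerA.
- by move=> *; rewrite !scalerA mulrC.
- by move=> *; rewrite bnZ.
Qed.

Lemma holo_scalar_mul (f g : R[i] -> R[i]^o) z0 :
  holo (@nm R R[i]) f z0 -> holo (@nm R R[i]) g z0 ->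
  holo (V := R[i]^o) (@nm R R[i]) (fun z => (f z : R[i]) * (g z : R[i])) z0.
Proof.
apply: (@holo_mul _ _ _ _ _ _ _ nm_seminorm nm_seminorm nm_seminorm
  (fun (a b : R[i]^o) => (a : R[i]) * (b : R[i]) : R[i]^o)).
- by move=> *; rewrite mulrDl.
- by move=> *; rewrite mulrDr.
- by move=> *; rewrite -mulrA.
- by move=> a u y; rewrite /GRing.scale /= mulrCA.
- by move=> *; rewrite nmM.
Qed.

Lemma holo_near (V : lmodType R[i]) (nr : V -> R) f z0 : is_seminorm nr ->
  holo nr f z0 -> forall e : R, 0 < e ->
  exists2 rho : R, 0 < rho & forall z, nm (z - z0) < rho -> nr (f z - f z0) <= e.
Proof.
move=> [_ _ nrZ] [a [fs [r [C [M hf]]]]] e e0.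
have [r0 C0 M1 h] := hf; have [ha f0] := expansion_coef hf.
have CM : 0 < C * M + 1 by rewrite ltr_wpDl// mulr_ge0// (le_trans ler01).
exists (Num.min r (e / (C * M + 1))); first by rewrite lt_min r0 divr_gt0.
move=> z; rewrite lt_min => /andP[zr ze]; have [-> hz] := h z zr.
rewrite f0 (hz 0%N).1 addrAC subrr add0r nrZ.
have := (hz 1%N).2; rewrite expr1 => h1.
apply: (@le_trans _ _ (nm (z - z0) * (C * M + 1))).
  by rewrite ler_wpM2l ?nm_ge0// (le_trans h1)// lerDl.
by rewrite -ler_pdivlMr// ltW.
Qed.

Lemma holo_invertible_near (f : R[i] -> bop H H) z0 :
  holo (@bn R H H) f z0 -> invertible_op (f z0) ->
  exists rho b : R, [/\ 0 < rho, 0 < b & forall z, nm (z - z0) < rho ->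
    invertible_op (f z) /\ bn (inv_op (f z)) <= b].
Proof.
move=> hf iA; pose b := bn (inv_op (f z0)) + 1.
have b0 : 0 < b by rewrite ltr_wpDl ?bn_ge0.
have e0 : 0 < 2^-1 / b by rewrite divr_gt0// invr_gt0.
have [rho r0 hr] := holo_near (bn_seminorm _ _) hf e0.
exists rho, (2 * b); split=> //; first by rewrite mulr_gt0.
move=> z /hr; rewrite ler_pdivlMr// => h.
rewrite -(subrK (f z0) (f z)) [f z - f z0 + _]addrC.
by apply: invertible_perturb => //; rewrite lerDl.
Qed.

(** Comparing coefficients in f^-1 f = 1 gives c_n = - (sum over k < n of c_k a_(n-k)) c_0. The same
    formula with the remainders of f for the a's and f^-1 for the last factor gives the remainders
    of f^-1. *)
Lemma holo_inv (f : R[i] -> bop H H) z0 :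
  holo (@bn R H H) f z0 -> invertible_op (f z0) ->
  holo (@bn R H H) (fun z => inv_op (f z)) z0.
Proof.
move=> hf0 iA; have [r' [D [r'0 D0 hD]]] := holo_invertible_near hf0 iA.
have [a [fs [r [C [M hf]]]]] := hf0.
have m0 : 0 < Num.min r r' by case: hf => ? _ _ _; rewrite lt_min r'0 andbT.
have {}hf : expansion (@bn R H H) f z0 a fs (Num.min r r') C M.
  by apply: expansion_weaken hf _ _ _ _; rewrite ?ge_min ?lexx.
have [ha f0] := expansion_coef hf; have [_ C0 M1 h] := hf.
set c0 := inv_op (f z0).
have [ac ca] : a 0%N \c c0 = bop_id H /\ c0 \c a 0%N = bop_id H.
  by rewrite -f0; exact: inv_opP.
have [c cE] := @strong_rec (bop H H) 0
  (fun n c => if n is 0%N then c0 else - (\sum_(k < n) c k \c a (n - k)%N) \c c0)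
  (ltac:(by case=> // n g h' gh; congr (- _ \c _); apply: eq_bigr => k _; rewrite gh)).
have M0 : 0 <= M by rewrite (le_trans ler01).
have s0 : 0 <= C * bn c0 by rewrite mulr_ge0 ?bn_ge0.
pose M' := M * (1 + C * bn c0).
have M'1 : 1 <= M' by rewrite -[1]mulr1 ler_pM// lerDl.
have M'0 : 0 <= M' by rewrite (le_trans ler01).
have cb n : bn (c n) <= bn c0 * M' ^+ n.
  elim/ltn_ind: n => -[|n] IH; rewrite cE; first by rewrite expr0 mulr1.
  rewrite (le_trans (bn_comp _ _))// bnN.
  apply: le_trans (_ : bn c0 * (C * bn c0 *
     \sum_(k < n.+1) M' ^+ k * M ^+ (n.+1 - k)) <= _); last first.
    by rewrite ler_wpM2l ?bn_ge0// geometric_conv ?bn_ge0.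
  rewrite mulrC ler_wpM2l ?bn_ge0// (le_trans (bn_sum _ _ _))// mulr_sumr.
  apply: ler_sum => k _; rewrite (le_trans (bn_comp _ _))//.
  have -> : C * bn c0 * (M' ^+ k * M ^+ (n.+1 - k)) =
    (bn c0 * M' ^+ k) * (C * M ^+ (n.+1 - k)) by ring.
  by rewrite ler_pM ?bn_ge0 ?IH ?(ha _).2.
exists c, (fun n z => if n is 0%N then inv_op (f z) else
  - (\sum_(k < n) c k \c fs (n - k)%N z) \c inv_op (f z)), (Num.min r r').
exists D, M'; split=> //; first exact: ltW.
move=> z zr; have [fz hz] := h z zr.
have [|iz bz] := hD z; first by rewrite (lt_le_trans zr)// ge_min lexx orbT.
have [fi _] := inv_opP iz; set hh := inv_op (f z) in fi bz *.
have wf k : (z - z0) *: fs k.+1 z = fs k z - a k.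
  by rewrite (hz k).1 addrAC subrr add0r.
split=> // n; split; last first.
  case: n => [|n]; first by rewrite expr0 mulr1.
  rewrite (le_trans (bn_comp _ _))// bnN mulrC ler_pM ?bn_ge0//.
  apply: le_trans (_ : C * bn c0 *
     \sum_(k < n.+1) M' ^+ k * M ^+ (n.+1 - k) <= _); last first.
    by rewrite geometric_conv ?bn_ge0.
  rewrite (le_trans (bn_sum _ _ _))// mulr_sumr.
  apply: ler_sum => k _; rewrite (le_trans (bn_comp _ _))//.
  have -> : C * bn c0 * (M' ^+ k * M ^+ (n.+1 - k)) =
    (bn c0 * M' ^+ k) * (C * M ^+ (n.+1 - k)) by ring.
  by rewrite ler_pM ?bn_ge0 ?cb ?(hz _).2.
have step : (z - z0) *: (- (\sum_(k < n.+1) c k \c fs (n.+1 - k)%N z) \c hh) =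
    - (\sum_(k < n) c k \c fs (n - k)%N z) \c hh - c n +
    ((\sum_(k < n) c k \c a (n - k)%N) + c n \c a 0%N) \c hh.
  rewrite -compZl scalerN scaler_sumr.
  have -> : \sum_(k < n.+1) (z - z0) *: (c k \c fs (n.+1 - k)%N z) =
    \sum_(k < n.+1) (c k \c fs (n - k)%N z - c k \c a (n - k)%N).
    apply: eq_bigr => k _; rewrite -compZr subSn ?wf ?compBr//.
    by rewrite -ltnS.
  rewrite sumrB !big_ord_recr /= subnn -fz opprB compBl [LHS]addrC compNl.
  rewrite [(_ + c n \c f z) \c hh]compDl -[c n \c f z \c hh]compA fi comp1r.
  by rewrite opprD.
(* n = 0 stands apart: the zeroth remainder is the inverse itself, not the empty sum. *)
case: n step => [|n]; rewrite ?big_ord0 ?oppr0 ?comp0l.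
  move=> ->; rewrite cE /= sub0r add0r ca comp1l addrA.
  by rewrite addrN add0r.
move=> ->; have -> : (\sum_(k < n.+1) c k \c a (n.+1 - k)%N) + c n.+1 \c a 0%N = 0.
  by rewrite (cE n.+1) -compA ca comp1r subrr.
by rewrite comp0l addr0 addrC subrK.
Qed.

End HoloInverse.

(** * The analytic Fredholm alternative *)

Section HoloScalar.
Context {R : realType}.
Implicit Types f : R[i] -> R[i]^o.
Local Notation holoC := (@holo R R[i]^o (@nm R R[i])).

(** If all coefficients vanish, f(z) is at most C 2^-n for every n once |z - z0| < 1 / (2 M).
    Otherwise p is the first index with a nonzero coefficient, and e is the p-th remainder. *)
Lemma holo_factor f z0 : holoC f z0 ->
  (exists2 rho : R, 0 < rho & forall z, nm (z - z0) < rho -> f z = 0) \/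
  (exists p e (rho : R), [/\ holoC e z0, e z0 != 0, 0 < rho &
     forall z, nm (z - z0) < rho -> f z = (z - z0) ^+ p * (e z : R[i])]).
Proof.
move=> [a [fs [r [C [M hf]]]]]; have [r0 C0 M1 h] := hf.
have [ha _] := expansion_coef hf; have M0 : 0 < M by rewrite (lt_le_trans ltr01).
have fsE n z : nm (z - z0) < r -> (forall k, (k < n)%N -> a k = 0) ->
    f z = (z - z0) ^+ n * (fs n z : R[i]).
  move=> /h[-> hz]; elim: n => [|n IH] ak; first by rewrite expr0 mul1r.
  rewrite IH => [|k kn]; last by rewrite ak// ltnW.
  by rewrite (hz n).1 ak// add0r exprSr -mulrA.
have [a0|] := pselect (forall n, a n = 0).
  left; exists (Num.min r (2 * M)^-1); first by rewrite lt_min r0 invr_gt0 mulr_gt0.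
  move=> z; rewrite lt_min => /andP[zr zM]; apply: nm_eq0; apply: le_anti.
  rewrite nm_ge0 andbT; apply: le_eps => e e0; rewrite add0r.
  have qn n : nm (f z) <= C * 2^-1 ^+ n.
    rewrite (fsE n z zr)// nmM nmX.
    rewrite (le_trans (ler_wpM2l (exprn_ge0 _ (nm_ge0 _)) ((h z zr).2 n).2))//.
    rewrite mulrCA -exprMn ler_wpM2l// lerXn2r ?nnegrE ?invr_ge0 ?mulr_ge0 ?nm_ge0 ?(ltW M0)//.
    by move: (ltW zM); rewrite invfM -ler_pdivlMr ?invr_gt0// invrK mulrC.
  have C1 : 0 < C + 1 by rewrite ltr_wpDl.
  have [N HN] := inv_lt (divr_gt0 e0 C1).
  apply: le_trans (qn N) _; apply: (@le_trans _ _ ((C + 1) * N.+1%:R^-1)).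
    rewrite ler_pM ?exprn_ge0 ?invr_ge0 ?lerDl// exprVn lef_pV2 ?posrE ?exprn_gt0//.
    by rewrite -natrX ler_nat ltn_expl.
  by have := ltW (HN N (leqnn _)); rewrite ler_pdivlMr// mulrC.
move=> /existsNP[n /eqP an]; right.
have ex : exists n, a n != 0 by exists n.
have [p ap pmin] := ex_minnP ex.
have ak k : (k < p)%N -> a k = 0.
  by move=> kp; apply/eqP; apply: contraTT kp => /pmin; rewrite -leqNgt.
have C'0 : 0 <= C * M ^+ p by rewrite mulr_ge0// exprn_ge0// ltW.
exists p, (fs p), r; split=> //.
- exists (fun k => a (p + k)%N), (fun k => fs (p + k)%N), r, (C * M ^+ p), M.
  split=> // z zr; split; first by rewrite addn0.
  move=> k; have [_ hz] := h z zr; rewrite addnS (hz (p + k)%N).1; split=> //.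
  by rewrite -(hz (p + k)%N).1 -mulrA -exprD (hz _).2.
- by rewrite -(ha p).1.
- by move=> z zr; apply: fsE.
Qed.

Lemma holo_prod I (r : seq I) (P : pred I) (f : I -> R[i] -> R[i]^o) z0 :
  (forall i, holoC (f i) z0) ->
  holoC (fun z => \prod_(i <- r | P i) (f i z : R[i])) z0.
Proof.
move=> h; elim: r => [|i r IH].
  have -> : (fun z => \prod_(i <- [::] | P i) (f i z : R[i])) = (fun=> 1).
    by apply/funext => z; rewrite big_nil.
  exact: (holo_cst nm_seminorm).
have -> : (fun z => \prod_(j <- i :: r | P j) (f j z : R[i])) =
    (fun z => (if P i then (f i z : R[i]) else 1) * \prod_(j <- r | P j) (f j z : R[i])).
  by apply/funext => z; rewrite big_cons; case: ifP; rewrite ?mul1r.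
apply: holo_scalar_mul => //; case: (P i) => //.
exact: (holo_cst nm_seminorm).
Qed.

Lemma holo_det n (A : R[i] -> 'M[R[i]]_n) z0 :
  (forall i j, holoC (fun z => A z i j) z0) -> holoC (fun z => \det (A z)) z0.
Proof.
move=> h; rewrite /determinant; apply: (holo_sum nm_seminorm) => s.
apply: holo_scalar_mul; first exact: (holo_cst nm_seminorm).
by apply: holo_prod => i; exact: h.
Qed.

Lemma holo_adj n (A : R[i] -> 'M[R[i]]_n) z0 i j :
  (forall i j, holoC (fun z => A z i j) z0) -> holoC (fun z => (\adj (A z)) i j) z0.
Proof.
move=> h; have -> : (fun z => (\adj (A z)) i j) = (fun z => cofactor (A z) j i).
  by apply/funext => z; rewrite mxE.
rewrite /cofactor; apply: holo_scalar_mul; first exact: (holo_cst nm_seminorm).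
apply: holo_det => k l.
have -> : (fun z => row' j (col' i (A z)) k l) = (fun z => A z (lift j k) (lift i l)).
  by apply/funext => z; rewrite !mxE.
exact: h.
Qed.

End HoloScalar.

(** * Reduction to a finite determinant *)

Section Fredholm.
Context {R : realType}.
Variables (K : hilbertType R) (psi : nat -> K).

Lemma rank1_exists (u v : K) : exists B : bop K K, forall x, B x = dot u x *: v.
Proof.
apply: (@bop_make _ _ _ _ (nm u * nm v)) => [a x y|x].
  by rewrite dotDr dotZr scalerDl scalerA.
by rewrite nmZ mulrAC ler_wpM2r ?nm_ge0// nm_dot.
Qed.

Definition rank1 (u v : K) : bop K K := xget 0 [set B : bop K K | forall x, B x = dot u x *: v].

Lemma rank1E u v x : rank1 u v x = dot u x *: v.
Proof. exact: (xgetPex _ (rank1_exists u v)). Qed.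

Definition proj_op n : bop K K := \sum_(j < n) rank1 (psi j) (psi j).

Definition coords n (x : K) : 'rV[R[i]]_n := \row_i dot (psi i) x.

Definition lift_row n (c : 'rV[R[i]]_n) : K := \sum_j c 0 j *: psi j.

Lemma lift_rowZ n a (c : 'rV[R[i]]_n) : lift_row (a *: c) = a *: lift_row c.
Proof. by rewrite scaler_sumr; apply: eq_bigr => j _; rewrite mxE scalerA. Qed.

Lemma coordsD n x y : coords n (x + y) = coords n x + coords n y.
Proof. by apply/rowP => i; rewrite !mxE dotDr. Qed.

Lemma coordsZ n a x : coords n (a *: x) = a *: coords n x.
Proof. by apply/rowP => i; rewrite !mxE dotZr. Qed.

Lemma proj_opE n x : proj_op n x = lift_row (coords n x).
Proof.
rewrite bop_sumE; apply: eq_bigr => j _.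
by rewrite rank1E mxE.
Qed.

(** [proj_op] is X = [lift_row] after Y = [coords], so 1 + G X Y is traded for the matrix of 1 + Y G
    X. It is transposed because coordinates are row vectors. *)
Definition compression n (G : bop K K) : 'M[R[i]]_n :=
  \matrix_(j, i) ((i == j)%:R + dot (psi i) (G (psi j))).

Lemma mul_compression n (G : bop K K) (c : 'rV[R[i]]_n) :
  c *m compression n G = c + coords n (G (lift_row c)).
Proof.
apply/rowP => i; rewrite !mxE /lift_row bop_sum dot_sumr.
have -> : c 0 i = \sum_j c 0 j * (i == j)%:R.
  rewrite (bigD1 i)//= eqxx mulr1 big1 ?addr0// => j ji.
  by rewrite eq_sym (negPf ji) mulr0.
rewrite -big_split; apply: eq_bigr => j _.
by rewrite mxE bopZ dotZr mulrDr.
Qed.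

(** The identity (1 + X Y)^-1 = 1 - X (1 + Y X)^-1 Y multiplied by the determinant: the adjugate
    replaces the inverse matrix, so nothing is divided and the result is holomorphic where G is. *)
Definition adj_inverse n (G : bop K K) : bop K K := \det (compression n G) *: bop_id K -
  \sum_i \sum_j (\adj (compression n G)) i j *: (G \c rank1 (psi i) (psi j)).

Lemma adj_inverseE n G x : adj_inverse n G x = \det (compression n G) *: x -
  G (lift_row (coords n x *m \adj (compression n G))).
Proof.
rewrite /adj_inverse !bopE; congr (_ - _); rewrite bop_sumE.
under eq_bigr do rewrite bop_sumE.
rewrite exchange_big /lift_row bop_sum; apply: eq_bigr => j _.
rewrite mxE bopZ scaler_suml; apply: eq_bigr => i _.
by rewrite !bopE rank1E bopZ scalerA [coords n x _ _]mxE mulrC.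
Qed.

Lemma adj_inverse_l n G :
  adj_inverse n G \c (bop_id K + G \c proj_op n) = \det (compression n G) *: bop_id K.
Proof.
apply: bopP => u; rewrite bop_compE adj_inverseE !bopE proj_opE.
have -> : coords n (u + G (lift_row (coords n u))) = coords n u *m compression n G.
  by rewrite mul_compression coordsD.
by rewrite -mulmxA mul_mx_adj mul_mx_scalar lift_rowZ bopZ scalerDr addrK.
Qed.

Lemma adj_inverse_r n G :
  (bop_id K + G \c proj_op n) \c adj_inverse n G = \det (compression n G) *: bop_id K.
Proof.
apply: bopP => x; rewrite bop_compE adj_inverseE.
set y := lift_row (_ *m _); set d := \det _.
rewrite !bopE proj_opE.
have -> : lift_row (coords n (d *: x - G y)) = y.
  rewrite /y; congr lift_row; rewrite coordsD coordsZ -scaleN1r coordsZ scaleN1r.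
  have := mul_compression G (coords n x *m \adj (compression n G)).
  rewrite -mulmxA mul_adj_mx mul_mx_scalar -/y -/d => ->.
  by rewrite addrK.
by rewrite subrK.
Qed.

(** A row v annihilated by the matrix is the coordinate row of u = - G ([lift_row] v), so u is
    nonzero. *)
Lemma not_injective n G : \det (compression n G) = 0 ->
  exists2 u, u != 0 & (bop_id K + G \c proj_op n) u = 0.
Proof.
move=> /eqP/det0P[v v0 vm]; exists (- G (lift_row v)).
  apply: contra v0 => /eqP u0; have := mul_compression G v; rewrite vm.
  move=> /esym/eqP; rewrite addr_eq0 => /eqP ->.
  rewrite -scaleN1r -coordsZ scaleN1r u0.
  by apply/eqP/rowP => i; rewrite !mxE dot0r.
rewrite !bopE proj_opE.
have -> : coords n (- G (lift_row v)) = v.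
  rewrite -scaleN1r coordsZ scaleN1r.
  have := mul_compression G v; rewrite vm => /esym/eqP; rewrite addr_eq0.
  by move=> /eqP <-.
by rewrite addNr.
Qed.

Lemma holo_dot (f : R[i] -> bop K K) u v z0 : holo (@bn R K K) f z0 ->
  holo (V := R[i]^o) (@nm R R[i]) (fun z => dot u (f z v)) z0.
Proof.
move=> hf; apply: (@holo_lin R (bop K K) R[i]^o (@bn R K K) (@nm R R[i])
  (fun A : bop K K => dot u (A v)) (nm u * nm v) f z0 _ _ _ hf).
- by move=> a A B; rewrite !bopE dotDr dotZr.
- by rewrite mulr_ge0 ?nm_ge0.
- move=> A; rewrite (le_trans (nm_dot _ _))// -mulrA ler_wpM2l ?nm_ge0//.
  by rewrite mulrC bn_le.
Qed.

Lemma holo_compression n (G : R[i] -> bop K K) z0 i j : holo (@bn R K K) G z0 ->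
  holo (V := R[i]^o) (@nm R R[i]) (fun z => compression n (G z) i j) z0.
Proof.
move=> hG; have -> : (fun z => compression n (G z) i j) =
    (fun z => (j == i)%:R + dot (psi j) (G z (psi i))).
  by apply/funext => z; rewrite mxE.
apply: (holoD nm_seminorm); first exact: (holo_cst nm_seminorm).
exact: holo_dot.
Qed.

Lemma holo_adj_inverse n (G : R[i] -> bop K K) z0 : holo (@bn R K K) G z0 ->
  holo (@bn R K K) (fun z => adj_inverse n (G z)) z0.
Proof.
move=> hG; have bP := bn_seminorm K K.
have cst (B : bop K K) := holo_cst bP B z0.
apply: (holoD bP).
  by apply: holo_scale => //; apply: holo_det => i j; exact: holo_compression.
have -> : (fun z => - (\sum_i \sum_j (\adj (compression n (G z))) i j *:
      (G z \c rank1 (psi i) (psi j)))) =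
  (fun z => \sum_i \sum_j (\adj (compression n (G z))) i j *:
      (G z \c - rank1 (psi i) (psi j))).
  apply/funext => z; rewrite -sumrN; apply: eq_bigr => i _.
  by rewrite -sumrN; apply: eq_bigr => j _; rewrite compNr scalerN.
apply: (holo_sum bP) => i; apply: (holo_sum bP) => j; apply: holo_scale.
  by apply: holo_adj => k l; exact: holo_compression.
exact: holo_comp.
Qed.

(* With T = T Q + (small), 1 + g T = f (1 + G Q) where f is invertible near    *)
(* z0 and 1 + G Q is invertible iff a finite determinant does not vanish.      *)
Lemma fredholm (g : R[i] -> bop K K) (T : bop K K) z0 :
  holo (@bn R K K) g z0 ->
  (forall e : R, 0 < e -> exists n, bn (T - T \c proj_op n) <= e) ->
  (exists2 rho : R, 0 < rho & forall z, nm (z - z0) < rho ->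
     ~ invertible_op (bop_id K + g z \c T)) \/
  (exists p Y (rho : R), [/\ 0 < rho, holo (@bn R K K) Y z0 &
     forall z, 0 < nm (z - z0) < rho -> invertible_op (bop_id K + g z \c T) /\
       (z - z0) ^+ p *: inv_op (bop_id K + g z \c T) = Y z]).
Proof.
move=> hg hT; have bP := bn_seminorm K K.
have cst (B : bop K K) := holo_cst bP B z0.
(* A tail this small makes g(z0) [T1] of norm at most 1/2, so that f(z0) is invertible. *)
have e0 : 0 < 2^-1 / (bn (g z0) + 1) by rewrite divr_gt0 ?invr_gt0// ltr_wpDl ?bn_ge0.
have [n hn] := hT _ e0; set Q := proj_op n in hn.
pose T1 := T - T \c Q; pose f z := bop_id K + g z \c T1.
have hf : holo (@bn R K K) f z0 by apply: (holoD bP) => //; exact: holo_comp.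
have id1 : inv_op (bop_id K) = bop_id K by apply: inv_op_eq; rewrite comp1l.
have iid : invertible_op (bop_id K) by exists (bop_id K); rewrite comp1l.
have if0 : invertible_op (f z0).
  have [] := @invertible_perturb _ _ (bop_id K) (g z0 \c T1) 1 iid ltr01 _ _ => //.
    by rewrite id1 bn_id.
  rewrite mulr1 (le_trans (bn_comp _ _))//.
  move: hn; rewrite -/T1 ler_pdivlMr ?ltr_wpDl ?bn_ge0// => hn; apply: le_trans hn.
  by rewrite mulrC ler_wpM2l ?bn_ge0// lerDl.
have [r1 [b [r10 _ hr1]]] := holo_invertible_near hf if0.
pose G z := inv_op (f z) \c g z \c T.
have hG : holo (@bn R K K) G z0.
  by apply: holo_comp => //; apply: holo_comp => //; exact: holo_inv.
have fac z : nm (z - z0) < r1 ->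
    bop_id K + g z \c T = f z \c (bop_id K + G z \c Q).
  move=> /hr1[iz _]; rewrite compDr comp1r /G !compA (inv_opP iz).1 comp1l.
  by rewrite -!compA /f /T1 compBr -addrA subrK.
have hd : holo (V := R[i]^o) (@nm R R[i]) (fun z => \det (compression n (G z))) z0.
  by apply: holo_det => i j; exact: holo_compression.
(* Identical vanishing of the determinant is the degenerate branch; otherwise its order of vanishing
   p bounds the order of the pole. *)
have [[r2 r20 d0]|[p [e [r2 [he ez0 r20 dE]]]]] := holo_factor hd; [left|right].
  exists (Num.min r1 r2); first by rewrite lt_min r10.
  move=> z; rewrite lt_min => /andP[z1 z2] [B [_ BA]].
  have [u u0 Gu] := not_injective (d0 z z2).
  move: u0; rewrite -[u]bop_idE -BA bopE fac// bopE Gu !bop0.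
  by rewrite eqxx.
have he' : holo (@bn R K K) (fun z => e z *: bop_id K) z0 by exact: holo_scale.
have ie c : c != 0 -> invertible_op (c *: bop_id K) /\
    inv_op (c *: bop_id K) = c^-1 *: bop_id K.
  move=> c0; have h1 : (c *: bop_id K) \c (c^-1 *: bop_id K) = bop_id K.
    by rewrite compZl compZr comp1l scalerA divff// scale1r.
  have h2 : (c^-1 *: bop_id K) \c (c *: bop_id K) = bop_id K.
    by rewrite compZl compZr comp1l scalerA mulVf// scale1r.
  by split; [exists (c^-1 *: bop_id K)|exact: inv_op_eq].
have [r3 r30 hr3] : exists2 rho : R, 0 < rho & forall z, nm (z - z0) < rho -> e z != 0.
  have e2 : 0 < nm (e z0 : R[i]) / 2 by rewrite divr_gt0// nm_gt0.
  have [rho rho0 h] := holo_near nm_seminorm he e2; exists rho => // z /h.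
  apply: contraTneq => ->; rewrite sub0r nmN -ltNge ltr_pdivrMr//.
  by rewrite ltr_pMr ?ltr1n// nm_gt0.
exists p, (fun z => inv_op (e z *: bop_id K) \c adj_inverse n (G z) \c inv_op (f z)).
exists (Num.min r1 (Num.min r2 r3)); split.
- by rewrite !lt_min r10 r20.
- apply: holo_comp; last exact: holo_inv.
  apply: holo_comp; last exact: holo_adj_inverse.
  by apply: holo_inv => //; exact: (ie _ ez0).1.
move=> z /andP[zn0]; rewrite !lt_min => /andP[z1 /andP[z2 z3]].
have [iz _] := hr1 _ z1; have [fi if_] := inv_opP iz.
have ez := hr3 _ z3; rewrite (ie _ ez).2.
have wp : (z - z0) ^+ p != 0 by rewrite expf_neq0// -nm_gt0.
pose d := \det (compression n (G z)).
have dz : d != 0 by rewrite /d dE// mulf_neq0.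
have dV : d^-1 *: adj_inverse n (G z) \c inv_op (f z) \c (bop_id K + g z \c T) = bop_id K.
  rewrite fac// compA -[_ \c inv_op _ \c _]compA if_ comp1r compZl adj_inverse_l.
  by rewrite scalerA mulVf// scale1r.
have Vd : (bop_id K + g z \c T) \c (d^-1 *: adj_inverse n (G z) \c inv_op (f z)) = bop_id K.
  rewrite fac// compA -[f z \c _ \c _]compA compZr adj_inverse_r.
  by rewrite scalerA mulVf// scale1r comp1r.
split; first by eexists; split; [exact: Vd|exact: dV].
rewrite (inv_op_eq Vd dV) !compZl comp1l scalerA; congr (_ *: _).
rewrite /d dE// invfM mulrA divff// mul1r //.
Qed.

End Fredholm.

(** * Taylor and Laurent series in trace norm *)

Section Series.
Context {R : realType}.

Definition partial (V : lmodType R[i]) (a : nat -> V) (z0 z : R[i]) n : V :=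
  \sum_(0 <= k < n) (z - z0) ^+ k *: a k.

Lemma partialS (V : lmodType R[i]) (a : nat -> V) z0 z n :
  partial a z0 z n.+1 = partial a z0 z n + (z - z0) ^+ n *: a n.
Proof. by rewrite /partial big_nat_recr. Qed.

Lemma expansion_remainder V nr f z0 a fs rho C M :
  @expansion R V nr f z0 a fs rho C M -> forall n z, nm (z - z0) < rho ->
  f z - partial a z0 z n = (z - z0) ^+ n *: fs n z.
Proof.
move=> [_ _ _ h] n z /h[fz hz]; elim: n => [|n IH].
  by rewrite /partial big_nil subr0 expr0 scale1r.
rewrite partialS opprD addrA IH -scalerBr (hz n).1.
by rewrite addrAC subrr add0r scalerA exprSr.
Qed.

(** Convergence gives geometric bounds: at one point at distance rho / 2 the remainders are bounded
    by some B, so the n-th coefficient is at most 2 B (2 / rho)^n. The centre is excluded so that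
    Laurent expansions, multiplied by a power, are covered too. *)
Lemma series_remainder (V : lmodType R[i]) (nr : V -> R) f z0 a (rho : R) :
  is_seminorm nr -> 0 < rho ->
  (forall z, 0 < nm (z - z0) < rho -> forall e : R, 0 < e ->
     exists N, forall n, (N <= n)%N -> nr (f z - partial a z0 z n) <= e) ->
  exists r C M : R, [/\ 0 < r, 0 <= C, 1 <= M, (forall n, nr (a n) <= C * M ^+ n) &
    forall n z, 0 < nm (z - z0) < r ->
      nr (f z - partial a z0 z n) <= C * (M * nm (z - z0)) ^+ n].
Proof.
move=> nrP r0 h; have [nr0 nrD nrZ] := nrP.
pose z1 := z0 + (rho / 2)%:C.
have w1 : nm (z1 - z0) = rho / 2.
  by rewrite /z1 addrAC subrr add0r nm_real ger0_norm// ltW// divr_gt0.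
have hz1 : 0 < nm (z1 - z0) < rho.
  by rewrite w1 divr_gt0//= ltr_pdivrMr// ltr_pMr// ltr1n.
have [N HN] := h z1 hz1 1 ltr01.
pose B := \sum_(k < N) nr (f z1 - partial a z0 z1 k) + 1.
have hB n : nr (f z1 - partial a z0 z1 n) <= B.
  have [Nn|nN] := leqP N n.
    by rewrite (le_trans (HN _ Nn))// lerDr sumr_ge0.
  rewrite /B (bigD1 (Ordinal nN))//= -addrA lerDl addr_ge0// sumr_ge0//.
have B0 : 0 <= B by rewrite (le_trans _ (hB 0%N)).
pose M := Num.max 1 (2 / rho); have M1 : 1 <= M by rewrite le_max lexx.
have M0 : 0 < M by rewrite (lt_le_trans ltr01).
have ha n : nr (a n) <= B *+ 2 * M ^+ n.
  have E : nm (z1 - z0) ^+ n * nr (a n) <= B *+ 2.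
    rewrite -nmX -nrZ (_ : _ *: _ = (f z1 - partial a z0 z1 n) -
      (f z1 - partial a z0 z1 n.+1)); last first.
      by rewrite partialS opprB [RHS]addrC subrKA [RHS]addrAC subrr add0r.
    by rewrite (le_trans (seminormB nrP _ _))// mulr2n lerD.
  move: E; rewrite mulrC -ler_pdivlMr ?exprn_gt0 ?w1 ?divr_gt0// => /le_trans; apply.
  rewrite ler_wpM2l ?mulrn_wge0// -exprVn invf_div lerXn2r ?nnegrE ?divr_ge0 ?(ltW r0) ?(ltW M0)//.
  by rewrite le_max lexx orbT.
have C0 : 0 <= (B *+ 2) by rewrite mulrn_wge0.
exists (Num.min rho (2 * M)^-1), (B *+ 2 *+ 2), M; split=> //.
- by rewrite lt_min r0 invr_gt0 mulr_gt0.
- by rewrite mulrn_wge0.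
- move=> n; rewrite (le_trans (ha n))// ler_wpM2r ?exprn_ge0 ?(ltW M0)//.
  by rewrite mulr2n lerDl.
move=> n z; rewrite lt_min => /andP[z0' /andP[zr zM]].
set q := M * nm (z - z0).
have q0 : 0 <= q by rewrite mulr_ge0 ?nm_ge0 ?ltW.
have q2 : q <= 2^-1.
  by rewrite /q mulrC -ler_pdivlMr// -invfM ltW.
(* As q is at most 1/2, q^k <= 2 q^k - 2 q^(k+1), and the terms telescope. *)
have dist m : nr (partial a z0 z (n + m) - partial a z0 z n) <=
    B *+ 2 * (q ^+ n *+ 2 - q ^+ (n + m) *+ 2).
  elim: m => [|m IH]; first by rewrite addn0 !subrr seminorm0// mulr0.
  rewrite addnS partialS addrAC (le_trans (nrD _ _))//.
  rewrite nrZ nmX.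
  have h1 : nm (z - z0) ^+ (n + m) * nr (a (n + m)%N) <= B *+ 2 * q ^+ (n + m).
    rewrite /q exprMn mulrC (mulrA (B *+ 2)) ler_wpM2r ?exprn_ge0 ?nm_ge0//.
  apply: le_trans (lerD IH h1) _; rewrite -mulrDr ler_wpM2l//.
  have := ler_wpM2l (exprn_ge0 (n + m) q0) q2; rewrite -exprSr; lra.
apply: le_eps => e e0.
have [|N' HN'] := h z _ e e0; first by rewrite z0'.
have := HN' (n + N')%N (leq_addl _ _) => h1.
rewrite -(subrKA (partial a z0 z (n + N'))) (le_trans (nrD _ _))// addrC lerD//.
rewrite (le_trans (dist N'))//.
have qn : 0 <= q ^+ (n + N') by exact: exprn_ge0.
rewrite [leRHS]mulrnAl -[leRHS]mulrnAr ler_wpM2l//.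
by rewrite gerBl mulrn_wge0.
Qed.

(** Off [z0] the remainders are obtained by dividing by powers of z - z0; at [z0] they are the
    coefficients. *)
Lemma holo_of_analytic (H K : hilbertType R) (f : R[i] -> bop H K) z0 :
  analytic_at (@opnorm R H K) f z0 -> holo (@bn R H K) f z0.
Proof.
move=> [rho' [a [/gt0C[-> ]]]]; set rho := complex.Re rho' => rho0 _ h.
have hl z : nm (z - z0) < rho -> forall e : R, 0 < e ->
     exists N, forall n, (N <= n)%N -> bn (f z - partial a z0 z n) <= e.
  move=> zr e e0; have [|_] := h z; first by rewrite ltnmE.
  move=> /(ecvg0P eventually_filter (fun n => opnorm_ge0 _)) /(_ e e0)[N _ HN].
  by exists N => n Nn; rewrite -lee_fin -opnormE; exact: HN.
have bP := bn_seminorm H K.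
have [r [C [M [r0 C0 M1 ha hr]]]] := @series_remainder _ _ f z0 a rho bP rho0
   (fun z zr => hl z (proj2 (andP zr))).
have fz0 : f z0 = a 0%N.
  apply/eqP; rewrite -subr_eq0; apply/eqP/bn_eq0/le_anti; rewrite bn_ge0 andbT.
  apply: le_eps => e e0; have [|N HN] := hl z0 _ e e0; first by rewrite subrr nm0.
  have := HN N.+1 (leqnSn _); rewrite /partial big_nat_recl// subrr expr0 scale1r.
  rewrite big1 ?addr0 ?add0r// => k _.
  by rewrite expr0n/= scale0r.
exists a, (fun n z => if z == z0 then a n else
   (z - z0) ^- n *: (f z - partial a z0 z n)), r, C, M; split=> // z zr.
have [zz0|zz0] := eqVneq z z0.
  by rewrite zz0; split=> // n; rewrite subrr scale0r addr0 ha.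
have w0 : z - z0 != 0 by rewrite subr_eq0.
split=> [|n]; first by rewrite expr0 invr1 scale1r /partial big_nil subr0.
split.
  have c1 : (z - z0) * (z - z0) ^- n.+1 = (z - z0) ^- n.
    by rewrite exprS invfM mulrA divff// mul1r.
  rewrite partialS opprD addrA scalerA c1 [in RHS]scalerBr.
  rewrite [_ *: (_ *: a n)]scalerA mulVf ?expf_neq0// scale1r.
  by rewrite [RHS]addrC subrK.
have [_ _ bZ] := bP; rewrite bZ nmV nmX mulrC ler_pdivrMr ?exprn_gt0 ?nm_gt0//.
by rewrite -mulrA -exprMn hr// nm_gt0 w0.
Qed.

Lemma eq_cvg0 (u v : nat -> \bar R) : u =1 v ->
  u @ \oo --> 0%E -> v @ \oo --> 0%E.
Proof. by move=> /funext ->. Qed.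

(** * From operator norm to trace norm *)

Section Sandwich.
Variables (K L : hilbertType R) (A : bop K L) (h : R).
Hypothesis hA : (hsn A <= h%:E)%E.

Lemma trace_norm_sandwich_fin (X : bop K K) :
  (trace_norm (A \c X \c adjoint A) < +oo)%E.
Proof.
have x0 : 0 < bn X + 1 by rewrite ltr_wpDl ?bn_ge0.
apply: le_lt_trans (trace_norm_sandwich x0 _ hA) (ltry _).
by rewrite lerDl.
Qed.

Lemma sandwich_partial (c : nat -> bop K K) z0 z n :
  A \c partial c z0 z n \c adjoint A =
  partial (fun k => A \c c k \c adjoint A) z0 z n.
Proof.
elim: n => [|n IH]; first by rewrite /partial !big_nil comp0r comp0l.
by rewrite !partialS compDr compDl IH compZr compZl.
Qed.

(** A remainder that is small in operator norm is small in trace norm between Hilbert-Schmidt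
    factors. The free scalar [s] leaves room for a negative power of z - z0. *)
Lemma tail_sandwich Y z0 : holo (@bn R K K) Y z0 ->
  exists (c : nat -> bop K K) (r : R), 0 < r /\ forall z (s : R[i]), nm (z - z0) < r ->
    trace_norm (A \c (s *: (Y z - partial c z0 z n)) \c adjoint A) @[n --> \oo] --> 0%E.
Proof.
move=> [a [fs [rho [C [M hY]]]]]; have [r0 C0 M1 hz] := hY.
have M0 : 0 < M by rewrite (lt_le_trans ltr01).
have h0 : 0 <= h.
  by rewrite -lee_fin (le_trans _ hA)//; apply: esum_ge0 => e _; rewrite lee_fin sqr_ge0.
exists a, (Num.min rho (2 * M)^-1); split; first by rewrite lt_min r0 invr_gt0 mulr_gt0.
move=> z s; rewrite lt_min => /andP[zr zM]; set q := M * nm (z - z0).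
have q0 : 0 <= q by rewrite mulr_ge0 ?nm_ge0 ?ltW.
have q2 : q <= 2^-1.
  by rewrite /q mulrC -ler_pdivlMr// -invfM ltW.
apply/ecvg0P => [n|e e0]; first exact: trace_norm_ge0.
have D0 : 0 < nm s * C + 1 by rewrite ltr_wpDl// mulr_ge0 ?nm_ge0.
have E0 : 0 < (nm s * C + 1) * (h + 1) by rewrite mulr_gt0// ltr_wpDl.
have [N HN] := inv_lt (divr_gt0 e0 E0); exists N => // n /= Nn.
have n0 : (0 : R) < n.+1%:R^-1 by rewrite invr_gt0.
have x0 : 0 < (nm s * C + 1) * n.+1%:R^-1 by rewrite mulr_gt0.
apply: le_trans (trace_norm_sandwich x0 _ hA) _.
  rewrite bnZ (expansion_remainder hY)// bnZ nmX.
  have h1 : nm (z - z0) ^+ n * bn (fs n z) <= C * n.+1%:R^-1.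
    apply: le_trans (ler_wpM2l (exprn_ge0 _ (nm_ge0 _)) ((hz z zr).2 n).2) _.
    rewrite mulrCA -exprMn ler_wpM2l// mulrC -/q.
    apply: (@le_trans _ _ (2^-1 ^+ n)); first by rewrite lerXn2r ?nnegrE ?invr_ge0.
    rewrite exprVn lef_pV2 ?posrE ?exprn_gt0//.
    by rewrite -natrX ler_nat ltn_expl.
  apply: le_trans (ler_wpM2l (nm_ge0 _) h1) _.
  by rewrite mulrA ler_wpM2r ?(ltW n0)// lerDl.
rewrite lee_fin; apply: le_trans (_ : (nm s * C + 1) * (h + 1) * n.+1%:R^-1 <= _).
  by rewrite mulrAC ler_wpM2r ?(ltW n0)// ler_wpM2l ?(ltW D0)// lerDl.
by have := ltW (HN n Nn); rewrite ler_pdivlMr// mulrC.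
Qed.

Lemma sandwich_meromorphic Y z0 (F : R[i] -> bop L L) m (rho : R) (s0 : R[i]) :
  holo (@bn R K K) Y z0 -> 0 < rho ->
  (forall z, 0 < nm (z - z0) < rho ->
     F z = s0 *: (A \c ((z - z0) ^- m *: Y z) \c adjoint A)) ->
  meromorphic_at (@trace_norm R L L) F z0.
Proof.
move=> hY rho0 FE; have [c [r [r0 hc]]] := tail_sandwich hY.
exists m, (fun k => A \c (s0 *: c k) \c adjoint A), (Num.min rho r)%:C; split.
- by rewrite ltcR lt_min rho0.
- by move=> k; exact: trace_norm_sandwich_fin.
move=> z; rewrite nmE !ltcR lt_min => /andP[z0' /andP[z1 z2]].
have w0 : z - z0 != 0 by rewrite -nm_gt0.
rewrite FE ?z0'//; split.
  by rewrite -compZl -compZr; exact: trace_norm_sandwich_fin.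
apply: (eq_cvg0 _ (hc z (s0 * (z - z0) ^- m) z2)) => n; congr trace_norm.
rewrite -scalerA scalerBr scalerBr compBr compBl; congr (_ - _).
  by rewrite -compZl -compZr.
rewrite scalerA compZr compZl sandwich_partial /partial scaler_sumr.
apply: eq_bigr => k _; rewrite compZr compZl !scalerA.
congr (_ *: _); rewrite expfzDr// -exprnN -exprnP.
by rewrite [RHS]mulrC [(z - z0) ^+ k * _]mulrC mulrA.
Qed.

Lemma sandwich_analytic Y z0 (F : R[i] -> bop L L) (rho : R) (s0 : R[i]) :
  holo (@bn R K K) Y z0 -> 0 < rho ->
  (forall z, nm (z - z0) < rho -> F z = s0 *: (A \c Y z \c adjoint A)) ->
  analytic_at (@trace_norm R L L) F z0.
Proof.
move=> hY rho0 FE; have [c [r [r0 hc]]] := tail_sandwich hY.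
exists (Num.min rho r)%:C, (fun k => A \c (s0 *: c k) \c adjoint A); split.
- by rewrite ltcR lt_min rho0.
- by move=> k; exact: trace_norm_sandwich_fin.
move=> z; rewrite nmE !ltcR lt_min => /andP[z1 z2].
rewrite FE//; split.
  by rewrite -compZl -compZr; exact: trace_norm_sandwich_fin.
apply: (eq_cvg0 _ (hc z s0 z2)) => n; congr trace_norm.
rewrite scalerBr compBr compBl; congr (_ - _).
  by rewrite -compZl -compZr.
rewrite compZr compZl sandwich_partial /partial scaler_sumr.
by apply: eq_bigr => k _; rewrite compZr compZl !scalerA mulrC.
Qed.

End Sandwich.

(** A bound at points accumulating at [z0] suffices. If a_i = 0 for i < k, then (z - z0)^k a_k
    differs from (z - z0)^m F(z) by O(|z - z0|^(k+1)), and the latter is of that order as well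
    because k < m. *)
Lemma bounded_no_negative_powers (L : hilbertType R) (F : R[i] -> bop L L) z0 (B : R) :
  (forall e : R, 0 < e -> exists2 z, 0 < nm (z - z0) < e & bn (F z) <= B) ->
  no_negative_powers (@trace_norm R L L) F z0.
Proof.
move=> hB m a [rho' [/gt0C[-> ]]]; set rho := complex.Re rho' => rho0 _ h.
pose f z := (z - z0) ^+ m *: F z.
have hl z : 0 < nm (z - z0) < rho -> forall e : R, 0 < e ->
    exists N, forall n, (N <= n)%N -> bn (f z - partial a z0 z n) <= e.
  move=> /andP[z0' zr] e e0; have w0 : z - z0 != 0 by rewrite -nm_gt0.
  have [|_] := h z; first by rewrite nmE !ltcR z0'.
  have wm : 0 < nm (z - z0) ^+ m by rewrite exprn_gt0.
  move=> /(ecvg0P eventually_filter (fun n => trace_norm_ge0 _)) /(_ _ (divr_gt0 e0 wm))[N _ HN].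
  exists N => n Nn; have := bn_trace_norm (HN n Nn).
  rewrite ler_pdivlMr// mulrC -nmX -bnZ scalerBr scaler_sumr.
  suff -> : \sum_(0 <= k < n) (z - z0) ^+ m *: ((z - z0) ^ (k%:Z - m%:Z) *: a k) =
    partial a z0 z n by [].
  apply: eq_bigr => k _; rewrite scalerA; congr (_ *: _).
  by rewrite expfzDr// -exprnN mulrCA divff ?mulr1// expf_neq0.
have [r [C [M [r0 C0 M1 _ hr]]]] := series_remainder (bn_seminorm L L) rho0 hl.
have M0 : 0 <= M by rewrite (le_trans ler01).
elim/ltn_ind => k IH km.
apply: bn_eq0; apply: le_anti; rewrite bn_ge0 andbT; apply: le_eps => e e0.
(* [a k] will have norm at most [q * D]: |B| comes from F, the second term from the remainder after
   k + 1 terms, and 1 keeps [D] positive. *)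
rewrite add0r; pose D := `|B| + C * M ^+ k.+1 + 1.
have D0 : 0 < D by rewrite /D ltr_wpDl// addr_ge0// mulr_ge0// exprn_ge0.
have [|z /andP[z0' ze] zB] := hB (Num.min (Num.min r 1) (e / D)).
  by rewrite !lt_min r0 ltr01 divr_gt0.
move: ze; rewrite !lt_min => /andP[/andP[zr z1] ze].
set q := nm (z - z0) in z0' zr z1 ze.
have := hr k.+1 z; rewrite z0' zr => /(_ isT).
rewrite partialS /partial big_nat_cond big1 ?add0r => [hk|i]; last first.
  by move=> /andP[/andP[_ ik] _]; rewrite IH ?scaler0// (ltn_trans ik).
have qk : 0 < q ^+ k by rewrite exprn_gt0.
have h1 : q ^+ k * bn (a k) <= q ^+ k * (q * D).
  rewrite -nmX -bnZ -(subrK (f z) (_ *: _)) (le_trans (bnD _ _))//.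
  have h2 : bn (f z) <= q ^+ k * (q * `|B|).
    rewrite bnZ nmX mulrA -exprSr ler_pM ?exprn_ge0 ?bn_ge0 ?nm_ge0//.
      by rewrite ler_wiXn2l ?(ltW z1) ?nm_ge0.
    by rewrite (le_trans zB)// ler_norm.
  rewrite bn_dist nmX; apply: le_trans (lerD hk h2) _.
  rewrite -/q exprMn [q ^+ k.+1]exprSr /D.
  rewrite [C * _](_ : _ = q ^+ k * (q * (C * M ^+ k.+1))); last by ring.
  rewrite -mulrDr -mulrDr ler_wpM2l ?(ltW qk)// ler_wpM2l ?(ltW z0')//.
  lra.
move: h1; rewrite ler_pM2l// => /le_trans; apply.
by rewrite -ler_pdivlMr// ltW.
Qed.

End Series.

(** * Resolvents of self-adjoint operators *)

Section Resolvent.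
Context {R : realType}.
Variable H : hilbertType R.
Implicit Types (A : unbounded_op H) (z : R[i]).

Lemma dense_orth (M : set H) v : closure M = setT ->
  (forall m, M m -> dot m v = 0) -> v = 0.
Proof.
move=> /densityP Md h; apply: limit_unique => e e0; rewrite subr0.
have [m Mm vm] := Md v _ e0.
have [->|v0] := eqVneq v 0; first by rewrite nm0.
have vp : 0 < nm v by rewrite nm_gt0.
rewrite -(ltr_pM2r vp) -expr2 (@le_lt_trans _ _ (nm (v - m) * nm v)) ?ltr_pM2r//.
have -> : nm v ^+ 2 = nm (dot (v - m) v).
  by rewrite dotBl (h m Mm) subr0 dotxx nm_real ger0_norm// sqr_ge0.
exact: nm_dot.
Qed.

Lemma sa_sym A x y : self_adjoint A -> opdom A x -> opdom A y ->
  dot (opfun A x) y = dot x (opfun A y).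
Proof.
move=> [_ _ _ h] Dx Dy.
by have [_ h2] := h x (opfun A x); apply: h2.
Qed.

Lemma sa_lin A a x y : self_adjoint A -> opdom A x -> opdom A y ->
  opdom A (a *: x + y) /\ opfun A (a *: x + y) = a *: opfun A x + opfun A y.
Proof. by move=> [_ h _ _]; exact: h. Qed.

(** <u, A u> is real, so <u, (A - z) u> has imaginary part - Im z |u|^2. *)
Lemma sa_below A z u : self_adjoint A -> opdom A u ->
  `|complex.Im z| * nm u <= nm (opfun A u - z *: u).
Proof.
move=> sA Du; have [->|u0] := eqVneq u 0; first by rewrite nm0 mulr0 nm_ge0.
have up : 0 < nm u by rewrite nm_gt0.
rewrite -(ler_pM2l up); apply: le_trans (nm_dot _ _).
apply: le_trans (Im_le_nm _); rewrite dotBr dotZr dotxx.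
have : dot u (opfun A u) = (dot u (opfun A u))^*%C by rewrite -dotC -sa_sym.
case: (dot u _) => a b [] /eqP; rewrite -addr_eq0 -mulr2n mulrn_eq0 => /eqP /= ->.
case: z => c d /=; rewrite mulr0 !add0r normrN normrM.
by rewrite (ger0_norm (sqr_ge0 _)) mulrCA expr2.
Qed.

(** A vector orthogonal to the range of A - z is in the domain and an eigenvector for conj z, hence
    zero by [sa_below]. The inverse on the range extends by continuity. *)
Lemma resolvent_exists A z : self_adjoint A -> complex.Im z != 0 ->
  exists B : bop H H, (forall f, opdom A (B f) /\ opfun A (B f) - z *: B f = f) /\
    (forall u, opdom A u -> B (opfun A u - z *: u) = u).
Proof.
move=> sA z0; pose b := `|complex.Im z|; have b0 : 0 < b by rewrite normr_gt0.
pose M := [set x | exists y, opdom A y /\ opfun A y - z *: y = x].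
have [A0 _ _ hA] := sA.
have linM a x y x' y' : opdom A y /\ opfun A y - z *: y = x ->
    opdom A y' /\ opfun A y' - z *: y' = x' ->
    opdom A (a *: y + y') /\ opfun A (a *: y + y') - z *: (a *: y + y') = a *: x + x'.
  move=> [Dy <-] [Dy' <-]; have [? ->] := sa_lin a sA Dy Dy'; split=> //.
  by rewrite scalerDr opprD addrACA scalerBr !scalerA mulrC.
have rd : closure M = setT.
  apply: dense_of_orth.
    split=> [|a x x' [y hy] [y' hy']].
      exists 0; split=> //; rewrite scaler0 subr0.
      by have [_] := sa_lin (-1) sA A0 A0; rewrite !scaleN1r addNr !addNr.
    by exists (a *: y + y'); exact: linM.
  move=> v hv; have /hA[Dv vE] : forall y, opdom A y ->
      dot (z^*%C *: v) y = dot v (opfun A y).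
    move=> y Dy; have /(congr1 (@conjc R)) : dot (opfun A y - z *: y) v = 0.
      by apply: hv; exists y.
    rewrite -dotC conjc0 dotBr dotZr => /eqP; rewrite subr_eq0 => /eqP ->.
    by rewrite dotZl conjcK.
  apply: nm_eq0; apply: le_anti; rewrite nm_ge0 andbT.
  have := sa_below z^*%C sA Dv; rewrite vE subrr nm0.
  by rewrite (_ : `|complex.Im z^*%C| = b) ?pmulr_rle0// /b; case: (z) => c d /=; rewrite normrN.
have [B [_ HB]] : exists B : bop H H, bn B <= b^-1 /\
    forall x y, opdom A y /\ opfun A y - z *: y = x -> B x = y.
  apply: bop_extend rd; first by rewrite invr_ge0 ltW.
    by move=> a x y x' y'; exact: linM.
  by move=> x y [Dy <-]; rewrite mulrC ler_pdivlMr// mulrC sa_below.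
(* The adjoint of [B] inverts A - conj z on the domain; testing against such y puts B f into the
   domain by the self-adjointness criterion. *)
have adjB y : opdom A y -> adjoint B (opfun A y - z^*%C *: y) = y.
  move=> Dy; apply/eqP; rewrite -subr_eq0; apply/eqP.
  apply: (dense_orth rd) => _ [u [Du <-]].
  rewrite dotBr adjPr (HB _ u)// dotBr dotBl dotZl dotZr sa_sym//.
  by rewrite subrr.
exists B; split; last by move=> u Du; apply: HB.
move=> f; have /hA[Df E] : forall y, opdom A y ->
    dot (f + z *: B f) y = dot (B f) (opfun A y).
  move=> y Dy; rewrite dotDl dotZl -[y in dot f y]adjB// adjPr dotBr dotZr.
  by rewrite subrK.
by split=> //; rewrite E addrK.
Qed.

Section Fixed.
Variables (A : unbounded_op H) (z : R[i]).
Hypotheses (sA : self_adjoint A) (z0 : complex.Im z != 0).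

Lemma resolventP :
  (forall f, opdom A (resolvent A z f) /\
     opfun A (resolvent A z f) - z *: resolvent A z f = f) /\
  (forall u, opdom A u -> resolvent A z (opfun A u - z *: u) = u).
Proof. exact: (xgetPex _ (resolvent_exists sA z0)). Qed.

Lemma conj_im : complex.Im z^*%C != 0.
Proof. by case: z z0 => a b /=; rewrite oppr_eq0. Qed.

End Fixed.

Lemma resolvent_adj A z : self_adjoint A -> complex.Im z != 0 ->
  adjoint (resolvent A z) = resolvent A z^*%C.
Proof.
move=> sA z0; have [Rz _] := resolventP sA z0.
have [Rw _] := resolventP sA (conj_im z0).
apply: adj_unique => x y; have [Dx Ex] := Rz x; have [Dy Ey] := Rw y.
rewrite -{1}Ex -{2}Ey dotBr dotBl dotZr dotZl conjcK sa_sym//.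
Qed.

Lemma resolvent_identity A z w : self_adjoint A -> complex.Im z != 0 ->
  complex.Im w != 0 ->
  resolvent A z - resolvent A w = (z - w) *: (resolvent A z \c resolvent A w).
Proof.
move=> sA z0 w0; apply: bopP => f; rewrite !bopE.
have [Rw _] := resolventP sA w0; have [_ Rz] := resolventP sA z0.
have [Du E] := Rw f; set u := resolvent A w f in Du E *.
rewrite -{1}E (_ : _ - w *: u = (opfun A u - z *: u) + (z - w) *: u).
  by rewrite bopD Rz// bopZ addrAC subrr add0r.
by rewrite scalerBl addrA subrK.
Qed.

Lemma perturb_self_adjoint A (V : bop H H) : self_adjoint A -> adjoint V = V ->
  self_adjoint (perturb A V).
Proof.
move=> [A0 Al Ad Aa] sV.
have dV u w : dot (V u) w = dot u (V w) by rewrite -{1}sV adjP.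
split=> //=.
  move=> a x y Dx Dy; have [? ->] := Al a x y Dx Dy; split=> //.
  by rewrite bop_linear scalerDr addrACA.
move=> x z; split=> [h|[Dx <-] y Dy].
  have /Aa[Dx E] : forall y, opdom A y -> dot (z - V x) y = dot x (opfun A y).
    move=> y Dy; by rewrite dotBl h// dotDr dV addrK.
  by split=> //; rewrite E subrK.
rewrite dotDl dotDr dV; congr (_ + _).
by have [_ h] := Aa x (opfun A x); apply: h.
Qed.

Lemma resolvent_perturb A (V : bop H H) z : self_adjoint A -> adjoint V = V ->
  complex.Im z != 0 ->
  resolvent (perturb A V) z = resolvent A z - resolvent (perturb A V) z \c V \c resolvent A z /\
  resolvent (perturb A V) z = resolvent A z - resolvent A z \c V \c resolvent (perturb A V) z.
Proof.
move=> sA sV z0; have sA' := perturb_self_adjoint sA sV.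
have [R1 R2] := resolventP sA z0; have [R1' R2'] := resolventP sA' z0.
split; apply: bopP => f; rewrite !bopE.
  have [Du E] := R1 f; set u := resolvent A z f in Du E *.
  rewrite -{1}E (_ : _ - z *: u = (opfun (perturb A V) u - z *: u) - V u).
    by rewrite bopB R2'.
  by rewrite /= addrAC addrK.
have [Du E] := R1' f; set u := resolvent (perturb A V) z f in Du E *.
rewrite -{1}E (_ : _ - z *: u = (opfun A u - z *: u) + V u).
  by rewrite bopD R2// addrK.
by rewrite /= addrAC.
Qed.

Lemma imag_part_resolvent A z : self_adjoint A -> complex.Im z != 0 ->
  imag_part (resolvent A z) = (complex.Im z)%:C *: (resolvent A z^*%C \c resolvent A z) /\
  imag_part (resolvent A z) = (complex.Im z)%:C *: (resolvent A z \c resolvent A z^*%C).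
Proof.
move=> sA z0; rewrite /imag_part resolvent_adj//.
have E : z - z^*%C = 2 * 'i%C * (complex.Im z)%:C by rewrite subcJ mulrAC.
have i2 : 2 * 'i%C != 0 :> R[i].
  by rewrite mulf_neq0// ?pnatr_eq0// eq_complex /= oner_eq0 andbF.
split; last first.
  by rewrite resolvent_identity ?conj_im// E scalerA mulrA mulVf// mul1r.
rewrite -opprB resolvent_identity ?conj_im// -scaleNr opprB E scalerA mulrA.
by rewrite mulVf// mul1r.
Qed.

End Resolvent.

(** * Boundary values *)

Section Limits.
Context {R : realType}.
Implicit Types H K L : hilbertType R.

Definition cvgN H K (T : R -> bop H K) (A : bop H K) : Prop :=
  forall e : R, 0 < e -> \forall y \near (0 : R)^'+, bn (T y - A) <= e.

Definition cvgT H K (T : R -> bop H K) (A : bop H K) : Prop :=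
  forall e : R, 0 < e -> \forall y \near (0 : R)^'+, (trace_norm (T y - A)%R <= e%:E)%E.

Lemma converges0_op H K (T : R -> bop H K) A :
  converges0 (@opnorm R H K) T A <-> cvgN T A.
Proof.
split=> [[_ /(ecvg0P _ (fun y => opnorm_ge0 _)) h] e /h|h].
  by apply: filterS => y; rewrite opnormE lee_fin.
split; first by rewrite opnormE ltry.
apply/(ecvg0P _ (fun y => opnorm_ge0 _)) => e /h.
by apply: filterS => y; rewrite opnormE lee_fin.
Qed.

Lemma converges0_trace H K (T : R -> bop H K) A :
  converges0 (@trace_norm R H K) T A <-> (trace_norm A < +oo)%E /\ cvgT T A.
Proof. by split=> -[h1 /(ecvg0P _ (fun y => trace_norm_ge0 _)) h2]. Qed.

Lemma near_pos (P : R -> Prop) : (forall y, 0 < y -> P y) ->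
  \forall y \near (0 : R)^'+, P y.
Proof. by move=> h; apply: filterS (nbhs_right_gt 0) => y; exact: h. Qed.

Lemma cvgN_unique H K (T : R -> bop H K) A B : cvgN T A -> cvgN T B -> A = B.
Proof.
move=> hA hB; apply/eqP; rewrite -subr_eq0; apply/eqP/bn_eq0/le_anti.
rewrite bn_ge0 andbT; apply: le_eps => e e0; rewrite add0r.
have e2 : 0 < e / 2 by rewrite divr_gt0.
have AB := filterI (hA _ e2) (hB _ e2).
have [y [Ay By]] := @filter_ex _ _ (at_right_proper_filter (0 : R)) _ (AB _).
rewrite -(subrKA (T y)) (le_trans (bnD _ _))// [leRHS]splitr lerD//.
by rewrite bn_dist.
Qed.

Lemma cvgT_cvgN H K (T : R -> bop H K) A : cvgT T A -> cvgN T A.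
Proof. by move=> h e /h; apply: filterS => y; exact: bn_trace_norm. Qed.

Lemma limit0_op H K (T : R -> bop H K) A : cvgN T A ->
  limit0 (@opnorm R H K) T = A.
Proof.
move=> h; apply: (@cvgN_unique _ _ T) => //; apply/converges0_op.
by apply: (xgetPex _ (ex_intro _ A _)); apply/converges0_op.
Qed.

Lemma limit0_trace H K (T : R -> bop H K) A : (trace_norm A < +oo)%E -> cvgT T A ->
  limit0 (@trace_norm R H K) T = A.
Proof.
move=> fA h; apply: (@cvgN_unique _ _ T); last exact: cvgT_cvgN.
have [] // : converges0 (@trace_norm R H K) T (limit0 (@trace_norm R H K) T).
  by apply: (xgetPex _ (ex_intro _ A _)); apply/converges0_trace.
move=> f2 h2; apply: cvgT_cvgN.
by have /converges0_trace[] := conj f2 h2.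
Qed.

Lemma cvgN_ext H K (T S : R -> bop H K) A : (forall y, 0 < y -> T y = S y) ->
  cvgN T A -> cvgN S A.
Proof. by move=> TS h e /h; apply: filterS2 (near_pos TS) => y ->. Qed.

Lemma cvgT_ext H K (T S : R -> bop H K) A : (forall y, 0 < y -> T y = S y) ->
  cvgT T A -> cvgT S A.
Proof. by move=> TS h e /h; apply: filterS2 (near_pos TS) => y ->. Qed.

Lemma cvgN_cst H K (A : bop H K) : cvgN (fun=> A) A.
Proof. by move=> e e0; apply: nearW => y; rewrite subrr bn0 ltW. Qed.

Lemma cvgND H K (T S : R -> bop H K) A B : cvgN T A -> cvgN S B ->
  cvgN (fun y => T y + S y) (A + B).
Proof.
move=> hA hB e e0; have e2 : 0 < e / 2 by rewrite divr_gt0.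
apply: filterS2 (hA _ e2) (hB _ e2) => y h1 h2.
by rewrite opprD addrACA (le_trans (bnD _ _))// [leRHS]splitr lerD.
Qed.

Lemma cvgNZ H K (T : R -> bop H K) A c : cvgN T A ->
  cvgN (fun y => c *: T y) (c *: A).
Proof.
move=> h e e0; have c0 : 0 < nm c + 1 by rewrite ltr_wpDl ?nm_ge0.
apply: filterS (h _ (divr_gt0 e0 c0)) => y; rewrite ler_pdivlMr// => h'.
rewrite -scalerBr bnZ mulrC (le_trans _ h')// ler_wpM2l ?bn_ge0// lerDl//.
Qed.

Lemma cvgN_adj H K (T : R -> bop H K) A : cvgN T A ->
  cvgN (fun y => adjoint (T y)) (adjoint A).
Proof. by move=> h e /h; apply: filterS => y; rewrite -adjN -adjD bn_adj. Qed.

Lemma cvgN_bounded H K (T : R -> bop H K) A : cvgN T A ->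
  \forall y \near (0 : R)^'+, bn (T y) <= bn A + 1.
Proof.
move=> /(_ 1 ltr01); apply: filterS => y h.
by rewrite -(subrK A (T y)) (le_trans (bnD _ _))// addrC lerD2l.
Qed.

Lemma cvgN_comp H K L (T : R -> bop K L) (S : R -> bop H K) A B :
  cvgN T A -> cvgN S B -> cvgN (fun y => T y \c S y) (A \c B).
Proof.
move=> hA hB e e0.
have b0 : 0 < bn B + 1 by rewrite ltr_wpDl ?bn_ge0.
have a0 : 0 < bn A + 1 by rewrite ltr_wpDl ?bn_ge0.
have e2 : 0 < e / 2 by rewrite divr_gt0.
apply: filterS3 (hA _ (divr_gt0 e2 b0)) (hB _ (divr_gt0 e2 a0)) (cvgN_bounded hA).
move=> y; rewrite ler_pdivlMr// => h1; rewrite ler_pdivlMr// => h2 h3.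
have -> : T y \c S y - A \c B = T y \c (S y - B) + (T y - A) \c B.
  by rewrite compBr compBl addrA subrK.
rewrite (le_trans (bnD _ _))// [leRHS]splitr lerD// (le_trans (bn_comp _ _))//.
  by rewrite (le_trans _ h2)// mulrC ler_wpM2l ?bn_ge0.
by rewrite (le_trans _ h1)// ler_wpM2l ?bn_ge0// lerDl.
Qed.

Lemma cvgT_compl H K L (C : R -> bop K L) (T : R -> bop H K) D A :
  cvgN C D -> (trace_norm A < +oo)%E -> cvgT T A -> cvgT (fun y => C y \c T y) (D \c A).
Proof.
move=> hC /trace_norm_fin[a [Ea a0]] hT e e0.
have d0 : 0 < bn D + 1 by rewrite ltr_wpDl ?bn_ge0.
have a1 : 0 < a + 1 by rewrite ltr_wpDl.
have e2 : 0 < e / 2 by rewrite divr_gt0.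
apply: filterS3 (hC _ (divr_gt0 e2 a1)) (hT _ (divr_gt0 e2 d0)) (cvgN_bounded hC).
move=> y h1 h2 h3.
have -> : C y \c T y - D \c A =
    C y \c (T y - A) \c bop_id H + (C y - D) \c A \c bop_id H.
  by rewrite !comp1r compBr compBl addrA subrK.
apply: le_trans (trace_normD _ _) _; rewrite (splitr e) EFinD leeD//.
  apply: le_trans (trace_norm_comp d0 ltr01 h3 (bn_id H) h2) _.
  by rewrite lee_fin mulr1 mulrC divfK// gt_eqF.
have aA : (trace_norm A <= (a + 1)%:E)%E by rewrite Ea lee_fin lerDl.
apply: le_trans (trace_norm_comp (divr_gt0 e2 a1) ltr01 h1 (bn_id H) aA) _.
by rewrite lee_fin mulr1 divfK// gt_eqF.
Qed.

Lemma cvgT_compr H K L (C : R -> bop L H) (T : R -> bop H K) D A :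
  cvgN C D -> (trace_norm A < +oo)%E -> cvgT T A -> cvgT (fun y => T y \c C y) (A \c D).
Proof.
move=> hC /trace_norm_fin[a [Ea a0]] hT e e0.
have d0 : 0 < bn D + 1 by rewrite ltr_wpDl ?bn_ge0.
have a1 : 0 < a + 1 by rewrite ltr_wpDl.
have e2 : 0 < e / 2 by rewrite divr_gt0.
apply: filterS3 (hC _ (divr_gt0 e2 a1)) (hT _ (divr_gt0 e2 d0)) (cvgN_bounded hC).
move=> y h1 h2 h3.
have -> : T y \c C y - A \c D =
    bop_id K \c (T y - A) \c C y + bop_id K \c A \c (C y - D).
  by rewrite !comp1l compBr compBl addrA subrK.
apply: le_trans (trace_normD _ _) _; rewrite (splitr e) EFinD leeD//.
  apply: le_trans (trace_norm_comp ltr01 d0 (bn_id K) h3 h2) _.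
  by rewrite lee_fin mul1r mulrC divfK// gt_eqF.
have aA : (trace_norm A <= (a + 1)%:E)%E by rewrite Ea lee_fin lerDl.
apply: le_trans (trace_norm_comp ltr01 (divr_gt0 e2 a1) (bn_id K) h1 aA) _.
by rewrite lee_fin mul1r divfK// gt_eqF.
Qed.

Lemma trace_norm_comp_fin H' H K K' (X : bop K K') (T : bop H K) (Y : bop H' H) :
  (trace_norm T < +oo)%E -> (trace_norm (X \c T \c Y) < +oo)%E.
Proof.
move=> /trace_norm_fin[t [Et _]].
have x0 : 0 < bn X + 1 by rewrite ltr_wpDl ?bn_ge0.
have y0 : 0 < bn Y + 1 by rewrite ltr_wpDl ?bn_ge0.
have Tt : (trace_norm T <= t%:E)%E by rewrite Et.
apply: le_lt_trans (trace_norm_comp x0 y0 _ _ Tt) (ltry _); by rewrite lerDl.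
Qed.

Lemma trace_norm_compl_fin H K L (X : bop K L) (T : bop H K) :
  (trace_norm T < +oo)%E -> (trace_norm (X \c T) < +oo)%E.
Proof. by move=> /(trace_norm_comp_fin X (bop_id H)); rewrite comp1r. Qed.

Lemma cvgN_inv H (T : R -> bop H H) A : cvgN T A -> invertible_op A ->
  cvgN (fun y => inv_op (T y)) (inv_op A) /\
  \forall y \near (0 : R)^'+, invertible_op (T y).
Proof.
move=> hT iA; pose b := bn (inv_op A) + 1.
have b0 : 0 < b by rewrite ltr_wpDl ?bn_ge0.
have Ab : bn (inv_op A) <= b by rewrite lerDl.
have e1 : 0 < 2^-1 / b by rewrite divr_gt0// invr_gt0.
have near_inv : \forall y \near (0 : R)^'+,
    invertible_op (T y) /\ bn (inv_op (T y)) <= 2 * b.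
  apply: filterS (hT _ e1) => y; rewrite ler_pdivlMr// => h.
  by rewrite -(subrK A (T y)) [_ + A]addrC; exact: invertible_perturb.
split; last by apply: filterS near_inv => y [].
move=> e e0; have e2 : 0 < e / (2 * b * b) by rewrite divr_gt0// !mulr_gt0.
apply: filterS2 near_inv (hT _ e2) => y [iT Tb].
rewrite ler_pdivlMr ?mulr_gt0// => h.
have -> : inv_op (T y) - inv_op A = inv_op (T y) \c (A - T y) \c inv_op A.
  by rewrite compBr compBl (inv_opP iT).2 -compA (inv_opP iA).1 comp1r comp1l.
rewrite (le_trans (bn_comp _ _))//.
have h1 : bn (inv_op (T y) \c (A - T y)) <= 2 * b * bn (T y - A).
  by rewrite (le_trans (bn_comp _ _))// bn_dist ler_wpM2r ?bn_ge0.
apply: le_trans (ler_pM (bn_ge0 _) (bn_ge0 _) h1 Ab) _.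
by rewrite [leLHS](_ : _ = bn (T y - A) * (2 * b * b)); last by ring.
Qed.

End Limits.

Section SandwichedResolvent.
Context {R : realType}.
Variables (H K : hilbertType R) (F : frame H K).

Lemma sandwich_imag (X : bop H H) : sandwich F (imag_part X) = imag_part (sandwich F X).
Proof.
rewrite /sandwich /imag_part compZl compZr; congr (_ *: _).
by rewrite compBl compBr !adj_comp adjK -[F \c adjoint X \c _]compA.
Qed.

Variables (A : unbounded_op H) (lambda : R).
Hypothesis sA : self_adjoint A.
Local Notation T y := (sandwich F (resolvent A (lambda +i* y))).

Lemma im_neq0 y : 0 < y -> complex.Im (lambda +i* y) != 0.
Proof. by move=> y0; rewrite /= gt_eqF. Qed.

Lemma sandwich_adj y : y != 0 -> adjoint (T y) = T (- y).
Proof.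
by move=> y0; rewrite /sandwich !adj_comp adjK resolvent_adj// -compA.
Qed.

Lemma cvgN_imag (S : R -> bop K K) B : cvgN S B ->
  cvgN (fun y => imag_part (S y)) (imag_part B).
Proof.
move=> h; apply: cvgNZ; apply: cvgND => //.
rewrite -scaleN1r; apply: (@cvgN_ext _ _ _ (fun y => -1 *: adjoint (S y))).
  by move=> y _; rewrite scaleN1r.
by apply: cvgNZ; exact: cvgN_adj.
Qed.

(** The trace-norm limit in [Lambda] is an unnamed witness. It is also an operator-norm limit, hence
    equals the imaginary part of the boundary value. *)
Lemma LambdaP : Lambda F A lambda ->
  [/\ cvgN (fun y => T y) (sandwich_limit F A lambda),
      (trace_norm (imag_part (sandwich_limit F A lambda)) < +oo)%E &
      cvgT (fun y => sandwich F (imag_part (resolvent A (lambda +i* y))))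
        (imag_part (sandwich_limit F A lambda))].
Proof.
move=> [[B /converges0_op hB] [C /converges0_trace[fC hC]]].
have -> : sandwich_limit F A lambda = B by exact: limit0_op.
have -> : imag_part B = C.
  apply: cvgN_unique (cvgN_imag hB) _; apply: cvgN_ext (cvgT_cvgN hC) => y _.
  by rewrite sandwich_imag.
by [].
Qed.

Lemma in_Lambda B : cvgN (fun y => T y) B -> (trace_norm (imag_part B) < +oo)%E ->
  cvgT (fun y => sandwich F (imag_part (resolvent A (lambda +i* y)))) (imag_part B) ->
  Lambda F A lambda /\ sandwich_limit F A lambda = B.
Proof.
move=> hB fB hT; split; last exact: limit0_op.
split; first by exists B; apply/converges0_op.
by exists (imag_part B); apply/converges0_trace.
Qed.

End SandwichedResolvent.

(** * The coupled resolvent *)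

Section Stationary.
Context {R : realType}.
Variables (K : hilbertType R) (J T : bop K K).
Hypothesis sJ : adjoint J = J.

(** [wop] and [wop_adj] are Y and Z of the overview. T is arbitrary here, as the identities are used
    at height y > 0 as well as at the boundary. *)
Definition wop : bop K K := inv_op (bop_id K + J \c T).
Definition wop_adj : bop K K := inv_op (bop_id K + J \c adjoint T).

Hypothesis iJT : invertible_op (bop_id K + J \c T).

Lemma wopP : (bop_id K + J \c T) \c wop = bop_id K /\
  wop \c (bop_id K + J \c T) = bop_id K /\
  adjoint wop \c (bop_id K + adjoint T \c J) = bop_id K /\
  (bop_id K + adjoint T \c J) \c adjoint wop = bop_id K.
Proof.
have [h1 h2] := inv_opP iJT; rewrite -/wop in h1 h2.
have E : adjoint (bop_id K + J \c T) = bop_id K + adjoint T \c J.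
  by rewrite adjD adj_id adj_comp sJ.
by rewrite -E -!adj_comp h1 h2 adj_id.
Qed.

(** 1 + T^* J is the adjoint of 1 + J T; (1 + X Y)^-1 = 1 - X (1 + Y X)^-1 Y then exchanges the
    order of the factors. *)
Lemma invertible_adj_wop : invertible_op (bop_id K + J \c adjoint T).
Proof.
have [_ [_ [h1 h2]]] := wopP.
exists (bop_id K - J \c adjoint wop \c adjoint T); split.
  rewrite compDl comp1l compBr comp1r -addrA -[RHS]addr0; congr (_ + _).
  rewrite addrC -addrA -opprD.
  have -> : J \c adjoint T \c (J \c adjoint wop \c adjoint T) + J \c adjoint wop \c adjoint T =
    J \c ((bop_id K + adjoint T \c J) \c adjoint wop) \c adjoint T.
    by rewrite compDl comp1l compDr compDl addrC !compA.
  by rewrite h2 comp1r subrr.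
rewrite compDr comp1r compBl comp1l -addrA -[RHS]addr0; congr (_ + _).
rewrite addrC -addrA -opprD.
have -> : J \c adjoint wop \c adjoint T \c (J \c adjoint T) + J \c adjoint wop \c adjoint T =
    J \c (adjoint wop \c (bop_id K + adjoint T \c J)) \c adjoint T.
  by rewrite compDr comp1r compDr compDl addrC !compA.
by rewrite h1 comp1r subrr.
Qed.

Lemma wop_adjP : (bop_id K + J \c adjoint T) \c wop_adj = bop_id K /\
  wop_adj \c (bop_id K + J \c adjoint T) = bop_id K /\
  adjoint wop_adj \c (bop_id K + T \c J) = bop_id K.
Proof.
have [h1 h2] := inv_opP invertible_adj_wop; rewrite -/wop_adj in h1 h2.
have E : adjoint (bop_id K + J \c adjoint T) = bop_id K + T \c J.
  by rewrite adjD adj_id adj_comp sJ adjK.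
by rewrite -E -adj_comp h1 adj_id h2.
Qed.

(** The adjoint of [wop_adj] inverts 1 + T J, and (1 + T J) T = T (1 + J T). *)
Lemma wop_exchange : T \c wop = adjoint wop_adj \c T.
Proof.
have [h1 [_ _]] := wopP; have [_ [_ h2]] := wop_adjP.
rewrite -[LHS]comp1l -h2 -!compA; congr (_ \c _).
rewrite compA compDl comp1l -compA -[J \c T]add0r.
have -> : T + T \c (0 + J \c T) = T \c (bop_id K + J \c T).
  by rewrite add0r compDr comp1r.
by rewrite -compA h1 comp1r.
Qed.

(** T Y = Y^* (T + T^* J T) Y and Y^* T^* = Y^* (T^* + T^* J T) Y, so the middle terms cancel in the
    difference. For Z the same is done starting from T Y = Z^* T, with T J T^* as the common
    term. *)
Lemma imag_wop :
  imag_part (T \c wop) = adjoint wop \c imag_part T \c wop /\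
  imag_part (T \c wop) = adjoint wop_adj \c imag_part T \c wop_adj.
Proof.
have [h1 [_ [h3 _]]] := wopP; have [g1 [_ g3]] := wop_adjP.
rewrite /imag_part; split.
  have e1 : T \c wop = adjoint wop \c (T + adjoint T \c J \c T) \c wop.
    by rewrite -[LHS]comp1l -h3 !compDr comp1r !compDl !compA.
  have e2 : adjoint wop \c adjoint T =
      adjoint wop \c (adjoint T + adjoint T \c J \c T) \c wop.
    by rewrite -[LHS]comp1r -h1 compDl comp1l !compDr compDl !compA.
  rewrite compZr compZl; congr (_ *: _); rewrite adj_comp {1}e1 e2.
  by rewrite -compBl -compBr opprD addrACA subrr addr0.
have e1 : adjoint wop_adj \c T =
    adjoint wop_adj \c (T + T \c J \c adjoint T) \c wop_adj.
  by rewrite -[LHS]comp1r -g1 compDl comp1l !compDr compDl !compA.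
have e2 : adjoint T \c wop_adj =
    adjoint wop_adj \c (adjoint T + T \c J \c adjoint T) \c wop_adj.
  by rewrite -[LHS]comp1l -g3 !compDr comp1r !compDl !compA.
rewrite compZr compZl wop_exchange; congr (_ *: _); rewrite adj_comp adjK {1}e1 e2.
by rewrite -compBl -compBr opprD addrACA subrr addr0.
Qed.

(** These are the limits of the factors 1 - T'(z) J that the resolvent identity produces, on the two
    sides of the real axis. *)
Lemma one_sub_wop : bop_id K - adjoint (T \c wop) \c J = adjoint wop /\
  bop_id K - T \c wop \c J = adjoint wop_adj.
Proof.
have [_ [_ [h3 _]]] := wopP; have [_ [_ g3]] := wop_adjP; split.
  by rewrite -h3 adj_comp compDr comp1r compA addrK.
by rewrite wop_exchange -g3 compDr comp1r compA addrK.
Qed.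

End Stationary.

(** * Boundary values for the perturbed operator *)

Section Perturbed.
Context {R : realType}.
Variables (H K : hilbertType R) (F : frame H K) (A : unbounded_op H) (lambda : R).
Variable J : bop K K.
Hypotheses (sA : self_adjoint A) (sJ : adjoint J = J).

Definition pert : unbounded_op H := perturb A (adjoint F \c (J \c F)).

Lemma pert_sym : adjoint (adjoint F \c (J \c F)) = adjoint F \c (J \c F).
Proof. by rewrite !adj_comp adjK sJ -compA. Qed.

Lemma pert_sa : self_adjoint pert.
Proof. exact: perturb_self_adjoint pert_sym. Qed.

Local Notation T z := (sandwich F (resolvent A z)).
Local Notation T' z := (sandwich F (resolvent pert z)).

Lemma sandwich_pert z : complex.Im z != 0 ->
  T' z = T z - T' z \c J \c T z /\ T' z = T z - T z \c J \c T' z.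
Proof.
move=> z0; have [h1 h2] := resolvent_perturb sA pert_sym z0.
rewrite -/pert in h1 h2; split.
  by rewrite {1}h1 /sandwich compBl compBr !compA.
by rewrite {1}h2 /sandwich compBl compBr !compA.
Qed.

(** Off the real axis the inverse is explicit, 1 - J T'(z); the two forms of the resolvent identity
    give the two sides. *)
Lemma wop_regular z : complex.Im z != 0 ->
  invertible_op (bop_id K + J \c T z) /\ T' z = T z \c wop J (T z).
Proof.
move=> z0; have [h1 h2] := sandwich_pert z0.
have e1 : (bop_id K + J \c T z) \c (bop_id K - J \c T' z) = bop_id K.
  rewrite compDl comp1l compBr comp1r -addrA -[RHS]addr0; congr (_ + _).
  have -> : J \c T z \c (J \c T' z) = J \c (T z \c J \c T' z) by rewrite !compA.
  by rewrite -compBr -h2 addNr.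
have e2 : (bop_id K - J \c T' z) \c (bop_id K + J \c T z) = bop_id K.
  rewrite compBl comp1l compDr comp1r -addrA -[RHS]addr0; congr (_ + _).
  have -> : J \c T' z \c (J \c T z) = J \c (T' z \c J \c T z) by rewrite !compA.
  have e : T' z + T' z \c J \c T z = T z by rewrite {1}h1 subrK.
  by rewrite -compDr e subrr.
split; first by eexists; split; [exact: e1|exact: e2].
by rewrite /wop (inv_op_eq e1 e2) compBr comp1r compA.
Qed.

Hypothesis hL : Lambda F A lambda.
Let T0 := sandwich_limit F A lambda.
Hypothesis iJT : invertible_op (bop_id K + J \c T0).

Lemma cvg_wop : cvgN (fun y => wop J (T (lambda +i* y))) (wop J T0) /\
  cvgN (fun y => T' (lambda +i* y)) (T0 \c wop J T0).
Proof.
have [hT _ _] := LambdaP hL.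
have hP : cvgN (fun y => bop_id K + J \c T (lambda +i* y)) (bop_id K + J \c T0).
  apply: cvgND; first exact: cvgN_cst.
  by apply: cvgN_comp hT; exact: cvgN_cst.
have [hW _] := cvgN_inv hP iJT.
split=> //.
apply: (@cvgN_ext _ _ _ (fun y => T (lambda +i* y) \c wop J (T (lambda +i* y)))).
  by move=> y y0; rewrite (wop_regular (im_neq0 lambda y0)).2.
exact: cvgN_comp.
Qed.

(** Already at height y the imaginary part for the perturbed operator is Y^* (F Im R F^* ) Y.
    Trace-norm convergence of the middle factor and norm convergence of the outer ones give the
    limit. *)
Lemma Lambda_pert : Lambda F pert lambda /\
  sandwich_limit F pert lambda = T0 \c wop J T0.
Proof.
have [hT fT cT] := LambdaP hL; have [hW hT'] := cvg_wop.
have E := (imag_wop sJ iJT).1.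
apply: in_Lambda => //.
  by rewrite E; exact: trace_norm_comp_fin.
rewrite E; apply: (@cvgT_ext _ _ _ (fun y => adjoint (wop J (T (lambda +i* y))) \c
    sandwich F (imag_part (resolvent A (lambda +i* y))) \c wop J (T (lambda +i* y)))).
  move=> y y0; have [iy E'] := wop_regular (im_neq0 lambda y0).
  by rewrite !sandwich_imag E' (imag_wop sJ iy).1.
apply: cvgT_compr => //; first exact: trace_norm_compl_fin.
by apply: cvgT_compl => //; exact: cvgN_adj.
Qed.

(** The product of resolvents equals pi^-1 (1 - T' J) F Im R F^*, with T' taken on the side of the
    real axis opposite to that of R; only the last factor needs trace-norm convergence. *)
Lemma amat_limit s :
  cvgT (fun y => (y / pi)%:C *: (F \c (resolvent pert (lambda +i* signed (~~ s) y) \c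
      resolvent A (lambda +i* signed s y) \c adjoint F)))
    ((pi^-1)%:C *: (adjoint (if s then wop J T0 else wop_adj J T0) \c imag_part T0)) /\
  (trace_norm ((pi^-1)%:C *: (adjoint (if s then wop J T0 else wop_adj J T0) \c imag_part T0)) < +oo)%E.
Proof.
have [hT fT cT] := LambdaP hL; have [hW hT'] := cvg_wop.
split; last by rewrite -compZl; exact: trace_norm_compl_fin.
have [o1 o2] := one_sub_wop sJ iJT.
pose D y := (pi^-1)%:C *: (bop_id K - T' (lambda +i* signed (~~ s) y) \c J).
apply: (@cvgT_ext _ _ _ (fun y => D y \c sandwich F (imag_part (resolvent A (lambda +i* y))))).
  move=> y y0; have z0 := im_neq0 lambda y0.
  have w0 : complex.Im (lambda +i* signed (~~ s) y) != 0.
    by case: (s); rewrite /= ?oppr_eq0 gt_eqF.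
  have -> : imag_part (resolvent A (lambda +i* y)) = y%:C *:
      (resolvent A (lambda +i* signed (~~ s) y) \c resolvent A (lambda +i* signed s y)).
    by have [i1 i2] := imag_part_resolvent sA z0; case: (s); [exact: i1|exact: i2].
  have [-> _] := resolvent_perturb sA pert_sym w0; rewrite -/pert.
  rewrite /D /sandwich !(compZl, compZr) scalerA -rmorphM/= [pi^-1 * y]mulrC.
  congr (_ *: _); rewrite !compBl !compBr comp1l !compA; congr (_ - _).
rewrite -compZl; apply: cvgT_compl => //; apply: cvgNZ.
have -> : adjoint (if s then wop J T0 else wop_adj J T0) = bop_id K -
    (if s then adjoint (T0 \c wop J T0) else T0 \c wop J T0) \c J.
  by case: (s).
apply: cvgND; first exact: cvgN_cst.
rewrite -scaleN1r; apply: (@cvgN_ext _ _ _ (fun y => -1 *: (T' (lambda +i* signed (~~ s) y) \c J))).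
  by move=> y _; rewrite scaleN1r.
apply: cvgNZ; apply: cvgN_comp; last exact: cvgN_cst.
case: (s) => //=; apply: cvgN_ext (cvgN_adj hT') => y y0.
by rewrite sandwich_adj ?gt_eqF//; exact: pert_sa.
Qed.

End Perturbed.

(** * Unitary operators between bases *)

Section BasisSequences.
Context {R : realType}.
Implicit Types H K L : hilbertType R.

Lemma bseq_inj H (e : nat -> H) : (forall i j, dot (e i) (e j) = (i == j)%:R) ->
  injective e.
Proof.
move=> oe i j eij; apply/eqP; apply: contraT => ij.
have := oe i j; rewrite (negPf ij) eij oe eqxx => /eqP; rewrite oner_eq0 //.
Qed.

Lemma bseq_basis H (e : nat -> H) : orthonormal_basis_seq e ->
  orthonormal_basis (range e).
Proof.
move=> [oe de]; split=> // _ _ [i _ <-] [j _ <-].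
by rewrite oe (inj_eq (bseq_inj oe)).
Qed.

Lemma bseq_orth H (e : nat -> H) v : orthonormal_basis_seq e ->
  (forall i, dot (e i) v = 0) -> v = 0.
Proof.
move=> [_ de] h; apply: (dense_orth de) => _ [n [a [f [Bf ->]]]].
rewrite dot_suml big1// => i _; rewrite dotZl.
by have [k _ <-] := Bf i; rewrite h mulr0.
Qed.

Lemma bseq_dense H (e : nat -> H) : (forall v, (forall i, dot (e i) v = 0) -> v = 0) ->
  closure (linear_span (range e)) = setT.
Proof.
move=> h; apply: dense_of_orth; first exact: linear_span_is_subspace.
by move=> v hv; apply: h => i; apply: hv; apply: linear_span_mem; exists i.
Qed.

Lemma bseq_eq H (V : normedModType R[i]) (e : nat -> H) (A B : bop H V) :
  orthonormal_basis_seq e -> (forall i, A (e i) = B (e i)) -> A = B.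
Proof.
move=> [_ de] h; apply: (bop_dense_eq de) => _ [n [a [f [Bf ->]]]].
rewrite !bop_sum; apply: eq_bigr => i _; rewrite !bopZ.
by have [k _ <-] := Bf i; rewrite h.
Qed.

Lemma bseq_norm H K (e : nat -> H) (f : nat -> K) x y :
  orthonormal_basis_seq e -> orthonormal_basis_seq f ->
  (forall j, dot (e j) x = dot (f j) y) -> nm x = nm y.
Proof.
move=> he hf h; apply/eqP; rewrite -(@eqrXn2 _ 2) ?nm_ge0//.
apply/eqP; apply: EFin_inj.
rewrite -(parseval x (bseq_basis he)) -(parseval y (bseq_basis hf)).
rewrite !esum_image; last 2 first.
- by move=> i j _ _; exact: bseq_inj hf.1 i j.
- by move=> i j _ _; exact: bseq_inj he.1 i j.
by apply: eq_esum => j _; rewrite h.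
Qed.

(* The graph S is pairs of vectors with the same coordinates; by Parseval it   *)
(* is isometric.                                                              *)
Lemma unitary_exists H K (e : nat -> H) (f : nat -> K) :
  orthonormal_basis_seq e -> orthonormal_basis_seq f ->
  exists V : bop H K, [/\ forall j, V (e j) = f j, adjoint V \c V = bop_id H &
    V \c adjoint V = bop_id K].
Proof.
have key H' K' (e' : nat -> H') (f' : nat -> K') : orthonormal_basis_seq e' ->
    orthonormal_basis_seq f' -> exists V : bop H' K',
    forall x y, (forall j, dot (e' j) x = dot (f' j) y) -> V x = y.
  move=> he hf; pose S x y := forall j, dot (e' j) x = dot (f' j) y.
  have Sl a x y x' y' : S x y -> S x' y' -> S (a *: x + x') (a *: y + y').
    by move=> h h' j; rewrite !dotDr !dotZr h h'.
  have [|||V [_ HV]] := @bop_extend _ _ _ S 1 ler01; first exact: Sl.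
  - by move=> x y h; rewrite mul1r (bseq_norm he hf h).
  - apply: dense_of_orth.
      split=> [|a x x' [y h] [y' h']].
        by exists 0 => j; rewrite !dot0r.
      by exists (a *: y + y'); exact: Sl.
    move=> v hv; apply: (bseq_orth he) => i; apply: hv.
    by exists (f' i) => j; rewrite he.1 hf.1.
  by exists V.
move=> he hf; have [V HV] := key _ _ _ _ he hf; have [W HW] := key _ _ _ _ hf he.
have Ve j : V (e j) = f j by apply: HV => i; rewrite he.1 hf.1.
have We j : W (f j) = e j by apply: HW => i; rewrite he.1 hf.1.
have VW : adjoint V = W.
  by apply: bopP => y; apply/esym/HW => j; rewrite adjPr Ve.
have WV : adjoint W = V by rewrite -VW adjK.
exists V; split=> //; rewrite VW; apply: bopP => x.
  by apply: HW => j; rewrite -WV adjPr We.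
by apply: HV => j; rewrite -VW adjPr Ve.
Qed.

(** The partial sum is the projection on the first m vectors, so it is at least as close to x as any
    combination of them; m only has to exceed the indices of one good combination. *)
Lemma bseq_expand H (e : nat -> H) x : orthonormal_basis_seq e ->
  series (fun j => dot (e j) x *: e j) @ \oo --> x.
Proof.
move=> he; have [oe de] := he; have [oB dB] := bseq_basis he.
pose s n := [seq e j | j <- iota 0 n].
have sE n : series (fun j => dot (e j) x *: e j) n = proj_seq (s n) x.
  by rewrite /series /proj_seq big_map /= /index_iota subn0.
have us n : uniq (s n) by rewrite map_inj_uniq ?iota_uniq//; exact: bseq_inj.
have sB n z : z \in s n -> range e z by move=> /mapP[j _ ->]; exists j.
apply/cvgn_nmP => d d0; have [y [n [a [f [Bf yE]]]] xy] := (densityP _).1 dB x _ d0.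
have ex i : exists k, e k = f i by have [k _ <-] := Bf i; exists k.
have [k hk] := choice ex.
exists (\max_i (k i)).+1 => m hm; rewrite sE nm_dist.
have fs i : f i \in s m.
  rewrite -hk map_f// mem_iota add0n /= (leq_trans _ hm)// ltnS.
  exact: leq_bigmax.
have py := proj_seq_span oB (us m) (sB m) fs yE.
apply: le_lt_trans xy.
have := bessel_eq oB (x - y) (us m) (sB m); rewrite proj_seqB py.
rewrite opprB addrA subrK => E.
have : 0 <= \sum_(e <- s m) nm (dot e (x - y)) ^+ 2.
  by apply: sumr_ge0 => z _; exact: sqr_ge0.
by rewrite E subr_ge0 ler_pXn2r ?nnegrE ?nm_ge0.
Qed.

(** A rigging prescribes norms only; this polarisation recovers inner products from them. *)
Lemma dot_polar H K (x y : H) (x' y' : K) : nm x = nm x' -> nm y = nm y' ->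
  nm (x + y) = nm (x' + y') -> nm (x + 'i%C *: y) = nm (x' + 'i%C *: y') ->
  dot x y = dot x' y'.
Proof.
move=> hx hy h1 h2.
have := nm_sqrD x y; rewrite h1 nm_sqrD hx hy => /addrI/eqP; rewrite eqrMn2r /= => /eqP e1.
have := nm_sqrD x ('i%C *: y); rewrite h2 nm_sqrD hx !nmZ hy => /addrI/eqP.
rewrite eqrMn2r /= !dotZr => /eqP; move: e1.
case: (dot x y) => a b; case: (dot x' y') => c d /= <-.
by rewrite !mul0r !mul1r !sub0r => /oppr_inj <-.
Qed.

Lemma series_single H (f : nat -> H) j : (forall i, i != j -> f i = 0) ->
  series f @ \oo --> f j.
Proof.
move=> h; apply/cvgn_nmP => e e0; exists j.+1 => n jn.
rewrite /series/= (bigD1_seq j) ?iota_uniq ?mem_index_iota//= big1 ?addr0 ?subrr ?nm0//.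
Qed.

End BasisSequences.

Section Ell2.
Context {R : realType}.

Lemma limn_series_single (f : nat -> R) j : (forall i, i != j -> f i = 0) ->
  limn (series f) = f j.
Proof.
move=> h; apply: cvg_lim => //; apply: cvg_near_cst; exists j.+1 => // n /= jn.
by rewrite /series/= (bigD1_seq j) ?iota_uniq ?mem_index_iota//= big1 ?addr0.
Qed.

Lemma dot_delta (x : ell2 R) i : dot (ell2_delta i) x = x i.
Proof.
have -> : dot (ell2_delta i) x = csum (fun k => (k == i)%:R^*%C * x k) by [].
rewrite /csum !(limn_series_single (j := i)).
- by rewrite eqxx conjc1 mul1r; case: (x i).
- by move=> k /negPf ->; rewrite conjc0 mul0r.
- by move=> k /negPf ->; rewrite conjc0 mul0r.
Qed.

Lemma delta_basis : orthonormal_basis_seq (@ell2_delta R).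
Proof.
split=> [i j|]; first by rewrite dot_delta.
apply: bseq_dense => v h; apply/val_inj/funext => i.
by rewrite -[LHS]dot_delta h.
Qed.

End Ell2.

(** * Rigging and evaluation operator *)

Lemma bop_series (R : realType) (U V : normedModType R[i]) (B : bop U V)
    (c : nat -> R[i]) (e : nat -> U) x :
  series (fun j => c j *: e j) @ \oo --> x ->
  series (fun j => c j *: B (e j)) @ \oo --> B x.
Proof.
move=> /cvgn_nmP h; have [b b0 hb] := bop_bounded B.
apply/cvgn_nmP => d d0; have b1 : 0 < b + 1 by rewrite ltr_wpDl.
have [N HN] := h _ (divr_gt0 d0 b1); exists N => n Nn.
have -> : series (fun j => c j *: B (e j)) n = B (series (fun j => c j *: e j) n).
  by rewrite /series /= bop_sum; apply: eq_bigr => j _; rewrite bopZ.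
rewrite -bopB (le_lt_trans (hb _))//.
apply: (@le_lt_trans _ _ ((b + 1) * nm (series (fun j => c j *: e j) n - x))).
  by rewrite ler_wpM2r ?nm_ge0// lerDl.
by rewrite mulrC -ltr_pdivlMr// HN.
Qed.

Lemma xget_unique (T : choiceType) (x0 p : T) (S : set T) :
  (forall x, S x <-> x = p) -> xget x0 S = p.
Proof. by move=> h; apply/h; apply: (xgetPex _ (ex_intro _ p _)); apply/h. Qed.

Section FrameFacts.
Context {R : realType}.
Variables (H K : hilbertType R) (F : frame H K).

Lemma kappa_neq0 j : (kappa F j)%:C != 0 :> R[i].
Proof. by rewrite -nm_gt0 nm_real normr_gt0 gt_eqF// kappa_gt0. Qed.

Lemma frame_phi j : F (phi F j) = (kappa F j)%:C *: psi F j.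
Proof.
have [op _] := phi_basis F.
have h1 := @frame_opE _ _ _ F (phi F j).
have h2 : series (fun i => ((kappa F i)%:C * dot (phi F i) (phi F j)) *: psi F i) @ \oo -->
    (kappa F j)%:C *: psi F j.
  rewrite [X in _ --> X](_ : _ = ((kappa F j)%:C * dot (phi F j) (phi F j)) *: psi F j).
    apply: (@series_single _ _ (fun i => ((kappa F i)%:C * dot (phi F i) (phi F j)) *: psi F i)).
    by move=> i ij; rewrite op (negPf ij) mulr0 scale0r.
  by rewrite op eqxx mulr1.
exact: limit_uniq h1 h2.
Qed.

Lemma frame_adj_psi j : adjoint F (psi F j) = (kappa F j)%:C *: phi F j.
Proof.
have [op _] := phi_basis F; have [os _] := psi_basis F.
apply/eqP; rewrite -subr_eq0; apply/eqP; apply: (bseq_orth (phi_basis F)) => i.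
rewrite dotBr adjPr frame_phi dotZl conjc_real dotZr op os.
by case: (eqVneq i j) => [->|_]; rewrite ?subrr// !mulr0 subrr.
Qed.

(** (P + kappa)(P - kappa) kills [phi F j] for P = |F|, and P + kappa is injective because P is
    nonnegative. *)
Lemma abs_frame_phi j : abs_op F (phi F j) = (kappa F j)%:C *: phi F j.
Proof.
have [P0 PP] := abs_opP F; set P := abs_op F in P0 PP *.
set v := P (phi F j) - (kappa F j)%:C *: phi F j.
have Pv : P v = - (kappa F j)%:C *: v.
  rewrite /v bopB bopZ -(bop_compE P) PP bopE frame_phi bopZ frame_adj_psi.
  by rewrite scaleNr scalerBr opprB.
have := (nonneg_real v P0).2; rewrite Pv dotZr dotxx.
have -> : complex.Re (- (kappa F j)%:C * (nm v ^+ 2)%:C) = - (kappa F j * nm v ^+ 2).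
  by rewrite /= mulr0 subr0 mulNr.
rewrite oppr_ge0 pmulr_rle0 ?kappa_gt0// => h.
have /eqP : nm v ^+ 2 = 0 by apply: le_anti; rewrite h sqr_ge0.
by rewrite sqrf_eq0 => /eqP/nm_eq0/eqP; rewrite subr_eq0 => /eqP.
Qed.

Lemma phi_span j : linear_span (range (phi F)) (phi F j).
Proof. by apply: linear_span_mem; exists j. Qed.

Variable G : rigging F.

(** The vectors u_j over kappa_j phi_j have the norms of the phi_j, also in combinations, so they
    are orthonormal; they span by [plus_dense]. The unitary sends u_j to psi_j. *)
Lemma plus_unitary : exists k : bop (Hplus G) K,
  [/\ adjoint k \c k = bop_id (Hplus G), k \c adjoint k = bop_id K &
      plus_incl G = adjoint F \c k].
Proof.
have [S0 Sl] := linear_span_is_subspace (range (phi F)).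
have [op _] := phi_basis F; pose P := abs_op F.
have ex j : exists u, plus_incl G u = (kappa F j)%:C *: phi F j.
  apply: plus_span; rewrite -[_ *: _]addr0; apply: (Sl) => //; exact: phi_span.
have [u hu] := choice ex.
have nu g x : linear_span (range (phi F)) (plus_incl G x) -> P g = plus_incl G x ->
    nm x = nm g.
  by move=> h1 h2; rewrite /nm (plus_norm h1 h2).
have comb i j b : nm (u i + b *: u j) = nm (phi F i + b *: phi F j).
  have E : plus_incl G (u i + b *: u j) = P (phi F i + b *: phi F j).
    by rewrite !(bopD, bopZ) !hu !abs_frame_phi.
  apply: nu; last by rewrite E.
  rewrite bopD bopZ !hu -[_ *: phi F i]scale1r; apply: (Sl).
    by rewrite -[_ *: _]addr0; apply: (Sl) => //; exact: phi_span.
  rewrite -[b *: _]addr0; apply: (Sl) => //.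
  by rewrite -[_ *: _]addr0; apply: (Sl) => //; exact: phi_span.
have nu1 i : nm (u i) = nm (phi F i).
  by have := comb i i 0; rewrite !scale0r !addr0.
have ou i j : dot (u i) (u j) = (i == j)%:R.
  rewrite -op; apply: dot_polar; [exact: nu1|exact: nu1| |exact: comb].
  by have := comb i j 1; rewrite !scale1r.
have du : closure (linear_span (range u)) = setT.
  apply/densityP => x e e0.
  have [v hv xv] := (densityP _).1 (plus_dense G) x _ e0.
  exists v => //; have [n [a [f [Bf E]]]] := hv.
  have exk i : exists k, phi F k = f i by have [k _ <-] := Bf i; exists k.
  have [k hk] := choice exk.
  exists n, (fun i => a i / (kappa F (k i))%:C), (fun i => u (k i)); split=> [i|].
    by exists (k i).
  (* A vector whose inclusion is 0 has norm 0, by [nu] at the preimage 0. *)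
  apply/eqP; rewrite -subr_eq0; apply/eqP/nm_eq0; rewrite (nu 0) ?nm0//.
    rewrite bopB bop_sum E.
    rewrite (_ : \sum_i _ - \sum_i _ = 0)//.
    apply/eqP; rewrite subr_eq0; apply/eqP; apply: eq_bigr => i _.
    by rewrite bopZ hu scalerA divfK ?kappa_neq0// hk.
  rewrite bop0 bopB bop_sum E; apply/esym/eqP; rewrite subr_eq0; apply/eqP.
  apply: eq_bigr => i _.
  by rewrite bopZ hu scalerA divfK ?kappa_neq0// hk.
have [k [ku k1 k2]] := unitary_exists (conj ou du) (psi_basis F).
exists k; split=> //; apply: (bseq_eq (conj ou du)) => i.
by rewrite bopE ku frame_adj_psi hu.
Qed.

(** Here the orthonormal vectors are the images of phi_j divided by kappa_j, since |F| multiplies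
    phi_j by kappa_j. *)
Lemma minus_unitary : exists j : bop (Hminus G) K,
  [/\ adjoint j \c j = bop_id (Hminus G), j \c adjoint j = bop_id K &
      j \c minus_incl G = F].
Proof.
have [S0 Sl] := linear_span_is_subspace (range (phi F)).
have [op _] := phi_basis F; pose P := abs_op F.
pose v j := (kappa F j)^-1%:C *: minus_incl G (phi F j).
have kV i : (kappa F i)^-1%:C * (kappa F i)%:C = 1 :> R[i].
  by rewrite -rmorphM/= mulVf// gt_eqF// kappa_gt0.
have hv j : minus_incl G (phi F j) = (kappa F j)%:C *: v j.
  by rewrite /v scalerA mulrC kV scale1r.
have comb i j b : nm (v i + b *: v j) = nm (phi F i + b *: phi F j).
  pose g := (kappa F i)^-1%:C *: phi F i + (b * (kappa F j)^-1%:C) *: phi F j.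
  have -> : v i + b *: v j = minus_incl G g by rewrite /v /g bopD !bopZ scalerA.
  have Sg : linear_span (range (phi F)) g.
    apply: (Sl); first exact: phi_span.
    by rewrite -[_ *: _]addr0; apply: (Sl) => //; exact: phi_span.
  rewrite {1}/nm (minus_norm G Sg) -/(nm _) /g bopD !bopZ !abs_frame_phi !scalerA.
  by rewrite -mulrA !kV mulr1 scale1r.
have nv1 i : nm (v i) = nm (phi F i).
  by have := comb i i 0; rewrite !scale0r !addr0.
have ov i j : dot (v i) (v j) = (i == j)%:R.
  rewrite -op; apply: dot_polar; [exact: nv1|exact: nv1| |exact: comb].
  by have := comb i j 1; rewrite !scale1r.
have dv : closure (linear_span (range v)) = setT.
  apply/densityP => x e e0.
  have [_ [g [n [a [f [Bf ->]]]] <-] xv] := (densityP _).1 (minus_dense G) x _ e0.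
  exists (minus_incl G (\sum_i a i *: f i)) => //.
  have exk i : exists k, phi F k = f i by have [k _ <-] := Bf i; exists k.
  have [k hk] := choice exk.
  exists n, (fun i => a i * (kappa F (k i))%:C), (fun i => v (k i)); split=> [i|].
    by exists (k i).
  by rewrite bop_sum; apply: eq_bigr => i _; rewrite bopZ -hk hv scalerA.
have [j [jv j1 j2]] := unitary_exists (conj ov dv) (psi_basis F).
exists j; split=> //; apply: (bseq_eq (phi_basis F)) => i.
by rewrite bopE hv bopZ jv frame_phi.
Qed.

Lemma ell2_unitary : exists W : bop (ell2 R) K,
  [/\ forall j, W (ell2_delta j) = psi F j, adjoint W \c W = bop_id (ell2 R) &
      W \c adjoint W = bop_id K].
Proof. exact: (unitary_exists delta_basis (psi_basis F)). Qed.

End FrameFacts.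

Lemma imag_part_sym (R : realType) (H : hilbertType R) (X : bop H H) :
  adjoint (imag_part X) = imag_part X.
Proof.
rewrite /imag_part adj_scale adjD adjN adjK -opprB scalerN -scaleNr.
congr (_ *: _); rewrite fmorphV -invrN; congr (_^-1).
rewrite rmorphM rmorph_nat -mulrN; congr (_ * _).
by apply/eqP; rewrite eq_complex /= oppr0 opprK !eqxx.
Qed.

Section Evaluation.
Context {R : realType}.
Variables (H K : hilbertType R) (F : frame H K) (G : rigging F).
Variables (A : unbounded_op H) (lambda : R).
Hypotheses (sA : self_adjoint A) (hL : Lambda F A lambda).
Let T0 := sandwich_limit F A lambda.

(** At height y the form is y |R F^* x|^2, and the limit keeps the sign. *)
Lemma imag_limit_nonneg : nonneg_op (imag_part T0).
Proof.
have [_ _ hT] := LambdaP hL; have hN := cvgT_cvgN hT; rewrite -/T0 in hN.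
move=> x; set B := imag_part T0 in hN *.
have sB : dot x (B x) = (dot x (B x))^*%C.
  have sBB : adjoint B = B by exact: imag_part_sym.
  by rewrite -dotC -{2}sBB adjP.
have e0 : 0 <= complex.Re (dot x (B x)).
  apply: le_eps => e e0; have x0 : 0 < nm x ^+ 2 + 1 by rewrite ltr_wpDl ?sqr_ge0.
  have hp := filterI (hN _ (divr_gt0 e0 x0)) (near_pos (fun y (y0 : 0 < y) => y0)).
  have [y [h y0]] := @filter_ex _ _ (at_right_proper_filter (0 : R)) _ (hp _).
  set By := sandwich F _ in h.
  have Bpos : 0 <= complex.Re (dot x (By x)).
    rewrite /By (imag_part_resolvent sA (im_neq0 lambda y0)).1.
    rewrite /sandwich !bopE bopZ dotZr -adjP -(resolvent_adj sA (im_neq0 lambda y0)).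
    by rewrite adjPr dotxx /= !mul0r subr0 mulr_ge0 ?sqr_ge0// ltW.
  have : `|complex.Re (dot x ((By - B) x))| <= e.
    rewrite (le_trans (Re_le_nm _))// (le_trans (nm_dot _ _))//.
    apply: (@le_trans _ _ (nm x * (e / (nm x ^+ 2 + 1) * nm x))).
      by rewrite ler_wpM2l ?nm_ge0// bn_ub.
    rewrite [leLHS](_ : _ = e * (nm x ^+ 2 / (nm x ^+ 2 + 1))); last by ring.
    by rewrite -[leRHS]mulr1 ler_wpM2l ?(ltW e0)// ler_pdivrMr// mul1r lerDl.
  rewrite !bopE dotBr; case: (dot x (By x)) Bpos => a a'.
  case: (dot x (B x)) => b b' /= a0; rewrite ler_norml => /andP[_]; lra.
rewrite lecE /= e0 andbT.
move: sB; case: (dot x _) => a b /= [] /eqP.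
by rewrite -addr_eq0 -mulr2n mulrn_eq0.
Qed.

(** kappa_i kappa_j <phi_i, X phi_j> = <psi_i, F X F^* psi_j>, so the matrix is pi^-1 Im T in the
    basis psi. The entrywise limits exist because T converges, and they determine the operator. *)
Lemma phi_matrixE (W : bop (ell2 R) K) : (forall j, W (ell2_delta j) = psi F j) ->
  phi_matrix F A lambda = (pi^-1)%:C *: (adjoint W \c (imag_part T0 \c W)).
Proof.
move=> hW; have [_ _ hT] := LambdaP hL; have hN := cvgT_cvgN hT; rewrite -/T0 in hN.
have [os _] := psi_basis F.
have ent i j : lim ((dot (phi F i) (imag_part (resolvent A (lambda +i* y)) (phi F j))
        : R[i]^o) @[y --> (0 : R)^'+]) =
    (kappa F i)%:C^-1 * (kappa F j)%:C^-1 * dot (psi F i) (imag_part T0 (psi F j)).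
  apply: cvg_lim => //; apply/cvgrPdist_lt => e' /gt0C[-> e0].
  set e := complex.Re e' in e0 *.
  set c := (kappa F i)%:C^-1 * (kappa F j)%:C^-1.
  have c0 : 0 < nm c + 1 by rewrite ltr_wpDl ?nm_ge0.
  have e2 : 0 < e / 2 by rewrite divr_gt0.
  apply: filterS (hN _ (divr_gt0 e2 c0)) => y; rewrite ler_pdivlMr// => h.
  have E (X : bop H H) : dot (phi F i) (X (phi F j)) = c * dot (psi F i) (sandwich F X (psi F j)).
    rewrite /sandwich !bopE frame_adj_psi !bopZ dotZr -(adjP F) frame_adj_psi dotZl.
    rewrite conjc_real /c; have := kappa_neq0 F i; have := kappa_neq0 F j.
    move: (kappa F i)%:C (kappa F j)%:C (dot _ _) => a b d b0 a0.
    by field; rewrite a0 b0.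
  rewrite E -mulrBr -dotBr ltnmE nmM.
  set X := sandwich F _ in h *.
  apply: (@le_lt_trans _ _ (nm c * bn (X - imag_part T0))).
    rewrite ler_wpM2l ?nm_ge0// (le_trans (nm_dot _ _))//.
    have n1 m : nm (psi F m) = 1.
      apply/eqP; rewrite -(@eqrXn2 _ 2) ?nm_ge0// expr1n; apply/eqP.
      by have := os m m; rewrite eqxx dotxx => /complexI.
    rewrite n1 mul1r nm_dist.
    by have := bn_le (X - imag_part T0) (psi F j); rewrite n1 mulr1.
  apply: (@le_lt_trans _ _ (e / 2)); last by rewrite ltr_pdivrMr// ltr_pMr// ltr1n.
  by apply: le_trans h; rewrite mulrC ler_wpM2l ?bn_ge0// lerDl.
have spec (P : bop (ell2 R) (ell2 R)) : (forall i j,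
    dot (ell2_delta i) (P (ell2_delta j)) = (pi^-1 * kappa F i * kappa F j)%:C *
      lim ((dot (phi F i) (imag_part (resolvent A (lambda +i* y)) (phi F j))
        : R[i]^o) @[y --> (0 : R)^'+])) <->
    P = (pi^-1)%:C *: (adjoint W \c (imag_part T0 \c W)).
  have ent' i j : dot (ell2_delta i)
      (((pi^-1)%:C *: (adjoint W \c (imag_part T0 \c W))) (ell2_delta j)) =
    (pi^-1 * kappa F i * kappa F j)%:C *
      lim ((dot (phi F i) (imag_part (resolvent A (lambda +i* y)) (phi F j))
        : R[i]^o) @[y --> (0 : R)^'+]).
    rewrite ent !bopE dotZr adjPr !hW !rmorphM /=.
    have := kappa_neq0 F i; have := kappa_neq0 F j.
    move: (pi^-1)%:C (kappa F i)%:C (kappa F j)%:C (dot _ _) => p a b d b0 a0.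
    by field; rewrite a0 b0.
  split=> [h|->] //; apply: (bseq_eq delta_basis) => j.
  apply/eqP; rewrite -subr_eq0; apply/eqP; apply: (bseq_orth delta_basis) => i.
  by rewrite dotBr h ent' subrr.
exact: xget_unique.
Qed.

Lemma eta_opP : adjoint (eta_op F A lambda) = eta_op F A lambda /\
  eta_op F A lambda \c eta_op F A lambda = phi_matrix F A lambda.
Proof.
have [W [hW _ _]] := ell2_unitary F.
suff P0 : nonneg_op (phi_matrix F A lambda).
  by have [/nonneg_sym] := sqrt_opP P0.
rewrite (phi_matrixE hW) => x; rewrite !bopE dotZr adjPr mulr_ge0//.
  by rewrite ler0c invr_ge0 pi_ge0.
exact: imag_limit_nonneg.
Qed.

(** The inclusion of f is the sum of beta_j kappa_j phi_j exactly when beta is the sequence of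
    coordinates of k f in the basis psi, which every f possesses. This makes the defining property
    of [evaluation] determine it. *)
Lemma evaluationE (k : bop (Hplus G) K) (W : bop (ell2 R) K) :
  plus_incl G = adjoint F \c k -> (forall j, W (ell2_delta j) = psi F j) ->
  W \c adjoint W = bop_id K ->
  evaluation G A lambda = eta_op F A lambda \c adjoint W \c k.
Proof.
move=> hk hW W2; set eta := eta_op F A lambda.
have coord f j : dot (ell2_delta j) (adjoint W (k f)) = dot (psi F j) (k f).
  by rewrite adjPr hW.
have inclE f j : dot (phi F j) (plus_incl G f) = (kappa F j)%:C * dot (psi F j) (k f).
  by rewrite hk bopE adjPr frame_phi dotZl conjc_real.
have cont (L : normedModType R[i]) (B : bop (ell2 R) L) (beta : ell2 R) :
    series (fun j => beta j *: B (ell2_delta j)) @ \oo --> B beta.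
  have hs : series (fun j => beta j *: ell2_delta j) @ \oo --> beta.
    have := @bseq_expand _ _ _ beta delta_basis.
    by under [X in series X]eq_fun do rewrite dot_delta.
  exact: bop_series.
have spec (E : bop (Hplus G) (ell2 R)) : (forall (beta : ell2 R) (f : Hplus G),
      series (fun j => (beta j * (kappa F j)%:C) *: phi F j) @ \oo -->
        plus_incl G f ->
      series (fun j => beta j *: eta (ell2_delta j)) @ \oo --> E f) <->
    E = eta \c adjoint W \c k.
  split=> [h|-> beta f hf].
    apply: bopP => f; pose beta := adjoint W (k f).
    have hf : series (fun j => (beta j * (kappa F j)%:C) *: phi F j) @ \oo -->
        plus_incl G f.
      have e1 : (adjoint F \c W) beta = plus_incl G f.
        by rewrite hk /beta !bopE -(bop_compE W) W2.
      have e2 : (fun j => beta j *: (adjoint F \c W) (ell2_delta j)) =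
          (fun j => (beta j * (kappa F j)%:C) *: phi F j).
        by apply/funext => j; rewrite bopE hW frame_adj_psi scalerA.
      by have := cont _ (adjoint F \c W) beta; rewrite e1 e2.
    exact: limit_uniq (h _ _ hf) (cont _ eta beta).
  suff -> : beta = adjoint W (k f) by exact: cont.
  apply/val_inj/funext => j; rewrite -[RHS]dot_delta coord.
  have h1 : dot (phi F j) (plus_incl G f) = beta j * (kappa F j)%:C.
    apply: limit_unique => e e0.
    have /cvgrPdist_lt/(_ _ e0)[N _ HN] := cvg_dot (phi F j) eventually_filter hf.
    have := HN (maxn N j.+1) (leq_maxl _ _) => /=; rewrite sub0r normrN.
    rewrite ger0_norm ?nm_ge0// nm_dist => h; apply: le_lt_trans h.
    rewrite le_eqVlt; apply/orP; left; apply/eqP; congr nm; congr (_ - _).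
    have [op _] := phi_basis F.
    rewrite /series /= dot_sumr (bigD1_seq j) ?iota_uniq ?mem_index_iota ?leq_maxr//=.
    rewrite dotZr op eqxx mulr1 big1 ?addr0// => i ij.
    by rewrite dotZr op eq_sym (negPf ij) mulr0.
  move: h1; rewrite inclE mulrC => /(mulIf (kappa_neq0 F j)) -> //.
exact: xget_unique.
Qed.

Lemma fiber_dot (f g : Hplus G) :
  dot (crange_map (evaluation G A lambda) f : fiber G A lambda)
      (crange_map (evaluation G A lambda) g) =
  dot (evaluation G A lambda f) (evaluation G A lambda g).
Proof. by []. Qed.

(** Yields [a0], and [ar] for the perturbed operator; the inner products follow from eta^2 =
    phi(lambda). The fiber is used below through these three facts only. *)
Lemma fiber_map (k : bop (Hplus G) K) :
  adjoint k \c k = bop_id (Hplus G) -> k \c adjoint k = bop_id K ->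
  plus_incl G = adjoint F \c k ->
  exists a : bop K (fiber G A lambda),
  [/\ forall f, a (k f) = crange_map (evaluation G A lambda) f,
      forall u v, dot (a u) (a v) = (pi^-1)%:C * dot u (imag_part T0 v) &
      closure (range a) = setT].
Proof.
move=> k1 k2 hk; have [W [hW _ W2]] := ell2_unitary F.
set E := evaluation G A lambda.
have EE : E = eta_op F A lambda \c adjoint W \c k by exact: evaluationE.
have [sE eE] := eta_opP.
have dE f g : dot (E f) (E g) = (pi^-1)%:C * dot (k f) (imag_part T0 (k g)).
  rewrite EE !bop_compE -{1}sE adjP -(bop_compE (eta_op F A lambda) (eta_op F A lambda)) eE.
  rewrite (phi_matrixE hW) bopZE !bop_compE dotZr -(bop_compE W (adjoint W)) W2 bop_idE.
  by rewrite adjP -(bop_compE W (adjoint W)) W2.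
have nfib (x : fiber G A lambda) : nm x = nm (val x).
  have : (nm x ^+ 2)%:C = (nm (val x) ^+ 2)%:C by rewrite -!dotxx.
  by move=> /complexI /eqP; rewrite eqrXn2 ?nm_ge0// => /eqP.
have nE f : nm (crange_map E f : fiber G A lambda) = nm (E f) by rewrite nfib.
have lE : linear (fun f => crange_map E f : fiber G A lambda).
  by move=> c x y; apply: val_inj; rewrite /= bop_linear.
have [a0 ha0] := bop_make lE (fun f => ltac:(rewrite nE; exact: bn_le)).
have ak f : (a0 \c adjoint k) (k f) = crange_map E f.
  by rewrite bopE -(bop_compE (adjoint k)) k1 bopE ha0.
have kk u : u = k (adjoint k u) by rewrite -(bop_compE k) k2.
exists (a0 \c adjoint k); split=> //.
  by move=> u v; rewrite [u in LHS]kk [v in LHS]kk !ak fiber_dot dE -!kk.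
apply/densityP => x e e0.
have : closure (range E) (val x) by have := crange_axiom x; rewrite inE.
have ec : (0 : R[i]) < e%:C by rewrite ltcR.
move=> /(_ _ (nbhsx_ballx (val x) _ ec))[y [[f _ <-]]].
rewrite -ball_normE /= ltnmE => h; exists (crange_map E f); first by exists (k f) => //; exact: ak.
by rewrite nfib.
Qed.

End Evaluation.

(** * Wave and scattering matrices *)

Lemma comp_adj_contraction (R : realType) (H K L : hilbertType R) (A : bop H K)
    (B : bop H L) : bn A <= 1 -> bn B <= 1 -> bn (A \c adjoint B) <= 1.
Proof.
move=> A1 B1.
by rewrite (le_trans (bn_comp _ _))// bn_adj -[leRHS]mulr1 ler_pM ?bn_ge0.
Qed.

Section StationaryScattering.
Context {R : realType}.
Variables (K L0 Lr : hilbertType R) (J T0 : bop K K).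
Hypothesis sJ : adjoint J = J.
Hypothesis iJT : invertible_op (bop_id K + J \c T0).
Variables (a0 : bop K L0) (ar : bop K Lr).
Hypothesis a0d : forall u v, dot (a0 u) (a0 v) = (pi^-1)%:C * dot u (imag_part T0 v).
Hypothesis a0r : closure (range a0) = setT.
Hypothesis ard : forall u v, dot (ar u) (ar v) =
  (pi^-1)%:C * dot u (imag_part (T0 \c wop J T0) v).
Hypothesis arr : closure (range ar) = setT.

(** [true] goes with w_+ and Y, [false] with w_- and Z. *)
Definition wside (s : bool) : bop K K := if s then wop J T0 else wop_adj J T0.

Lemma ar_side s u v : dot (ar u) (ar v) = dot (a0 (wside s u)) (a0 (wside s v)).
Proof.
have E : imag_part (T0 \c wop J T0) = adjoint (wside s) \c imag_part T0 \c wside s.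
  by have [h1 h2] := imag_wop sJ iJT; case: s.
by rewrite ard a0d E !bop_compE adjPr.
Qed.

(** By [ar_side] the prescription preserves norms, so it is well defined on the dense range of [ar].
    The adjoint is built, not the wave matrix, because both Y and Z act on that side. *)
Lemma wave_adj_exists s : exists w : bop Lr L0,
  bn w <= 1 /\ forall u, w (ar u) = a0 (wside s u).
Proof.
have [|||w [w1 hw]] := @bop_extend _ _ _
  (fun x y => exists u, x = ar u /\ y = a0 (wside s u)) 1 ler01.
- move=> c x y x' y' [u [-> ->]] [v [-> ->]]; exists (c *: u + v).
  by rewrite !bop_linear.
- move=> x y [u [-> ->]]; rewrite mul1r.
  have : (nm (ar u) ^+ 2)%:C = (nm (a0 (wside s u)) ^+ 2)%:C.
    by rewrite -!dotxx (ar_side s).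
  by move=> /complexI /eqP; rewrite eqrXn2 ?nm_ge0// => /eqP ->.
- apply/densityP => x e e0; have [_ [u _ <-] xu] := (densityP _).1 arr x _ e0.
  by exists (ar u) => //; exists (a0 (wside s u)), u.
by exists w; split=> // u; apply: hw; exists u.
Qed.

Lemma fiber_adj v : adjoint a0 (a0 v) = (pi^-1)%:C *: imag_part T0 v.
Proof. by apply: dot_extr => u; rewrite adjPr a0d [RHS]dotZr. Qed.

(** The adjoint of w_-^* sends a0 v to a_r (1 + J T^* ) v, as Z inverts 1 + J T^*. Then Y (1 + J T^*
    ) = 1 - Y J (T - T^* ), where T - T^* = 2 i Im T and Im T = pi a0^* a0. *)
Lemma wave_product (wp wm : bop Lr L0) : (forall u, wp (ar u) = a0 (wop J T0 u)) ->
  (forall u, wm (ar u) = a0 (wop_adj J T0 u)) ->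
  wp \c adjoint wm = bop_id L0 +
    (- (2 * 'i%C * pi%:C)) *: (a0 \c (wop J T0 \c J) \c adjoint a0).
Proof.
move=> hwp hwm.
have [_ [y1 _]] := wopP sJ iJT; have [z1 [z2 _]] := wop_adjP sJ iJT.
have hm v : adjoint wm (a0 v) = ar ((bop_id K + J \c adjoint T0) v).
  apply/eqP; rewrite -subr_eq0; apply/eqP; apply: (dense_orth arr) => _ [u _ <-].
  rewrite dotBr adjPr hwm (ar_side false); apply/eqP; rewrite subr_eq0; apply/eqP.
  congr (dot _ (a0 _)); rewrite -[RHS](bop_compE (wside false)).
  by rewrite /wside z2.
apply: (bop_dense_eq a0r) => _ [v _ <-].
rewrite bop_compE hm hwp [RHS]bopDE bop_idE bopZE !bop_compE fiber_adj !bopZ scalerA.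
have E : wop J T0 ((bop_id K + J \c adjoint T0) v) =
    v - wop J T0 (J ((T0 - adjoint T0) v)).
  have -> : (bop_id K + J \c adjoint T0) v =
      (bop_id K + J \c T0) v - J ((T0 - adjoint T0) v).
    rewrite !bopDE !bop_compE bopD bopNE bopN.
    by rewrite opprD opprK addrA addrK.
  by rewrite bopB -(bop_compE (wop J T0) (bop_id K + _)) y1 bop_idE.
rewrite E bopB; congr (_ + _).
have p0 : (pi : R) != 0 by rewrite gt_eqF// pi_gt0.
have i0 : 2 * 'i%C != 0 :> R[i].
  by rewrite mulf_neq0// ?pnatr_eq0// eq_complex /= oner_eq0 andbF.
rewrite scalerA -scaleN1r; congr (_ *: _).
by rewrite mulNr -[_ * pi%:C * _]mulrA -rmorphM/= divff// mulr1 mulNr divff.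
Qed.

End StationaryScattering.

Section Scattering.
Context {R : realType}.
Variables (H K : hilbertType R) (F : frame H K) (G : rigging F).
Variables (A : unbounded_op H) (lambda : R).
Hypotheses (sA : self_adjoint A) (hL : Lambda F A lambda).
Let T0 := sandwich_limit F A lambda.
Let B0 := imag_part T0.

(** Both sides agree on the image of H, which is dense in H_{-1}: after the unitaries the pairing is
    the inner product of K. *)
Lemma pairingE (k : bop (Hplus G) K) (j : bop (Hminus G) K) f v :
  plus_incl G = adjoint F \c k -> j \c minus_incl G = F ->
  pairing f v = dot (k f) (j v).
Proof.
move=> hk hj.
have [p0 hp0] : exists p : bop (Hminus G) R[i]^o, forall v, p v = dot (k f) (j v).
  apply: (@bop_make _ (Hminus G) R[i]^o (fun v => dot (k f) (j v)) (nm (k f) * bn j)).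
    by move=> a x y; rewrite bop_linear dotDr dotZr.
  by move=> x; rewrite (le_trans (nm_dot _ _))// -mulrA ler_wpM2l ?nm_ge0 ?bn_le.
have p0P g : p0 (minus_incl G g) = dot (plus_incl G f) g.
  by rewrite hp0 -(bop_compE j) hj hk bop_compE adjP.
have pP := xgetPex 0 (ex_intro (fun p : bop (Hminus G) R[i]^o =>
  forall g : H, p (minus_incl G g) = dot (plus_incl G f) g) p0 p0P).
rewrite -hp0; congr (bop_fun _ v).
apply: (bop_dense_eq (minus_dense G)) => _ [g _ <-].
by rewrite p0P; exact: pP.
Qed.

Section Fixed.
Variables (k : bop (Hplus G) K) (j : bop (Hminus G) K) (a0 : bop K (fiber G A lambda)).
Hypotheses (k1 : adjoint k \c k = bop_id (Hplus G)) (k2 : k \c adjoint k = bop_id K).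
Hypothesis hk : plus_incl G = adjoint F \c k.
Hypotheses (j1 : adjoint j \c j = bop_id (Hminus G)) (j2 : j \c adjoint j = bop_id K).
Hypothesis hj : j \c minus_incl G = F.
Hypothesis a0k : forall f, a0 (k f) = crange_map (evaluation G A lambda) f.
Hypothesis a0d : forall u v, dot (a0 u) (a0 v) = (pi^-1)%:C * dot u (B0 v).
Hypothesis a0r : closure (range a0) = setT.

(** The squared Hilbert-Schmidt norm of a0 is the trace of a0^* a0 = Im T / pi, finite since lambda
    lies in [Lambda]. *)
Lemma fiber_hs : exists h : R, (hsn a0 <= h%:E)%E.
Proof.
have [_ fB _] := LambdaP hL; have [t [Et t0]] := trace_norm_fin fB.
have pi0 : 0 <= pi^-1 :> R by rewrite invr_ge0 pi_ge0.
have B0p : nonneg_op B0 := imag_limit_nonneg sA hL.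
exists (pi^-1 * t); rewrite EFinM -Et.
apply: (@le_trans _ _ ((pi^-1)%:E * trace B0)%E); last first.
  by rewrite lee_wpmul2l ?lee_fin//; exact: nonneg_trace.
rewrite /trace -/(onb K) (le_trans _ (esumZ_le _ _ _))//; last first.
  by move=> e; rewrite lee_fin; exact: (nonneg_real e B0p).2.
apply: le_esum => e _; rewrite -EFinM lee_fin.
rewrite -[leLHS]/(complex.Re (nm (a0 e) ^+ 2)%:C) -dotxx a0d.
by case: (dot e _) => a b /=; rewrite mul0r subr0.
Qed.

Section Coupling.
Variable J : bop K K.
Hypothesis sJ : adjoint J = J.
Hypothesis iJT : invertible_op (bop_id K + J \c T0).
Local Notation A' := (pert F A J).
Local Notation X s := (wside J T0 s).

Lemma amatE s : amat G s A' A lambda =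
  adjoint j \c ((pi^-1)%:C *: (adjoint (X s) \c B0)) \c k.
Proof.
have [hT fT] := amat_limit sA sJ hL iJT s.
have hj' : minus_incl G = adjoint j \c F by rewrite -hj compA j1 comp1l.
apply: limit0_trace; first exact: trace_norm_comp_fin.
apply: (@cvgT_ext _ _ _ (fun y => adjoint j \c ((y / pi)%:C *:
    (F \c (resolvent A' (lambda +i* signed (~~ s) y) \c
      resolvent A (lambda +i* signed s y) \c adjoint F))) \c k)).
  move=> y y0; rewrite hj' hk !(compZr, compZl) !compA //.
apply: cvgT_compr; first exact: cvgN_cst.
  exact: trace_norm_compl_fin.
by apply: cvgT_compl => //; exact: cvgN_cst.
Qed.

Variable ar : bop K (fiber G A' lambda).
Hypothesis ark : forall f, ar (k f) = crange_map (evaluation G A' lambda) f.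
Hypothesis arr : closure (range ar) = setT.

(** The adjoint of [w] satisfies the defining identity, which on the dense ranges of [a0] and [ar]
    leaves no other choice. *)
Lemma wave_matrixE s (w : bop (fiber G A' lambda) (fiber G A lambda)) :
  (forall u, w (ar u) = a0 (X s u)) ->
  wave_matrix G s A' A lambda = adjoint w.
Proof.
move=> hw; apply: xget_unique => v /=.
have pE f g : pairing f (amat G s A' A lambda g) =
    dot (a0 (X s (k f))) (a0 (k g)).
  rewrite (pairingE _ _ hk hj) amatE !bop_compE -(bop_compE j) j2 bop_idE.
  by rewrite (bopZE _ (adjoint _ \c B0)) bop_compE dotZr adjPr a0d.
have kk u : u = k (adjoint k u) by rewrite -(bop_compE k) k2.
have cE (v0 : bop (fiber G A lambda) (fiber G A' lambda)) f g :
    dot (ar (k f)) (v0 (a0 (k g))) =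
    dot (crange_map (evaluation G A' lambda) f : fiber G A' lambda)
      (v0 (crange_map (evaluation G A lambda) g)) :=
  congr2 (fun x y => dot x (v0 y)) (ark f) (a0k g).
have wE u x : dot (ar u) (adjoint w (a0 x)) = dot (a0 (X s u)) (a0 x) :=
  etrans (adjPr w _ _) (congr1 (fun y => dot y (a0 x)) (hw u)).
split=> [hv|vE f g].
  have hv' u x : dot (ar u) (v (a0 x)) = dot (a0 (X s u)) (a0 x).
    rewrite (kk u) (kk x).
    exact: (etrans (cE v _ _) (etrans (hv _ _) (pE _ _))).
  apply: (bop_dense_eq a0r) => _ [x _ <-].
  apply/eqP; rewrite -subr_eq0; apply/eqP; apply: (dense_orth arr) => _ [u _ <-].
  rewrite dotBr.
  exact: (etrans (congr2 (fun a b => a - b) (hv' u x) (wE u x)) (subrr _)).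
have E1 : dot (ar (k f)) (v (a0 (k g))) = dot (ar (k f)) (adjoint w (a0 (k g))) :=
  congr1 (fun v0 : bop _ _ => dot (ar (k f)) (v0 (a0 (k g)))) vE.
exact: (etrans (esym (cE v f g)) (etrans E1 (etrans (wE _ _) (esym (pE f g))))).
Qed.

End Coupling.

(** The norm bound, from two contractions, is what later rules out poles. *)
Lemma scattering_formula (J : bop K K) : adjoint J = J ->
  invertible_op (bop_id K + J \c T0) ->
  scattering_matrix G (pert F A J) A lambda = bop_id (fiber G A lambda) +
    (- (2 * 'i%C * pi%:C)) *: (a0 \c (wop J T0 \c J) \c adjoint a0) /\
  bn (scattering_matrix G (pert F A J) A lambda) <= 1.
Proof.
move=> sJ iJT; have sA' := pert_sa F sA sJ.
have [hL' EL] := Lambda_pert sA sJ hL iJT.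
have [ar [ark ard arr]] := fiber_map sA' hL' k1 k2 hk.
rewrite EL in ard.
have [wp [wp1 hwp]] := wave_adj_exists sJ iJT a0d ard arr true.
have [wm [wm1 hwm]] := wave_adj_exists sJ iJT a0d ard arr false.
have Ep := wave_matrixE sJ iJT ark arr hwp.
have Em := wave_matrixE sJ iJT ark arr hwm.
have -> : scattering_matrix G (pert F A J) A lambda = wp \c adjoint wm.
  exact: (etrans (congr2 (fun a b => adjoint a \c b) Ep Em)
    (congr1 (fun a => a \c adjoint wm) (adjK wp))).
split; first exact: (wave_product sJ iJT a0d a0r ard arr).
exact: comp_adj_contraction.
Qed.

End Fixed.
End Scattering.

(** * Finite-rank approximation and pieces of the path *)

Section FiniteRank.
Context {R : realType}.
Variables (H K : hilbertType R) (F : frame H K).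
Local Notation Q := (proj_op (psi F)).

Lemma dot_psi_proj n j x : dot (psi F j) (Q n x) = if (j < n)%N then dot (psi F j) x else 0.
Proof.
have [os _] := psi_basis F.
rewrite bop_sumE dot_sumr; case: ifP => jn; last first.
  rewrite big1// => i _; rewrite rank1E dotZr os (_ : (j == i :> nat) = false) ?mulr0//.
  by apply: contraFF jn => /eqP ->.
rewrite (bigD1 (Ordinal jn))//= rank1E dotZr os eqxx mulr1 big1 ?addr0// => i ij.
rewrite rank1E dotZr os (_ : (j == i :> nat) = false) ?mulr0//.
by apply: contraNF ij => /eqP ji; apply/eqP/val_inj.
Qed.

Lemma bn_proj_compl n : bn (bop_id K - Q n) <= 1.
Proof.
have os := psi_basis F; apply: bn_lub => // x; rewrite mul1r.
rewrite -(@ler_pXn2r _ 2) ?nnegrE ?nm_ge0// -lee_fin.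
rewrite -(parseval x (bseq_basis os)) -(parseval _ (bseq_basis os)).
rewrite !esum_image; [|by move=> i j _ _; exact: (bseq_inj os.1)..].
apply: le_esum => j _; rewrite lee_fin !bopE dotBr dot_psi_proj.
by case: ifP; rewrite ?subr0// subrr nm0 expr0n sqr_ge0.
Qed.

(** F^* psi_j = kappa_j phi_j and kappa decreases, so the first discarded index dominates. *)
Lemma bn_frame_tail n : bn (adjoint F \c (bop_id K - Q n)) <= kappa F n.
Proof.
have os := psi_basis F; have op := phi_basis F.
have k0 := kappa_gt0 F n.
apply: bn_lub => [|x]; first exact: ltW.
rewrite -(@ler_pXn2r _ 2) ?nnegrE ?mulr_ge0 ?nm_ge0 ?(ltW k0)// exprMn -lee_fin [leRHS]EFinM.
rewrite -(parseval x (bseq_basis os)) -(parseval _ (bseq_basis op)).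
rewrite !esum_image; last 2 first.
- by move=> i j _ _; exact: (bseq_inj os.1).
- by move=> i j _ _; exact: (bseq_inj op.1).
rewrite (le_trans _ (esumZ_le _ _ _)) ?sqr_ge0//; last by move=> i; rewrite lee_fin sqr_ge0.
apply: le_esum => j _; rewrite -EFinM lee_fin -exprMn.
rewrite lerXn2r ?nnegrE ?mulr_ge0 ?nm_ge0 ?(ltW k0)//.
rewrite !bopE adjPr frame_phi dotZl conjc_real nmM nm_real.
rewrite ger0_norm ?(ltW (kappa_gt0 F j))// dotBr dot_psi_proj.
case: ltnP => jn; first by rewrite subrr nm0 mulr0 mulr_ge0 ?nm_ge0 ?ltW.
by rewrite subr0 ler_wpM2r ?nm_ge0// kappa_decr.
Qed.

Lemma kappa_small (e : R) : 0 < e -> exists n, kappa F n <= e.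
Proof.
move=> e0; have /cvgrPdist_lt h := cvg_series_cvg_0 (@kappa_l2 _ _ _ F).
have [N _ HN] := h _ (exprn_gt0 2 e0); exists N.
have := HN N (leqnn N); rewrite /= sub0r normrN ger0_norm ?sqr_ge0// => hk.
by rewrite -(@ler_pXn2r _ 2) ?nnegrE ?(ltW e0) ?(ltW (kappa_gt0 F N))// ltW.
Qed.

(** Compactness of the boundary value in the form [fredholm] needs: replace it by the sandwiched
    resolvent at a small height, which ends in F^*, and cut off there. *)
Lemma sandwich_limit_approx (A : unbounded_op H) (lambda : R) :
  Lambda F A lambda -> forall e : R, 0 < e ->
  exists n, bn (sandwich_limit F A lambda - sandwich_limit F A lambda \c Q n) <= e.
Proof.
move=> hL e e0; have [hT _ _] := LambdaP hL; set T0 := sandwich_limit F A lambda in hT *.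
have e2 : 0 < e / 2 by rewrite divr_gt0.
have [y hy] := @filter_ex _ _ (at_right_proper_filter (0 : R)) _ (hT _ e2).
set T := sandwich F _ in hy; set X := resolvent A _ in T hy.
have c0 : 0 < bn (F \c X) + 1 by rewrite ltr_wpDl ?bn_ge0.
have [n hn] := kappa_small (divr_gt0 e2 c0); exists n.
have -> : T0 - T0 \c Q n = (T0 - T) \c (bop_id K - Q n) +
    F \c X \c (adjoint F \c (bop_id K - Q n)).
  have -> : F \c X \c (adjoint F \c (bop_id K - Q n)) = T \c (bop_id K - Q n).
    by rewrite /T /sandwich !compA.
  by rewrite -compDl subrK compBr comp1r.
rewrite (le_trans (bnD _ _))// [leRHS]splitr lerD// (le_trans (bn_comp _ _))//.
  by rewrite -[leRHS]mulr1 ler_pM ?bn_ge0 ?bn_proj_compl// bn_dist.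
move: hn; rewrite ler_pdivlMr// => hn; apply: le_trans hn; rewrite mulrC.
by rewrite ler_pM ?bn_ge0 ?bn_frame_tail// lerDl.
Qed.

End FiniteRank.

Section Pieces.
Context {R : realType}.

(** The last property holds because a < b: a point below b is approached from the right inside the
    piece, b itself from the left. *)
Lemma piece_facts (N I : set R) : piece N I ->
  [/\ closed I, is_interval I &
    forall r (e : R), I r -> 0 < e -> exists s, I s /\ 0 < `|s - r| < e].
Proof.
move=> [a [b [ab _ _ _ ->]]]; split.
- rewrite (_ : [set x | _] = [set x | (a <= x%:E)%E] `&` [set x | (x%:E <= b)%E]).
    apply: closedI.
      case: a ab => [a _||].
      + rewrite (_ : [set x | _] = [set x | a <= x]); first exact: closed_ge.
        by apply/seteqP; split=> x /=; rewrite lee_fin.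
      + by rewrite ltNge leey.
      + move=> _; rewrite (_ : [set x | _] = setT); first exact: closedT.
        by apply/seteqP; split=> x //= _; rewrite leNye.
    case: b ab => [b _||].
    + rewrite (_ : [set x | _] = [set x | x <= b]); first exact: closed_le.
      by apply/seteqP; split=> x /=; rewrite lee_fin.
    + move=> _; rewrite (_ : [set x | _] = setT); first exact: closedT.
      by apply/seteqP; split=> x //= _; rewrite leey.
    + by rewrite ltNge leNye.
  by apply/seteqP; split=> x /= => [/andP[]|[-> ->]].
- move=> x y /andP[ax _] /andP[_ yb] z /andP[xz zy] /=; apply/andP; split.
    by rewrite (le_trans ax)// lee_fin.
  by rewrite (le_trans _ yb)// lee_fin.
- move=> r e /andP[ar rb] e0.
  have [rb'|br] := ltP r%:E b.
    have [d [d0 de rd]] : exists d : R, [/\ 0 < d, d < e & (((r + d)%:E) <= b)%E].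
      case: b rb' {rb ab} => [b|_|]//; first rewrite lte_fin => rb.
        exists (Num.min (b - r) (e / 2)); split.
        - by rewrite lt_min subr_gt0 rb divr_gt0.
        - by rewrite gt_min ltr_pdivrMr// ltr_pMr// ltr1n orbT.
        - by rewrite lee_fin -lerBrDl ge_min lexx.
      by exists (e / 2); rewrite divr_gt0// ltr_pdivrMr// ltr_pMr// ltr1n leey.
    exists (r + d); rewrite addrAC subrr add0r gtr0_norm// d0 de; split=> //=.
    by rewrite rd andbT (le_trans ar)// lee_fin lerDl ltW.
  have ra : (a < r%:E)%E by exact: lt_le_trans ab br.
  have [d [d0 de rd]] : exists d : R, [/\ 0 < d, d < e & (a <= ((r - d)%:E))%E].
    case: a ra {ar ab} => [a||_]//; first rewrite lte_fin => ra.
      exists (Num.min (r - a) (e / 2)); split.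
      - by rewrite lt_min subr_gt0 ra divr_gt0.
      - by rewrite gt_min ltr_pdivrMr// ltr_pMr// ltr1n orbT.
      - by rewrite lee_fin lerBrDl -lerBrDr ge_min lexx.
    by exists (e / 2); rewrite divr_gt0// ltr_pdivrMr// ltr_pMr// ltr1n leNye.
  exists (r - d); rewrite addrAC subrr add0r normrN gtr0_norm// d0 de; split=> //=.
  by rewrite rd (le_trans _ rb)// lee_fin gerBl ltW.
Qed.

Lemma open_complex (U : set R[i]) : open (U : set R[i]^o) <->
  forall z, U z -> exists2 rho : R, 0 < rho & forall w, nm (w - z) < rho -> U w.
Proof.
split=> [oU z Uz|h].
  have : nbhs (z : R[i]^o) (U : set R[i]^o) by exact: open_nbhs_nbhs.
  move=> /nbhs_ballP[e /= /gt0C[eE e0] eU]; exists (complex.Re e) => // w wz.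
  by apply: eU; rewrite -ball_normE /= eE ltnmE nm_dist.
rewrite openE => z /h[rho r0 hr]; apply/nbhs_ballP; exists rho%:C; first by rewrite /= ltcR.
by move=> w; rewrite -ball_normE /= ltnmE => zw; apply: hr; rewrite nm_dist.
Qed.

Lemma open_real (C : set R) :
  (forall r, C r -> exists2 rho : R, 0 < rho & forall s, `|s - r| < rho -> C s) -> open C.
Proof.
move=> h; rewrite openE => r /h[rho r0 hr]; apply/nbhs_ballP; exists rho => //.
by move=> s; rewrite -ball_normE /= => rs; apply: hr; rewrite distrC.
Qed.

Lemma nm_realB (s r : R) : nm (s%:C - r%:C) = `|s - r|.
Proof. by rewrite -rmorphB/= nm_real. Qed.

End Pieces.

(** * Regular and degenerate points along a piece *)

Section Dichotomy.
Context {R : realType}.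
Variables (K : hilbertType R) (g : R[i] -> bop K K) (T : bop K K) (U : set R[i]).
Hypothesis hU : forall z, U z -> exists2 rho : R, 0 < rho & forall w, nm (w - z) < rho -> U w.
Hypothesis hg : forall z, U z -> holo (@bn R K K) g z.
Variable psi : nat -> K.
Hypothesis hT : forall e : R, 0 < e -> exists n, bn (T - T \c proj_op psi n) <= e.

(** The inverse has at worst a pole at z; z itself may be a resonance. *)
Definition regular z : Prop := exists p Y (rho : R), [/\ 0 < rho, holo (@bn R K K) Y z &
  forall w, 0 < nm (w - z) < rho -> invertible_op (bop_id K + g w \c T) /\
    (w - z) ^+ p *: inv_op (bop_id K + g w \c T) = Y w].

Definition degenerate z : Prop := exists2 rho : R, 0 < rho &
  forall w, nm (w - z) < rho -> ~ invertible_op (bop_id K + g w \c T).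

Lemma regular_or_degenerate z : U z -> degenerate z \/ regular z.
Proof. by move=> Uz; exact: (fredholm (hg Uz) hT). Qed.

Lemma near_point (z : R[i]) (e : R) : 0 < e -> exists w, 0 < nm (w - z) < e.
Proof.
move=> e0; exists (z + (e / 2)%:C); rewrite addrAC subrr add0r nm_real.
by rewrite gtr0_norm ?divr_gt0//= ltr_pdivrMr// ltr_pMr// ltr1n.
Qed.

Lemma regular_not_degenerate z : regular z -> degenerate z -> False.
Proof.
move=> [p [Y [r [r0 _ hr]]]] [r' r'0 hr'].
have m0 : 0 < Num.min r r' by rewrite lt_min r0.
have [w] := near_point z m0; rewrite lt_min => /andP[w0 /andP[wr wr']].
by apply: (hr' w wr'); apply: (hr w _).1; rewrite w0.
Qed.

Lemma regular_open z : U z -> regular z ->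
  exists2 rho : R, 0 < rho & forall w, nm (w - z) < rho -> U w /\ regular w.
Proof.
move=> Uz rz; have [p [Y [r [r0 _ hr]]]] := rz; have [r' r'0 hr'] := hU Uz.
exists (Num.min r r'); first by rewrite lt_min r0.
move=> w; rewrite lt_min => /andP[wr wr']; have Uw := hr' _ wr'; split=> //.
have [->//|wz] := eqVneq w z.
(* A nearby w other than z is a point of invertibility, so the degenerate branch fails at w. *)
have [[e e0 he]|//] := regular_or_degenerate Uw.
have := he w; rewrite subrr nm0 => /(_ e0) ni; exfalso; apply: ni.
by apply: (hr w _).1; rewrite wr nm_gt0 subr_eq0 wz.
Qed.

Lemma degenerate_open z : degenerate z ->
  exists2 rho : R, 0 < rho & forall w, nm (w - z) < rho -> degenerate w.
Proof.
move=> [r r0 hr]; have r2 : 0 < r / 2 by rewrite divr_gt0.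
exists (r / 2) => // w wz; exists (r / 2) => // v vw; apply: hr.
rewrite -(subrKA w) (le_lt_trans (nmD _ _))// [ltRHS]splitr ltrD//.
Qed.

(** Regular and degenerate points are both open conditions and exclude each other, so the regular
    points of [I] are relatively open and closed; the interval is connected and [r0] is one of
    them. *)
Lemma regular_on_interval (I : set R) r0 : is_interval I -> (forall r, I r -> U r%:C) ->
  I r0 -> invertible_op (bop_id K + g r0%:C \c T) -> forall r, I r -> regular r%:C.
Proof.
move=> iI IU Ir0 ir0; have /connected_intervalP cI := iI.
have E : [set r | I r /\ regular r%:C] = I.
  apply: cI.
  - exists r0; split=> //; have [[e e0 he]|//] := regular_or_degenerate (IU _ Ir0).
    by have := he r0%:C; rewrite subrr nm0 => /(_ e0).
  - exists [set r | U r%:C /\ regular r%:C].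
      apply: open_real => r [Ur /(regular_open Ur)[e e0 he]]; exists e => // s sr.
      by apply: he; rewrite nm_realB.
    by apply/seteqP; split=> r [Ir]; [split=> //; split=> //; exact: IU|case].
  - exists (~` [set r | degenerate r%:C]).
      apply: open_closedC; apply: open_real => r /degenerate_open[e e0 he].
      by exists e => // s sr; apply: he; rewrite nm_realB.
    apply/seteqP; split=> r [Ir].
      by move=> rr; split=> // /(regular_not_degenerate rr).
    by move=> nd; split=> //; have [/nd|] := regular_or_degenerate (IU _ Ir).
by move=> r; rewrite -{1}E => -[].
Qed.

End Dichotomy.

Lemma bn_sub_id (R : realType) (L : hilbertType R) (S M : bop L L) :
  S = bop_id L + M -> bn S <= 1 -> bn M <= 2.
Proof.
move=> E S1; have -> : M = S - bop_id L by rewrite E addrAC subrr add0r.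
by rewrite (le_trans (bnB _ _))// (_ : 2 = 1 + 1)// lerD// bn_id.
Qed.

(** Serves the pieces made of resonance points only. *)
Lemma zero_meromorphic (R : realType) (L : hilbertType R) z :
  meromorphic_at (@trace_norm R L L) (fun=> 0) z /\
  no_negative_powers (@trace_norm R L L) (fun=> 0) z.
Proof.
split; last first.
  apply: (@bounded_no_negative_powers _ _ _ _ 0) => e e0.
  by have [w hw] := near_point z e0; exists w; rewrite ?bn0.
have h0 : (hsn (0%R : bop L L) <= 0%:E)%E.
  rewrite /hsn /hs (eq_esum (b := fun=> 0%E)) ?esum1// => e _.
  by rewrite bop0E nm0 expr0n.
apply: (@sandwich_meromorphic _ _ _ 0 0 h0 (fun=> 0) _ _ 0%N 1 0) => //.
  exact: (holo_cst (bn_seminorm L L)).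
by move=> w _; rewrite scale0r.
Qed.

(** Stated piece by piece, with M continuing S - 1, because J extends analytically from each piece
    separately and two extensions meet at a breakpoint. Analyticity links points of one piece only
    and carries no invertibility past a resonant breakpoint: hence the alternative of an entirely
    resonant piece. *)
Theorem proposition8p8 (R : realType) (H K : hilbertType R) (F : frame H K)
    (G : rigging F) (H0 : unbounded_op H) (J : R -> bop K K) (N : set R)
    (lambda : R) :
  self_adjoint H0 ->
  (forall r, adjoint (J r) = J r) ->
  J 0 = 0 ->
  (forall r, opnorm (J s - J r) @[s --> r] --> 0%E) ->
  piecewise_real_analytic (@opnorm R K K) N J ->
  Lambda F H0 lambda ->
  forall I : set R, piece N I ->
    (I `<=` resonance_set F H0 J lambda \/
     limit_point (I `&` resonance_set F H0 J lambda) = set0) /\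
    exists (U : set R[i])
           (M : R[i] -> bop (fiber G H0 lambda) (fiber G H0 lambda)),
      let L1norm := @trace_norm R (fiber G H0 lambda) (fiber G H0 lambda) in
      [/\ complex_neighbourhood I U,
          forall z, U z -> meromorphic_at L1norm M z,
          forall r, I r -> ~ resonance_set F H0 J lambda r ->
            analytic_at L1norm M r%:C /\
            scattering_matrix G (perturbed_path F H0 J r) H0 lambda =
              bop_id (fiber G H0 lambda) + M r%:C &
          forall r, I r -> resonance_set F H0 J lambda r ->
            no_negative_powers L1norm M r%:C].
Proof.
move=> sA sJ _ _ [_ hJ] hL I hI.
have [U [g [[/open_complex oU IU] gan gE]]] := hJ I hI.
have [cI iI pI] := piece_facts hI.
have hg z : U z -> holo (@bn R K K) g z by move=> /gan; exact: holo_of_analytic.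
pose T0 := sandwich_limit F H0 lambda.
have hT := sandwich_limit_approx hL.
have [allres|/existsNP[r0 /not_implyP[Ir0 /contrapT ir0]]] :=
    pselect (forall r, I r -> resonance_set F H0 J lambda r).
  split; first by left.
  (* S is defined at no point of such a piece, so zero can stand for M. *)
  exists setT, (fun=> 0); split.
  - by split=> //; exact: openT.
  - by move=> z _; exact: (zero_meromorphic _ z).1.
  - by move=> r /allres.
  - by move=> r _ _; exact: (zero_meromorphic _ _).2.
rewrite gE// in ir0.
have reg := regular_on_interval oU hg hT iI IU Ir0 ir0.
split.
  (* A limit point of resonances lies in the closed piece, hence is regular, yet a punctured
     neighbourhood of a regular point contains no resonance. *)
  right; apply/seteqP; split=> // r lr.
  have Ir : I r.
    apply: cI => B /lr[s [_ [Is _] Bs]]; exists s; split=> //.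
  have [p [Y [e [e0 _ he]]]] := reg r Ir.
  have /lr[s [sr [Is ress] /= se]] : nbhs r [set s | `|s - r| < e].
    apply/nbhs_ballP; exists e => // s; rewrite -ball_normE /= => rs.
    by rewrite distrC.
  apply: ress; rewrite gE//; apply: (he _ _).1.
  by rewrite nm_realB normr_gt0 subr_eq0 sr.
have [k [k1 k2 hk]] := plus_unitary G.
have [j [j1 j2 hj]] := minus_unitary G.
have [a0 [a0k a0d a0r]] := fiber_map sA hL k1 k2 hk.
have [h hh] := fiber_hs sA hL a0d.
pose s0 : R[i] := - (2 * 'i%C * pi%:C).
pose M z := s0 *: (a0 \c (wop (g z) T0 \c g z) \c adjoint a0).
have SE r : I r -> invertible_op (bop_id K + J r \c T0) ->
    scattering_matrix G (perturbed_path F H0 J r) H0 lambda =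
      bop_id (fiber G H0 lambda) + M r%:C /\
    bn (scattering_matrix G (perturbed_path F H0 J r) H0 lambda) <= 1.
  move=> Ir ir; rewrite /M -(gE r Ir).
  exact: (scattering_formula sA hL k1 k2 hk j1 j2 hj a0k a0d a0r (sJ r) ir).
(* The neighbourhood shrinks to the regular points, still open and still containing the whole
   piece. *)
exists [set z | U z /\ regular g T0 z], M; split.
- split; last by move=> r Ir; split; [exact: IU|exact: reg].
  by apply/open_complex => z [Uz rz]; exact: (regular_open oU hg hT Uz rz).
- move=> z [Uz [p [Y [e [e0 hY he]]]]].
  apply: (sandwich_meromorphic hh (holo_comp hY (hg z Uz)) e0 (m := p)) => w hw.
  have [_ <-] := he w hw; have w0 : w - z != 0 by case/andP: hw; rewrite nm_gt0.
  have E : (w - z) ^- p *: ((w - z) ^+ p *: wop (g w) T0 \c g w) = wop (g w) T0 \c g w.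
    by rewrite compZl scalerA mulVf ?expf_neq0// scale1r.
  exact: (congr1 (fun X => s0 *: (a0 \c X \c adjoint a0)) (esym E)).
- move=> r Ir /contrapT ir; split; last exact: (SE r Ir ir).1.
  rewrite gE// in ir.
  have hf : holo (@bn R K K) (fun z => bop_id K + g z \c T0) r%:C.
    apply: (holoD (bn_seminorm K K)); first exact: (holo_cst (bn_seminorm K K)).
    apply: holo_comp; first exact: hg (IU _ Ir).
    exact: (holo_cst (bn_seminorm K K)).
  have hY := holo_comp (holo_inv hf ir) (hg _ (IU _ Ir)).
  exact: (sandwich_analytic hh hY ltr01).
(* At real non-resonant points S is a contraction, so M = S - 1 has norm at most 2; such points of
   the piece accumulate at r. *)
move=> r Ir _; apply: (@bounded_no_negative_powers _ _ _ _ 2) => e e0.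
have [p [Y [e' [e'0 _ he]]]] := reg r Ir.
have m0 : 0 < Num.min e e' by rewrite lt_min e0.
have [s [Is]] := pI r _ Ir m0; rewrite lt_min => /andP[s1 /andP[s2 s3]].
exists s%:C; first by rewrite nm_realB s1.
have is_ : invertible_op (bop_id K + J s \c T0).
  by rewrite gE//; apply: (he _ _).1; rewrite nm_realB s1.
have [S1 S2] := SE s Is is_.
exact: (bn_sub_id S1 S2).
Qed.
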